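(* Every $\mathfrak{S}$-flat Kisin module is isogenous to a flat Kisin module of type HN.
   Context: Let $K/\mathbb{Q}_p$ be finite with residue field $k$, uniformizer $\pi$, $g=[K:\mathbb{Q}_p]$; $\mathfrak{S}=W(k)[[u]]$, $\varphi(u)=u^p$, $E(u)$ the Eisenstein polynomial, $\mathcal{O}_{\mathcal{E}}$ the $p$-adic completion of $\mathfrak{S}[1/u]$. A Kisin module is a finitely generated $u$-torsion-free $\mathfrak{S}$-module with an isomorphism $\phi:\varphi^*\mathfrak{M}[1/E(u)]\cong\mathfrak{M}[1/E(u)]$ of bounded $E(u)$-height; flat means $\mathfrak{S}$-flat; an isogeny is a morphism of flat Kisin modules which becomes an isomorphism after inverting $p$, and isogeny generates an equivalence relation. A strict subobject of a flat Kisin module is a $\phi$-stable submodule whose quotient is again a flat Kisin module. For flat effective $\mathfrak{M}$, $\deg_{\mathfrak{S}}(\mathfrak{M})$ is defined by $\mathrm{Char}(\mathrm{coker}(\phi:\varphi^*\mathfrak{M}\to\mathfrak{M}))=(E(u)^{\deg_{\mathfrak{S}}\mathfrak{M}})$, extended by Tate twist ($\mathfrak{M}(r)$: Frobenius multiplied by $(c_0^{-1}E(u))^r$, $c_0=E(0)/p$; $\deg_{\mathfrak{S}}\mathfrak{M}=\deg_{\mathfrak{S}}\mathfrak{M}(r)-r\,\mathrm{rk}_{\mathfrak{S}}\mathfrak{M}$); $\mu=\mu_{\mathfrak{S}}=\deg_{\mathfrak{S}}/\mathrm{rk}_{\mathfrak{S}}$. For $p$-torsion Kisin modules: rank = $\mathcal{O}_{\mathcal{E}}$-length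 after $\otimes\mathcal{O}_{\mathcal{E}}$, degree $\frac1g\ell_{\mathbb{Z}_p}(\mathrm{coker}\,\phi)$ (twisted in general), and semi-stable means all nonzero strict subobjects ($\phi$-stable submodules with $u$-torsion-free quotient) have slope $\ge$ the slope. A flat Kisin module $\mathfrak{M}$ is semi-stable if $\mathfrak{M}/p$ is semi-stable. A flat Kisin module $\mathfrak{M}$ is of type HN if it has an increasing filtration $0=\mathfrak{M}_0\subset\mathfrak{M}_1\subset\cdots\subset\mathfrak{M}_r=\mathfrak{M}$ by strict subobjects such that each $\mathfrak{M}_i/\mathfrak{M}_{i-1}$ is a semi-stable flat Kisin module and $\mu(\mathfrak{M}_1/\mathfrak{M}_0)<\mu(\mathfrak{M}_2/\mathfrak{M}_1)<\cdots<\mu(\mathfrak{M}_r/\mathfrak{M}_{r-1})$. *)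

(* Defs.v *)
From HB Require Import structures.
From mathcomp Require Import all_boot all_order all_algebra all_field.
From mathcomp Require Import generic_quotient.
From mathcomp Require Import boolp classical_sets ring.
From Stdlib Require Import Relation_Operators.

Set Implicit Arguments.
Unset Strict Implicit.
Unset Printing Implicit Defensive.

Import GRing.Theory.
Local Open Scope ring_scope.
Local Open Scope quotient_scope.
Local Open Scope classical_set_scope.

(** * Formal power series *)

Record fps (R : Type) := Fps { fcoef : nat -> R }.

HB.instance Definition _ (R : Type) := gen_eqMixin (fps R).
HB.instance Definition _ (R : Type) := gen_choiceMixin (fps R).

Lemma fpsP (R : Type) (f g : fps R) : fcoef f =1 fcoef g -> f = g.
Proof. by case: f; case: g => g f /funext /= ->. Qed.

Section FpsRing.
Variable R : comNzRingType.
Implicit Types f g h : fps R.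

Definition fps_zero : fps R := Fps (fun _ => 0).
Definition fps_add f g : fps R := Fps (fun n => fcoef f n + fcoef g n).
Definition fps_opp f : fps R := Fps (fun n => - fcoef f n).
Definition fps_one : fps R := Fps (fun n => (n == 0%N)%:R).
Definition fps_mul f g : fps R :=
  Fps (fun n => \sum_(i < n.+1) fcoef f i * fcoef g (n - i)%N).

Lemma fps_addA : associative fps_add.
Proof. by move=> f g h; apply: fpsP => n /=; rewrite addrA. Qed.
Lemma fps_addC : commutative fps_add.
Proof. by move=> f g; apply: fpsP => n /=; rewrite addrC. Qed.
Lemma fps_add0 : left_id fps_zero fps_add.
Proof. by move=> f; apply: fpsP => n /=; rewrite add0r. Qed.
Lemma fps_addN : left_inverse fps_zero fps_opp fps_add.
Proof. by move=> f; apply: fpsP => n /=; rewrite addNr. Qed.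

HB.instance Definition _ :=
  GRing.isZmodule.Build (fps R) fps_addA fps_addC fps_add0 fps_addN.

Definition fps_trunc n f : {poly R} := \poly_(i < n) fcoef f i.

Lemma coef_fps_trunc n f i : (i < n)%N -> (fps_trunc n f)`_i = fcoef f i.
Proof. by move=> lt_in; rewrite coef_poly lt_in. Qed.

Lemma fps_mul_trunc n f g i : (i < n)%N ->
  fcoef (fps_mul f g) i = (fps_trunc n f * fps_trunc n g)`_i.
Proof.
move=> lt_in; rewrite coefM /=; apply: eq_bigr => j _.
rewrite !coef_fps_trunc //; first by rewrite (leq_ltn_trans (leq_subr _ _)).
by rewrite (leq_trans (ltn_ord j)).
Qed.

Lemma coefM_eq (P P' Q Q' : {poly R}) n :
    (forall i, (i <= n)%N -> P`_i = P'`_i) ->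
    (forall i, (i <= n)%N -> Q`_i = Q'`_i) ->
  (P * Q)`_n = (P' * Q')`_n.
Proof.
move=> eP eQ; rewrite !coefM; apply: eq_bigr => i _.
by rewrite eP ?eQ ?leq_subr // -ltnS.
Qed.

Lemma fps_mulA : associative fps_mul.
Proof.
move=> f g h; apply: fpsP => n.
rewrite !(@fps_mul_trunc n.+1) //.
transitivity ((fps_trunc n.+1 f * (fps_trunc n.+1 g * fps_trunc n.+1 h))`_n).
  apply: coefM_eq => // i le_in.
  by rewrite coef_fps_trunc ?ltnS // (@fps_mul_trunc n.+1) ?ltnS.
rewrite mulrA; apply: coefM_eq => // i le_in.
by rewrite coef_fps_trunc ?ltnS // (@fps_mul_trunc n.+1) ?ltnS.
Qed.

Lemma fps_mulC : commutative fps_mul.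
Proof.
by move=> f g; apply: fpsP => n; rewrite !(@fps_mul_trunc n.+1) // mulrC.
Qed.

Lemma fps_mul1 : left_id fps_one fps_mul.
Proof.
move=> f; apply: fpsP => n /=; rewrite big_ord_recl /= mul1r subn0 big1 ?addr0 //.
by move=> i _; rewrite mul0r.
Qed.

Lemma fps_mulDl : left_distributive fps_mul fps_add.
Proof.
move=> f g h; apply: fpsP => n /=; rewrite -big_split /=.
by apply: eq_bigr => i _; rewrite mulrDl.
Qed.

Lemma fps_one_neq0 : fps_one != fps_zero.
Proof.
by apply/eqP => /(congr1 (fun f => fcoef f 0%N)) /= /eqP; rewrite oner_eq0.
Qed.

HB.instance Definition _ := GRing.Zmodule_isComNzRing.Build (fps R)
  fps_mulA fps_mulC fps_mul1 fps_mulDl fps_one_neq0.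

Lemma fcoefD f g n : fcoef (f + g) n = fcoef f n + fcoef g n.
Proof. by []. Qed.
Lemma fcoefM f g n :
  fcoef (f * g) n = \sum_(i < n.+1) fcoef f i * fcoef g (n - i)%N.
Proof. by []. Qed.

Definition fpsC (a : R) : fps R := Fps (fun n => if n == 0%N then a else 0).
Definition fpsX : fps R := Fps (fun n => (n == 1%N)%:R).
Definition fps_of_poly (P : {poly R}) : fps R := Fps (fun n => P`_n).

Lemma fpsC_is_zmod : zmod_morphism fpsC.
Proof.
move=> a b; apply: fpsP => n /=; case: (n == 0%N) => //.
by rewrite subr0.
Qed.
Lemma fpsC_is_monoid : monoid_morphism fpsC.
Proof.
split=> [|a b]; apply: fpsP => n.
  by rewrite /=; case: eqP.
rewrite fcoefM /= big_ord_recl /= subn0 big1 ?addr0 => [|i _].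
  by case: (n == 0%N); rewrite ?mulr0.
by rewrite mul0r.
Qed.
HB.instance Definition _ := GRing.isZmodMorphism.Build R (fps R) fpsC fpsC_is_zmod.
HB.instance Definition _ :=
  GRing.isMonoidMorphism.Build R (fps R) fpsC fpsC_is_monoid.

(* sum_n a_n u^n  |->  sum_n sigma(a_n) u^(p n) *)
Definition fps_frob (sigma : R -> R) (p : nat) f : fps R :=
  Fps (fun n => if (p %| n)%N then sigma (fcoef f (n %/ p)%N) else 0).

End FpsRing.

Section FpsFrob.
Variables (R : comNzRingType) (sigma : {rmorphism R -> R}) (p : nat).
Hypothesis p_gt0 : (0 < p)%N.

Lemma fps_frob_is_zmod : zmod_morphism (fps_frob sigma p).
Proof.
move=> f g; apply: fpsP => n /=; case: ifP => // _; last by rewrite subr0.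
by rewrite rmorphB.
Qed.

Lemma fps_frob_is_monoid : monoid_morphism (fps_frob sigma p).
Proof.
split=> [|f g]; apply: fpsP => n.
  rewrite /=; case: ifP => [/dvdnP [m ->]|].
    by rewrite mulnK // muln_eq0 (gtn_eqF p_gt0) orbF rmorph_nat.
  by case: n => //; rewrite dvdn0.
pose F (P : {poly R}) := map_poly sigma P \Po 'X^p.
have coefF m h i : (i < m)%N -> (F (fps_trunc m h))`_i = fcoef (fps_frob sigma p h) i.
  move=> lt_im; rewrite /F coef_comp_poly_Xn //=; case: ifP => // _.
  by rewrite coef_map coef_fps_trunc // (leq_ltn_trans (leq_div _ _)).
transitivity ((F (fps_trunc n.+1 f) * F (fps_trunc n.+1 g))`_n); last first.
  rewrite coefM fcoefM; apply: eq_bigr => i _.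
  by rewrite !coefF // ltnS leq_subr.
rewrite /F -comp_polyM -rmorphM coef_comp_poly_Xn //=; case: ifP => // _.
by rewrite coef_map /= -fps_mul_trunc // ltnS leq_div.
Qed.
End FpsFrob.

(** * Localization T^-1 R *)

Section Localization.
Variables (R : comNzRingType) (T : set R).

(* Multiplicative closure of T: the denominators.  So [loc [set f]] is R[1/f],
   and [loc (~` P)] is the local ring at P when P is a prime ideal. *)
Inductive denom : R -> Prop :=
| denom1 : denom 1
| denomM x y : T x -> denom y -> denom (x * y).

Lemma denom_mul x y : denom x -> denom y -> denom (x * y).
Proof.
move=> dx dy; elim: dx => [|a b Ta db IH]; first by rewrite mul1r.
by rewrite -mulrA; apply: denomM.
Qed.

Lemma denomT x : T x -> denom x.
Proof. by move=> Tx; rewrite -[x]mulr1; apply: denomM => //; apply: denom1. Qed.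

Record fracpair := Fracpair { fnum : R; fden : R; _ : denom fden }.
HB.instance Definition _ := gen_eqMixin fracpair.
HB.instance Definition _ := gen_choiceMixin fracpair.

Lemma fdenP x : denom (fden x). Proof. by case: x. Qed.

Definition fracrel (x y : fracpair) : bool :=
  `[< exists2 w, denom w & w * (fnum x * fden y) = w * (fnum y * fden x) >].

Lemma fracrel_refl : reflexive fracrel.
Proof. by move=> x; apply/asboolP; exists 1; first exact: denom1. Qed.
Lemma fracrel_sym : symmetric fracrel.
Proof. by move=> x y; apply/asboolP/asboolP => -[w dw e]; exists w. Qed.
Lemma fracrel_trans : transitive fracrel.
Proof.
move=> y x z /asboolP[v dv ev] /asboolP[w dw ew]; apply/asboolP.
exists (v * w * fden y); first exact: denom_mul (denom_mul dv dw) (fdenP y).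
transitivity (w * fden z * (v * (fnum x * fden y))); first by ring.
rewrite ev; transitivity (v * fden x * (w * (fnum y * fden z))); first by ring.
by rewrite ew; ring.
Qed.

Canonical fracrel_equiv :=
  EquivRel fracrel fracrel_refl fracrel_sym fracrel_trans.

Definition loc := {eq_quot fracrel}%qT.
HB.instance Definition _ := Choice.on loc.
HB.instance Definition _ := EqQuotient.on loc.

Definition frac (a s : R) (ds : denom s) : loc := \pi_loc (Fracpair a ds).

Lemma fracP (x : loc) : exists a s (ds : denom s), x = frac a ds.
Proof. by elim/quotW: x => -[a s ds]; exists a, s, ds. Qed.

Lemma frac_eq a s (ds : denom s) b t (dt : denom t) :
  frac a ds = frac b dt <-> exists2 w, denom w & w * (a * t) = w * (b * s).
Proof. by split=> [/eqmodP/asboolP | e]; last by apply/eqmodP/asboolP. Qed.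

Definition lnum (x : loc) := fnum (repr x).
Definition lden (x : loc) := fden (repr x).
Definition ldenP (x : loc) : denom (lden x) := fdenP (repr x).

Lemma frac_repr x : x = frac (lnum x) (ldenP x).
Proof.
rewrite -[LHS]reprK /frac; apply/eqmodP/asboolP; exists 1; first exact: denom1.
by [].
Qed.

Definition loc_zero : loc := frac 0 denom1.
Definition loc_one : loc := frac 1 denom1.
Definition loc_opp (x : loc) : loc := frac (- lnum x) (ldenP x).
Definition loc_add (x y : loc) : loc :=
  frac (lnum x * lden y + lnum y * lden x) (denom_mul (ldenP x) (ldenP y)).
Definition loc_mul (x y : loc) : loc :=
  frac (lnum x * lnum y) (denom_mul (ldenP x) (ldenP y)).

Lemma loc_oppE a s (ds : denom s) : loc_opp (frac a ds) = frac (- a) ds.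
Proof.
have /esym/frac_eq [w dw e] := frac_repr (frac a ds).
by apply/frac_eq; exists w => //; rewrite !mulNr !mulrN e.
Qed.

Lemma loc_addE a s (ds : denom s) b t (dt : denom t) :
  loc_add (frac a ds) (frac b dt) = frac (a * t + b * s) (denom_mul ds dt).
Proof.
have /esym/frac_eq [v dv ev] := frac_repr (frac a ds).
have /esym/frac_eq [w dw ew] := frac_repr (frac b dt).
apply/frac_eq; exists (v * w); first exact: denom_mul.
set x := frac a ds in ev *; set y := frac b dt in ew *.
transitivity (w * lden y * t * (v * (lnum x * s))
              + v * lden x * s * (w * (lnum y * t))); first by ring.
by rewrite ev ew; ring.
Qed.

Lemma loc_mulE a s (ds : denom s) b t (dt : denom t) :
  loc_mul (frac a ds) (frac b dt) = frac (a * b) (denom_mul ds dt).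
Proof.
have /esym/frac_eq [v dv ev] := frac_repr (frac a ds).
have /esym/frac_eq [w dw ew] := frac_repr (frac b dt).
apply/frac_eq; exists (v * w); first exact: denom_mul.
set x := frac a ds in ev *; set y := frac b dt in ew *.
transitivity ((v * (lnum x * s)) * (w * (lnum y * t))); first by ring.
by rewrite ev ew; ring.
Qed.

Lemma frac_eq1 a s (ds : denom s) b t (dt : denom t) :
  a * t = b * s -> frac a ds = frac b dt.
Proof. by move=> e; apply/frac_eq; exists 1; [exact: denom1 | rewrite e]. Qed.

Lemma loc_addA : associative loc_add.
Proof.
move=> x y z; have [a [s [ds ->]]] := fracP x; have [b [t [dt ->]]] := fracP y.
have [c [r [dr ->]]] := fracP z; rewrite !loc_addE; apply: frac_eq1; ring.
Qed.
Lemma loc_addC : commutative loc_add.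
Proof.
move=> x y; have [a [s [ds ->]]] := fracP x; have [b [t [dt ->]]] := fracP y.
by rewrite !loc_addE; apply: frac_eq1; ring.
Qed.
Lemma loc_add0 : left_id loc_zero loc_add.
Proof.
move=> x; have [a [s [ds ->]]] := fracP x.
by rewrite !loc_addE; apply: frac_eq1; ring.
Qed.
Lemma loc_addN : left_inverse loc_zero loc_opp loc_add.
Proof.
move=> x; have [a [s [ds ->]]] := fracP x.
by rewrite loc_oppE !loc_addE; apply: frac_eq1; ring.
Qed.
HB.instance Definition _ :=
  GRing.isZmodule.Build loc loc_addA loc_addC loc_add0 loc_addN.

Lemma loc_mulA : associative loc_mul.
Proof.
move=> x y z; have [a [s [ds ->]]] := fracP x; have [b [t [dt ->]]] := fracP y.
have [c [r [dr ->]]] := fracP z; rewrite !loc_mulE; apply: frac_eq1; ring.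
Qed.
Lemma loc_mulC : commutative loc_mul.
Proof.
move=> x y; have [a [s [ds ->]]] := fracP x; have [b [t [dt ->]]] := fracP y.
by rewrite !loc_mulE; apply: frac_eq1; ring.
Qed.
Lemma loc_mul1 : left_id loc_one loc_mul.
Proof.
move=> x; have [a [s [ds ->]]] := fracP x.
by rewrite !loc_mulE; apply: frac_eq1; ring.
Qed.
Lemma loc_mulDl : left_distributive loc_mul loc_add.
Proof.
move=> x y z; have [a [s [ds ->]]] := fracP x; have [b [t [dt ->]]] := fracP y.
have [c [r [dr ->]]] := fracP z; rewrite !(loc_addE, loc_mulE).
by apply: frac_eq1; ring.
Qed.
HB.instance Definition _ := GRing.Zmodule_isComPzRing.Build loc
  loc_mulA loc_mulC loc_mul1 loc_mulDl.

Definition to_loc (a : R) : loc := frac a denom1.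

Lemma to_loc_is_zmod : zmod_morphism to_loc.
Proof.
move=> a b; rewrite /to_loc.
rewrite [RHS](_ : _ = loc_add (frac a denom1) (loc_opp (frac b denom1))) //.
by rewrite loc_oppE loc_addE; apply: frac_eq1; ring.
Qed.
Lemma to_loc_is_monoid : monoid_morphism to_loc.
Proof.
split=> // a b; rewrite [RHS](_ : _ = loc_mul (to_loc a) (to_loc b)) //.
by rewrite loc_mulE; apply: frac_eq1; ring.
Qed.
HB.instance Definition _ := GRing.isZmodMorphism.Build R loc to_loc to_loc_is_zmod.
HB.instance Definition _ :=
  GRing.isMonoidMorphism.Build R loc to_loc to_loc_is_monoid.

End Localization.

Arguments to_loc {R} T a.
Arguments frac {R T} a {s} ds.

(** * Tensor products *)

Section Tensor.
Variables (R A : comPzRingType) (f : {rmorphism R -> A}).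
Variables (N : lmodType A) (M : lmodType R).

(* The A-module N (x)_R M, where R acts on N through f. *)
Record balanced (T : lmodType A) (b : N -> M -> T) : Prop := Balanced {
  balDl : forall n n' m, b (n + n') m = b n m + b n' m;
  balDr : forall n m m', b n (m + m') = b n m + b n m';
  balZ  : forall a n m, b (a *: n) m = a *: b n m;
  bal_mid : forall r n m, b (f r *: n) m = b n (r *: m)
}.

Definition bsum (T : lmodType A) (b : N -> M -> T) (s : seq (N * M)) : T :=
  \sum_(x <- s) b x.1 x.2.

(* Formal sums of pairs are identified when no balanced map to an A-module
   separates them: the universal property is built in. *)
Definition tensrel (s t : seq (N * M)) : bool :=
  `[< forall (T : lmodType A) (b : N -> M -> T), balanced b ->
        bsum b s = bsum b t >].

Lemma tensrel_refl : reflexive tensrel.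
Proof. by move=> s; apply/asboolP. Qed.
Lemma tensrel_sym : symmetric tensrel.
Proof. by move=> s t; apply/asboolP/asboolP => e T b bb; rewrite e. Qed.
Lemma tensrel_trans : transitive tensrel.
Proof.
move=> t s r /asboolP e1 /asboolP e2; apply/asboolP => T b bb.
by rewrite e1 // e2.
Qed.
Canonical tensrel_equiv :=
  EquivRel tensrel tensrel_refl tensrel_sym tensrel_trans.

Definition tens := {eq_quot tensrel}%qT.
HB.instance Definition _ := Choice.on tens.
HB.instance Definition _ := EqQuotient.on tens.

Definition tens_pi (s : seq (N * M)) : tens := \pi_tens s.

Lemma tensP (x : tens) : exists s, x = tens_pi s.
Proof. by elim/quotW: x => s; exists s. Qed.

Lemma tens_eq s t : tens_pi s = tens_pi t <->
  (forall (T : lmodType A) (b : N -> M -> T), balanced b -> bsum b s = bsum b t).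
Proof. by split=> [/eqmodP/asboolP | e]; last by apply/eqmodP/asboolP. Qed.

Lemma repr_tens s : forall (T : lmodType A) (b : N -> M -> T), balanced b ->
  bsum b (repr (tens_pi s)) = bsum b s.
Proof. by apply/tens_eq; rewrite /tens_pi reprK. Qed.

Definition tens_zero : tens := tens_pi [::].
Definition tens_add (x y : tens) : tens := tens_pi (repr x ++ repr y).
Definition tens_scale (a : A) (x : tens) : tens :=
  tens_pi [seq (a *: z.1, z.2) | z <- repr x].
Definition tens_opp (x : tens) : tens := tens_scale (-1) x.

Lemma bsum_cat (T : lmodType A) (b : N -> M -> T) s t : bsum b (s ++ t) = bsum b s + bsum b t.
Proof. by rewrite /bsum big_cat. Qed.
Lemma bsum_scale (T : lmodType A) (b : N -> M -> T) a s : balanced b ->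
  bsum b [seq (a *: z.1, z.2) | z <- s] = a *: bsum b s.
Proof.
move=> bb; rewrite /bsum big_map scaler_sumr; apply: eq_bigr => z _ /=.
exact: balZ.
Qed.

Lemma tens_addE s t : tens_add (tens_pi s) (tens_pi t) = tens_pi (s ++ t).
Proof. by apply/tens_eq => T b bb; rewrite !bsum_cat !repr_tens. Qed.
Lemma tens_scaleE a s :
  tens_scale a (tens_pi s) = tens_pi [seq (a *: z.1, z.2) | z <- s].
Proof. by apply/tens_eq => T b bb; rewrite !bsum_scale // repr_tens. Qed.

Lemma tens_addA : associative tens_add.
Proof.
move=> x y z; have [s ->] := tensP x; have [t ->] := tensP y.
by have [r ->] := tensP z; rewrite !tens_addE catA.
Qed.
Lemma tens_addC : commutative tens_add.
Proof.
move=> x y; have [s ->] := tensP x; have [t ->] := tensP y; rewrite !tens_addE.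
by apply/tens_eq => T b bb; rewrite !bsum_cat addrC.
Qed.
Lemma tens_add0 : left_id tens_zero tens_add.
Proof. by move=> x; have [s ->] := tensP x; rewrite tens_addE. Qed.
Lemma tens_addN : left_inverse tens_zero tens_opp tens_add.
Proof.
move=> x; have [s ->] := tensP x; rewrite /tens_opp tens_scaleE tens_addE.
apply/tens_eq => T b bb.
by rewrite bsum_cat bsum_scale // scaleN1r addNr /bsum big_nil.
Qed.
HB.instance Definition _ :=
  GRing.isZmodule.Build tens tens_addA tens_addC tens_add0 tens_addN.

Lemma tens_scaleA a b x : tens_scale a (tens_scale b x) = tens_scale (a * b) x.
Proof.
have [s ->] := tensP x; rewrite !tens_scaleE; apply/tens_eq => T c bc.
by rewrite !bsum_scale // scalerA.
Qed.
Lemma tens_scale1 : left_id 1 tens_scale.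
Proof.
move=> x; have [s ->] := tensP x; rewrite !tens_scaleE; apply/tens_eq => T c bc.
by rewrite bsum_scale // scale1r.
Qed.
Lemma tens_scaleDr : right_distributive tens_scale +%R.
Proof.
move=> a x y; have [s ->] := tensP x; have [t ->] := tensP y.
rewrite [X in tens_scale a X]tens_addE !tens_scaleE.
by rewrite [RHS]tens_addE map_cat.
Qed.
Lemma tens_scaleDl x : {morph tens_scale^~ x : a b / a + b}.
Proof.
move=> a b; have [s ->] := tensP x; rewrite /= !tens_scaleE.
rewrite [RHS]tens_addE; apply/tens_eq => T c bc.
by rewrite bsum_cat !bsum_scale // scalerDl.
Qed.
HB.instance Definition _ := GRing.Zmodule_isLmodule.Build A tens
  tens_scaleA tens_scale1 tens_scaleDr tens_scaleDl.

(* the elementary tensor n (x) m *)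
Definition ten (n : N) (m : M) : tens := tens_pi [:: (n, m)].

End Tensor.

Section TensorMap.
Variables (R A : comPzRingType) (f : {rmorphism R -> A}).
Variables (N N' : lmodType A) (M M' : lmodType R).
Variables (g : {linear N -> N'}) (h : {linear M -> M'}).

(* g (x) h *)
Definition tens_map (x : tens f N M) : tens f N' M' :=
  tens_pi f [seq (g z.1, h z.2) | z <- repr x].

Lemma balanced_comp (T : lmodType A) (b : N' -> M' -> T) :
  balanced f b -> balanced f (fun n m => b (g n) (h m)).
Proof.
move=> [bDl bDr bZ bm]; split=> *; first by rewrite linearD bDl.
- by rewrite linearD bDr.
- by rewrite linearZ bZ.
by rewrite !linearZ /= bm.
Qed.

Lemma bsum_map (T : lmodType A) (b : N' -> M' -> T) s :
  bsum b [seq (g z.1, h z.2) | z <- s] = bsum (fun n m => b (g n) (h m)) s.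
Proof. by rewrite /bsum big_map. Qed.

Lemma tens_mapE s :
  tens_map (tens_pi f s) = tens_pi f [seq (g z.1, h z.2) | z <- s].
Proof.
by apply/tens_eq => T b bb; rewrite !bsum_map repr_tens //; apply: balanced_comp.
Qed.

Lemma tens_map_is_linear : linear tens_map.
Proof.
move=> a x y; have [s ->] := tensP x; have [t ->] := tensP y.
rewrite [X in tens_map (X + _)]tens_scaleE [X in tens_map X]tens_addE.
rewrite !tens_mapE map_cat [X in _ = X + _]tens_scaleE [RHS]tens_addE.
by rewrite -!map_comp; apply/tens_eq => T b bb;
  rewrite !bsum_cat /bsum !big_map /=; congr (_ + _); apply: eq_bigr => z _;
  rewrite linearZ.
Qed.
HB.instance Definition _ := GRing.isLinear.Build A (tens f N M) (tens f N' M')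
  *:%R tens_map tens_map_is_linear.
End TensorMap.
Arguments tens_map {R A} f {N N' M M'} g h x.
Arguments ten {R A} f {N M} n m.

(* extension of scalars A (x)_R M *)
Definition bchange (R A : comPzRingType) (f : {rmorphism R -> A})
  (M : lmodType R) : lmodType A := tens f A^o M.

Definition bchange_map (R A : comPzRingType) (f : {rmorphism R -> A})
    (M M' : lmodType R) (h : {linear M -> M'}) :
  {linear bchange f M -> bchange f M'} := tens_map f idfun h.

Definition bc1 (R A : comPzRingType) (f : {rmorphism R -> A})
  (M : lmodType R) (m : M) : bchange f M := ten f (1 : A^o) m.

Definition flat (R : comPzRingType) (M : lmodType R) : Prop :=
  forall (N N' : lmodType R) (g : {linear N -> N'}), injective g ->
    injective (tens_map idfun g (idfun : {linear M -> M})).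

(** * Submodules, quotients, length *)

Section Modules.
Variables (R : comPzRingType) (M : lmodType R).

Definition is_submod (P : set M) : Prop :=
  P 0 /\ forall a x y, P x -> P y -> P (a *: x + y).

Definition fingen : Prop :=
  exists s : seq M, forall x : M, exists c : nat -> R,
    x = \sum_(i < size s) c i *: s`_i.

(* c 0 < c 1 < ... < c n *)
Definition submod_chain (n : nat) (c : nat -> set M) : Prop :=
  (forall i, (i <= n)%N -> is_submod (c i)) /\
  (forall i, (i < n)%N -> c i `<` c i.+1).

Definition has_length (n : nat) : Prop :=
  (exists c, submod_chain n c) /\ (forall m c, submod_chain m c -> (m <= n)%N).

(* Total function; only meaningful for modules of finite length. *)
Definition mlength : nat := xget 0%N has_length.

(* Total function; only meaningful for free modules of finite rank. *)
Definition free_rank : nat :=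
  xget 0%N (fun n => exists g : {linear 'rV[R]_n -> M}, bijective g).

End Modules.
Arguments fingen {R} M.
Arguments has_length {R} M n.
Arguments mlength {R} M.
Arguments free_rank {R} M.

Section Quotient.
Variables (R : comPzRingType) (M : lmodType R) (P : set M).

Definition gen_submod (x : M) : Prop := forall Q, is_submod Q -> P `<=` Q -> Q x.

Lemma gen_submodP : is_submod gen_submod.
Proof.
split=> [Q [] //|a x y Px Py Q sQ PQ].
by apply: sQ.2; [apply: Px|apply: Py].
Qed.

Definition quotrel (x y : M) : bool := `[< gen_submod (x - y) >].

Lemma quotrel_refl : reflexive quotrel.
Proof. by move=> x; apply/asboolP; rewrite subrr; case: gen_submodP. Qed.
Lemma quotrel_sym : symmetric quotrel.
Proof.
have H x y : gen_submod (x - y) -> gen_submod (y - x).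
  move=> /((gen_submodP.2 (-1))^~ 0); rewrite scaleN1r opprB addr0.
  by apply; case: gen_submodP.
by move=> x y; apply/asboolP/asboolP; apply: H.
Qed.
Lemma quotrel_trans : transitive quotrel.
Proof.
move=> y x z /asboolP xy /asboolP yz; apply/asboolP.
by have := gen_submodP.2 1 _ _ xy yz; rewrite scale1r addrA subrK.
Qed.
Canonical quotrel_equiv :=
  EquivRel quotrel quotrel_refl quotrel_sym quotrel_trans.

(* M / (submodule generated by P) *)
Definition quotm := {eq_quot quotrel}.
HB.instance Definition _ := Choice.on quotm.
HB.instance Definition _ := EqQuotient.on quotm.

Definition to_quotm (x : M) : quotm := \pi_quotm x.

Lemma to_quotmP (q : quotm) : exists x, q = to_quotm x.
Proof. by elim/quotW: q => x; exists x. Qed.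

Lemma to_quotm_eq x y : to_quotm x = to_quotm y <-> gen_submod (x - y).
Proof. by split=> [/eqmodP/asboolP | e]; last by apply/eqmodP/asboolP. Qed.

Definition quotm_comb (a : R) (p q : quotm) := to_quotm (a *: repr p + repr q).

Lemma quotm_combE a x y :
  quotm_comb a (to_quotm x) (to_quotm y) = to_quotm (a *: x + y).
Proof.
have reprE z : gen_submod (repr (to_quotm z) - z) by apply/to_quotm_eq; rewrite /to_quotm reprK.
apply/to_quotm_eq; rewrite opprD addrACA -scalerBr.
exact: gen_submodP.2.
Qed.

Definition quotm_zero : quotm := to_quotm 0.
Definition quotm_add (p q : quotm) : quotm := quotm_comb 1 p q.
Definition quotm_opp (p : quotm) : quotm := quotm_comb (-1) p quotm_zero.
Definition quotm_scale (a : R) (p : quotm) : quotm := quotm_comb a p quotm_zero.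

Lemma quotm_addE x y : quotm_add (to_quotm x) (to_quotm y) = to_quotm (x + y).
Proof. by rewrite /quotm_add quotm_combE scale1r. Qed.
Lemma quotm_scaleE a x : quotm_scale a (to_quotm x) = to_quotm (a *: x).
Proof. by rewrite /quotm_scale quotm_combE addr0. Qed.
Lemma quotm_oppE x : quotm_opp (to_quotm x) = to_quotm (- x).
Proof. by rewrite /quotm_opp quotm_combE scaleN1r addr0. Qed.

Lemma quotm_addA : associative quotm_add.
Proof.
move=> x y z; have [s ->] := to_quotmP x; have [t ->] := to_quotmP y.
by have [r ->] := to_quotmP z; rewrite !quotm_addE addrA.
Qed.
Lemma quotm_addC : commutative quotm_add.
Proof.
move=> x y; have [s ->] := to_quotmP x; have [t ->] := to_quotmP y.
by rewrite !quotm_addE addrC.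
Qed.
Lemma quotm_add0 : left_id quotm_zero quotm_add.
Proof. by move=> x; have [s ->] := to_quotmP x; rewrite quotm_addE add0r. Qed.
Lemma quotm_addN : left_inverse quotm_zero quotm_opp quotm_add.
Proof.
by move=> x; have [s ->] := to_quotmP x; rewrite quotm_oppE quotm_addE addNr.
Qed.
HB.instance Definition _ :=
  GRing.isZmodule.Build quotm quotm_addA quotm_addC quotm_add0 quotm_addN.

Lemma quotm_scaleA a b x : quotm_scale a (quotm_scale b x) = quotm_scale (a * b) x.
Proof. by have [s ->] := to_quotmP x; rewrite !quotm_scaleE scalerA. Qed.
Lemma quotm_scale1 : left_id 1 quotm_scale.
Proof. by move=> x; have [s ->] := to_quotmP x; rewrite quotm_scaleE scale1r. Qed.
Lemma quotm_scaleDr : right_distributive quotm_scale +%R.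
Proof.
move=> a x y; have [s ->] := to_quotmP x; have [t ->] := to_quotmP y.
rewrite [X in quotm_scale a X]quotm_addE !quotm_scaleE.
by rewrite [RHS]quotm_addE scalerDr.
Qed.
Lemma quotm_scaleDl x : {morph quotm_scale^~ x : a b / a + b}.
Proof.
move=> a b; have [s ->] := to_quotmP x; rewrite /= !quotm_scaleE.
by rewrite [RHS]quotm_addE scalerDl.
Qed.
HB.instance Definition _ := GRing.Zmodule_isLmodule.Build R quotm
  quotm_scaleA quotm_scale1 quotm_scaleDr quotm_scaleDl.

End Quotient.

Section Restriction.
Variables (R A : comPzRingType) (f : {rmorphism R -> A}) (M : lmodType A).

(* M viewed as an R-module *)
Definition restr : Type := let _ := f in M.
HB.instance Definition _ := GRing.Zmodule.on restr.

Definition restr_scale (r : R) (x : restr) : restr := f r *: (x : M).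
Lemma restr_scaleA a b x : restr_scale a (restr_scale b x) = restr_scale (a * b) x.
Proof. by rewrite /restr_scale scalerA rmorphM. Qed.
Lemma restr_scale1 : left_id 1 restr_scale.
Proof. by move=> x; rewrite /restr_scale rmorph1 scale1r. Qed.
Lemma restr_scaleDr : right_distributive restr_scale +%R.
Proof. by move=> a x y; rewrite /restr_scale scalerDr. Qed.
Lemma restr_scaleDl x : {morph restr_scale^~ x : a b / a + b}.
Proof. by move=> a b; rewrite /restr_scale rmorphD scalerDl. Qed.
HB.instance Definition _ := GRing.Zmodule_isLmodule.Build R restr
  restr_scaleA restr_scale1 restr_scaleDr restr_scaleDl.
End Restriction.

(** * Characteristic ideals *)

Section CharIdeal.
Variable R : comNzRingType.
Implicit Types I J P Q : set R.

Definition is_ideal I : Prop := is_submod (I : set R^o).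

Definition prime_ideal P : Prop :=
  [/\ is_ideal P, ~ P 1 & forall x y, P (x * y) -> P x \/ P y].

Definition height1 P : Prop :=
  [/\ prime_ideal P,
      exists2 Q, prime_ideal Q & Q `<` P
    & forall Q Q', prime_ideal Q -> prime_ideal Q' -> ~ (Q `<` Q' /\ Q' `<` P)].

Definition principal (a : R) : set R := [set x | exists b, x = b * a].

Definition ideal_mul I J : set R :=
  gen_submod [set x : R^o | exists a b, [/\ I a, J b & x = a * b]].

Definition ideal_exp I (n : nat) : set R := iter n (ideal_mul I) setT.

(* I is the product over the height one primes P of P^n(P), where n(P) is the
   length of the localization C_P over R_P; s lists the P with n(P) > 0. *)
Definition is_char_ideal (C : lmodType R) (I : set R) : Prop :=
  exists (s : seq (set R)) (n : set R -> nat),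
    [/\ uniq s,
        forall P, P \in s <-> height1 P /\ (0 < n P)%N,
        forall P, height1 P -> has_length (bchange (to_loc (~` P)) C) (n P)
      & I = foldr (fun P J => ideal_mul (ideal_exp P (n P)) J) setT s].

End CharIdeal.

(** * p-adic rings *)

Section Padic.
Variable p : nat.

Definition pdvd (A : comPzRingType) (n : nat) (x : A) : Prop :=
  exists y, x = p%:R ^+ n * y.

Definition padic_complete (A : comPzRingType) : Prop :=
  (forall x : A, (forall n, pdvd n x) -> x = 0) /\
  (forall x : nat -> A, (forall n, pdvd n (x n.+1 - x n)) ->
     exists l, forall n, pdvd n (l - x n)).

(* Strict p-rings.  When k is a perfect field of characteristic p there is,
   up to unique isomorphism over k, exactly one, namely W(k); and W(F_p) is
   the ring of p-adic integers. *)
Record strict_p_ring (A : comNzRingType) (k : fieldType)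
    (red : {rmorphism A -> k}) : Prop := StrictPRing {
  spr_reg : forall x : A, p%:R * x = 0 -> x = 0;
  spr_surj : forall c : k, exists x, red x = c;
  spr_ker : forall x : A, red x = 0 <-> pdvd 1 x;
  spr_complete : padic_complete A
}.

(* j identifies B with the inverse limit of the A / p^n A. *)
Record padic_completion (A B : comPzRingType) (j : {rmorphism A -> B}) : Prop :=
  PadicCompletion {
    pc_complete : padic_complete B;
    pc_dense : forall (b : B) n, exists a, pdvd n (b - j a);
    pc_inj : forall (a : A) n, pdvd n (j a) -> pdvd n a
}.

End Padic.

(** * The arithmetic base *)

Definition base_incl (A : idomainType) (L : fieldExtType {fraction A}) (z : A) : L :=
  (tofrac z)%:A.

(* the integral closure of A in L *)
Definition int_closure (A : idomainType) (L : fieldExtType {fraction A}) : set L :=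
  [set x | integralOver (@base_incl A L) x].
Arguments base_incl {A} L z.
Arguments int_closure {A} L _.

Record kisin_base := KisinBase {
  res_char : nat;
  res_char_prime : prime res_char;

  (* Z_p, and K / Q_p finite *)
  Zp : idomainType;
  Zp_red : {rmorphism Zp -> 'F_res_char};
  Zp_strict : strict_p_ring res_char Zp_red;
  Kf : fieldExtType {fraction Zp};

  unif : Kf;
  unif_neq0 : unif != 0;
  unif_int : int_closure Kf unif;
  (* the non-units of O_K form the ideal generated by unif *)
  unifP : forall x, int_closure Kf x ->
    (exists2 y, int_closure Kf y & x = unif * y) <->
    ~ (x != 0 /\ int_closure Kf x^-1);

  (* W(k) with its Frobenius, the unique lift of x |-> x ^ p *)
  kf : finFieldType;
  Wk : idomainType;
  Wk_red : {rmorphism Wk -> kf};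
  Wk_strict : strict_p_ring res_char Wk_red;
  frobW : {rmorphism Wk -> Wk};
  frobWP : forall w, Wk_red (frobW w) = Wk_red w ^+ res_char;

  (* Z_p -> W(k) -> O_K, inducing k = W(k)/p = O_K/(unif) *)
  ZpWk : {rmorphism Zp -> Wk};
  WkK : {rmorphism Wk -> Kf};
  WkK_Zp : forall z, WkK (ZpWk z) = base_incl Kf z;
  WkK_int : forall w, int_closure Kf (WkK w);
  WkK_res_surj : forall x, int_closure Kf x ->
    exists w, exists2 y, int_closure Kf y & x - WkK w = unif * y;
  WkK_res_ker : forall w,
    (exists2 y, int_closure Kf y & WkK w = unif * y) <-> Wk_red w = 0;

  (* The Eisenstein polynomial of unif; its constant term is p times c0. *)
  Eis : {poly Wk};
  Eis_c0 : Wk;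
  Eis_monic : Eis \is monic;
  Eis_lower : forall i, (i < (size Eis).-1)%N -> pdvd res_char 1 Eis`_i;
  Eis_const : Eis`_0 = res_char%:R * Eis_c0;
  Eis_c0_unit : Eis_c0 \is a GRing.unit;
  Eis_root : root (map_poly WkK Eis) unif;

  (* O_E, the p-adic completion of W[[u]][1/u] *)
  OE : comNzRingType;
  toOE : {rmorphism loc [set fpsX Wk] -> OE};
  toOE_completion : padic_completion res_char toOE
}.

Section Kisin.
Variable D : kisin_base.

Definition SS : comNzRingType := fps (Wk D).
Definition uS : SS := fpsX (Wk D).
Definition ES : SS := fps_of_poly (Eis D).
Definition degK : nat := \dim {:Kf D}.

Definition phiS (f : SS) : SS := fps_frob (frobW D) (res_char D) f.
HB.instance Definition _ := GRing.isZmodMorphism.Build SS SS phiS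
  (fps_frob_is_zmod (frobW D) (res_char D)).
HB.instance Definition _ := GRing.isMonoidMorphism.Build SS SS phiS
  (fps_frob_is_monoid (frobW D) (prime_gt0 (res_char_prime D))).

Definition phi_pull (M : lmodType SS) : lmodType SS := bchange phiS M.
Definition invE (M : lmodType SS) : lmodType (loc [set ES]) :=
  bchange (to_loc [set ES]) M.
Definition to_invE (M : lmodType SS) (m : M) : invE M := bc1 (to_loc [set ES]) m.

(* A module with phi : phi^*M[1/E] -> M[1/E]; see [kisin] for the conditions. *)
Record phi_module := PhiModule {
  pm_car :> lmodType SS;
  frob : {linear invE (phi_pull pm_car) -> invE pm_car}
}.

Definition u_torsion_free (M : lmodType SS) : Prop :=
  forall x : M, uS *: x = 0 -> x = 0.

(* E^a phi(phi^* M) is contained in M, and E^b M in phi(phi^* M) *)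
Definition bounded_height (M : phi_module) : Prop :=
  exists a b : nat,
    (forall x : phi_pull M, exists m : M,
       to_loc [set ES] (ES ^+ a) *: frob M (to_invE x) = to_invE m) /\
    (forall m : M, exists x : phi_pull M,
       to_loc [set ES] (ES ^+ b) *: to_invE m = frob M (to_invE x)).

Definition kisin (M : phi_module) : Prop :=
  [/\ fingen M, u_torsion_free M, bijective (frob M) & bounded_height M].

Definition flat_kisin (M : phi_module) : Prop := kisin M /\ flat M.

Definition is_morph (M N : phi_module) (f : {linear M -> N}) : Prop :=
  forall x : invE (phi_pull M),
    frob N (bchange_map (to_loc [set ES]) (bchange_map phiS f) x)
    = bchange_map (to_loc [set ES]) f (frob M x).

Definition isogeny (M N : phi_module) (f : {linear M -> N}) : Prop :=
  is_morph f /\ bijective (bchange_map (to_loc [set (res_char D)%:R]) f).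

Definition isogenous : phi_module -> phi_module -> Prop :=
  clos_refl_sym_trans phi_module (fun M N =>
    [/\ flat_kisin M, flat_kisin N & exists f : {linear M -> N}, isogeny f]).

(* N, through i, is the submodule P with the restricted Frobenius. *)
Definition is_sub (M N : phi_module) (P : set M) (i : {linear N -> M}) : Prop :=
  [/\ is_morph i, injective i & range i = P].

(* Q, through q, is M/P with the induced Frobenius. *)
Definition is_quo (M Q : phi_module) (P : set M) (q : {linear M -> Q}) : Prop :=
  [/\ is_morph q, range q = setT & [set m | q m = 0] = P].

(* phi maps phi^*P[1/E] into P[1/E]: by linearity this is tested on the
   generators 1 (x) m, and P[1/E] consists of the E^(-n) m' with m' in P. *)
Definition phi_stable (M : phi_module) (P : set M) : Prop :=
  forall m, P m -> exists (n : nat) (m' : M), P m' /\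
    to_loc [set ES] (ES ^+ n) *: frob M (to_invE (bc1 phiS m)) = to_invE m'.

Definition strict_flat (M : phi_module) (P : set M) : Prop :=
  [/\ is_submod P, phi_stable P
    & exists (Q : phi_module) (q : {linear M -> Q}), flat_kisin Q /\ is_quo P q].

Definition strict_tors (M : phi_module) (P : set M) : Prop :=
  [/\ is_submod P, phi_stable P & forall x : M, P (uS *: x) -> P x].

(** ** Tate twists, degrees and slopes *)

(* (c0^-1 E)^r *)
Definition twist_coef (r : int) : loc [set ES] :=
  match r with
  | Posz n => to_loc [set ES] (fpsC (Eis_c0 D)^-1 * ES) ^+ n
  | Negz n => (to_loc [set ES] (fpsC (Eis_c0 D)) *
               frac 1 (@denomT SS [set ES] ES erefl)) ^+ n.+1
  end.

Definition twist (M : phi_module) (r : int) : phi_module :=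
  @PhiModule M (twist_coef r \*: frob M).

Definition effective (M : phi_module) : Prop :=
  forall x : phi_pull M, exists m : M, frob M (to_invE x) = to_invE m.

(* coker (phi^* M -> M), for M effective with no E-torsion *)
Definition coker (M : phi_module) : lmodType SS :=
  quotm [set m : M | exists x : phi_pull M, frob M (to_invE x) = to_invE m].

(* The value d does not depend on the twist r making M effective. *)
Definition has_deg_flat (M : phi_module) (d : int) : Prop :=
  exists (r : int) (n : nat), effective (twist M r) /\
    is_char_ideal (coker (twist M r)) (principal (ES ^+ n)) /\
    d = n%:Z - r * (free_rank M)%:Z.

Definition deg_flat (M : phi_module) : int := xget 0 (has_deg_flat M).
Definition slope_flat (M : phi_module) : rat :=
  (deg_flat M)%:~R / (free_rank M)%:R.

Definition rank_tors (M : phi_module) : nat :=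
  mlength (bchange (toOE D \o to_loc [set uS]) M).

Definition has_deg_tors (M : phi_module) (d : rat) : Prop :=
  exists (r : int) (n : nat), effective (twist M r) /\
    has_length (restr (@fpsC (Wk D) \o ZpWk D) (coker (twist M r))) n /\
    d = n%:R / degK%:R - r%:~R * (rank_tors M)%:R.

Definition deg_tors (M : phi_module) : rat := xget 0 (has_deg_tors M).
Definition slope_tors (M : phi_module) : rat := deg_tors M / (rank_tors M)%:R.

Definition p_torsion_kisin (M : phi_module) : Prop :=
  kisin M /\ exists n, forall x : M, (res_char D)%:R ^+ n *: x = 0.

Definition nonzero (M : phi_module) : Prop := exists x : M, x != 0.

Definition semistable_tors (M : phi_module) : Prop :=
  forall (P : set M) (N : phi_module) (i : {linear N -> M}),
    strict_tors P -> is_sub P i -> kisin N -> nonzero N ->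
    slope_tors M <= slope_tors N.

Definition semistable_flat (M : phi_module) : Prop :=
  exists (Q : phi_module) (q : {linear M -> Q}),
    [/\ p_torsion_kisin Q,
        is_quo [set x | exists y, x = (res_char D)%:R *: y] q
      & semistable_tors Q].

(* G is the subquotient P'/P of M *)
Definition is_subquo (M : phi_module) (P P' : set M) (G : phi_module) : Prop :=
  exists (N : phi_module) (i : {linear N -> M}) (q : {linear N -> G}),
    [/\ kisin N, is_sub P' i & is_quo (i @^-1` P) q].

Definition type_HN (M : phi_module) : Prop :=
  exists (r : nat) (F : nat -> set M) (G : nat -> phi_module),
  [/\ F 0%N = [set 0] /\ F r = setT,
      forall i, (i <= r)%N -> strict_flat (F i),
      forall i, (i < r)%N ->
        [/\ F i `<` F i.+1, is_subquo (F i) (F i.+1) (G i), flat_kisin (G i)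
          & semistable_flat (G i)]
    & forall i, (i.+1 < r)%N -> slope_flat (G i) < slope_flat (G i.+1)].

End Kisin.

(* Main.v *)
(* A flat Kisin module is free over W[[u]], hence given by a Frobenius matrix A whose
   determinant divides a power of E(u); its slope is the u-adic valuation of det A mod p,
   divided by the rank and normalised. As in Langton's semistable reduction, choose in the
   isogeny class a lattice for which the destabilising submodule of the reduction mod p
   (smallest slope, then largest rank) has the largest slope, then the smallest rank. In a basis
   lifting one adapted to this submodule, A = [C B; F D] with p dividing B. If B could not
   be removed modulo p^i, the lattice rescaled by diag(1, p^i) would do better; so a p-adic
   limit of base changes makes B vanish. Then C is semi-stable, all submodules of D mod p
   have larger slope, and one continues with D. *)

(* Langton's process modifies a lattice step by step and must be shown to stop; an optimal choice at
   the outset replaces termination by a bound. The determinant of an isogeny divides a power of [p],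
   so it is a unit times [p^j], and [phi] fixes [p]: hence [det A] changes only by a unit, the
   degree is an isogeny invariant, and it bounds the key of the minimal submodule because the whole
   module is itself a candidate. Slopes can be read on the reduction because [E = u^e] modulo [p].
   Stable submodules need not be saturated: [phi] multiplies valuations by [p > 1], so saturation
   can only lower the degree. Rescaling turns [[C, p^i Z; F, D]] into [[C, Z; p^i F, D]], in whose
   reduction [D] is a submodule and [C] the quotient. All submodules of [D] have larger slope than
   [C], so the minimal submodule of the new lattice either beats the old one or projects
   isomorphically onto [C], and in the latter case it splits the extension. The tie-break by rank
   makes the slopes of the filtration strictly increasing. *)
From HB Require Import structures.
From mathcomp Require Import all_boot all_order all_algebra all_field all_fingroup.
From mathcomp Require Import generic_quotient boolp classical_sets ring zify.
From Stdlib Require Import Relation_Operators.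
Require Import Defs.

Set Implicit Arguments.
Unset Strict Implicit.
Unset Printing Implicit Defensive.

Import Order.TTheory GRing.Theory Num.Theory.
Local Open Scope ring_scope.

(** * Power series *)

Section FpsUnit.
Variable R : comNzRingType.
Implicit Types f g h : fps R.

Lemma fcoefB f g n : fcoef (f - g) n = fcoef f n - fcoef g n.
Proof. by []. Qed.

Lemma fcoef0 n : fcoef (0 : fps R) n = 0.
Proof. by []. Qed.

Lemma fcoef1 n : fcoef (1 : fps R) n = (n == 0%N)%:R.
Proof. by []. Qed.

Lemma fcoef_sum (I : Type) (s : seq I) (P : pred I) (F : I -> fps R) n :
  fcoef (\sum_(i <- s | P i) F i) n = \sum_(i <- s | P i) fcoef (F i) n.
Proof.
by elim/big_ind2: _ => // [x1 x2 y1 y2 h1 h2]; rewrite fcoefD h1 h2.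
Qed.

Lemma fcoefC0 (a : R) f n : fcoef (fpsC a * f) n = a * fcoef f n.
Proof.
rewrite fcoefM big_ord_recl /= subn0 big1 ?addr0 // => i _.
by rewrite /= mul0r.
Qed.

Lemma fcoefXM f n :
  fcoef (fpsX R * f) n = if n is m.+1 then fcoef f m else 0.
Proof.
rewrite fcoefM; case: n => [|n]; first by rewrite big_ord1 mul0r.
rewrite 2!big_ord_recl mul0r add0r mul1r big1 ?addr0 => [|i _].
  by rewrite subSS subn0.
by rewrite mul0r.
Qed.

Lemma fcoefXnM k f n :
  fcoef (fpsX R ^+ k * f) n = if (n < k)%N then 0 else fcoef f (n - k)%N.
Proof.
elim: k n => [|k IH] n; first by rewrite expr0 mul1r ltn0 subn0.
rewrite exprS -mulrA fcoefXM; case: n => [//|n].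
by rewrite IH ltnS subSS.
Qed.

Definition fps_shift k f : fps R := Fps (fun n => fcoef f (n + k)%N).

Lemma fps_shiftE k f : (forall i, (i < k)%N -> fcoef f i = 0) ->
  f = fpsX R ^+ k * fps_shift k f.
Proof.
move=> f0; apply: fpsP => n; rewrite fcoefXnM; case: ltnP => [/f0 //|le_kn].
by rewrite /= subnK.
Qed.

Lemma fcoef_eqM f g g' n : (forall i, (i <= n)%N -> fcoef g i = fcoef g' i) ->
  fcoef (f * g) n = fcoef (f * g') n.
Proof.
by move=> e; rewrite !fcoefM; apply: eq_bigr => i _; rewrite e ?leq_subr.
Qed.

Lemma fcoef_exp_lt h k i : fcoef h 0 = 0 -> (i < k)%N -> fcoef (h ^+ k) i = 0.
Proof.
move=> h0 lt_ik; have -> : h = fpsX R ^+ 1 * fps_shift 1 h.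
  by apply: fps_shiftE => -[].
by rewrite expr1 exprMn fcoefXnM lt_ik.
Qed.

Lemma fps_inv_exists f a : a * fcoef f 0 = 1 -> exists g, g * f = 1.
Proof.
move=> af; pose h := 1 - fpsC a * f.
have h0 : fcoef h 0 = 0 by rewrite fcoefB fcoefC0 af fcoef1 subrr.
pose gk k := \sum_(i < k) h ^+ i.
pose g : fps R := Fps (fun n => fcoef (gk n.+1) n).
exists (fpsC a * g); rewrite mulrAC; apply: fpsP => n.
have -> : fpsC a * f = 1 - h by rewrite /h opprB addrCA subrr addr0.
rewrite (@fcoef_eqM _ _ (gk n.+1)).
  rewrite -[1 - h]opprB mulNr -subrX1 opprB fcoefB (fcoef_exp_lt h0) ?subr0 //.
move=> i le_in; change (fcoef (gk i.+1) i = fcoef (gk n.+1) i).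
have -> : gk n.+1 = gk i.+1 + \sum_(j < n - i) h ^+ (i.+1 + j).
  by rewrite /gk -[in LHS](subnKC le_in) -addSn big_split_ord.
rewrite fcoefD [X in _ + X]fcoef_sum [X in _ + X]big1 ?addr0 // => j _.
by rewrite fcoef_exp_lt // ltn_addr.
Qed.

(** Units and inverses are taken classically, so that the unit ring structure exists over any [R];
    [fps_unitE] recovers the criterion on the constant term. *)
Definition fps_unit : pred (fps R) := fun f => `[< exists g, g * f = 1 >].
Definition fps_inv f : fps R :=
  if pselect (exists g, g * f = 1) is left e then projT1 (cid e) else f.

Lemma fps_mulVr : {in fps_unit, left_inverse 1 fps_inv *%R}.
Proof.
move=> f /asboolP uf; rewrite /fps_inv; case: pselect => // e.
by case: cid.
Qed.
Lemma fps_unitP f g : g * f = 1 -> fps_unit f.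
Proof. by move=> e; apply/asboolP; exists g. Qed.
Lemma fps_inv_out : {in [predC fps_unit], fps_inv =1 id}.
Proof.
move=> f; rewrite !inE => nu; rewrite /fps_inv.
by case: pselect => // e; case/negP: nu; apply/asboolP.
Qed.
HB.instance Definition _ := GRing.ComNzRing_hasMulInverse.Build (fps R)
  fps_mulVr fps_unitP fps_inv_out.

End FpsUnit.

Lemma fps_unitE (R : comUnitRingType) (f : fps R) :
  (f \is a GRing.unit) = (fcoef f 0 \is a GRing.unit).
Proof.
apply/idP/idP => [uf|uf0].
  apply/unitrPr; exists (fcoef f^-1 0).
  by have := congr1 (fun f => fcoef f 0) (divrr uf); rewrite fcoefM big_ord1.
have [g gf] := @fps_inv_exists R f (fcoef f 0)^-1 (mulVr uf0).
by apply/unitrPr; exists g; rewrite mulrC.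
Qed.

Section FpsDomain.
Variable R : idomainType.
Implicit Types f g : fps R.

Lemma fps_order f : f != 0 ->
  exists k g, fcoef g 0 != 0 /\ f = fpsX R ^+ k * g.
Proof.
move=> nz; have ex : exists n, fcoef f n != 0.
  apply/not_existsP => f0; case/eqP: nz; apply: fpsP => n.
  by apply/eqP/negPn/negP; exact: f0.
have [k fk kmin] := find_ex_minn ex.
exists k, (fps_shift k f); split=> //; apply: fps_shiftE => i lt_ik.
by apply/eqP/negPn/negP => /kmin; rewrite leqNgt lt_ik.
Qed.

Lemma fps_integral f g : f * g = 0 -> (f == 0) || (g == 0).
Proof.
move=> fg; have [//|/fps_order[k [f' [f'0 fE]]]] := eqVneq f 0.
have [//|/fps_order[l [g' [g'0 gE]]]] := eqVneq g 0.
have /eqP := congr1 (fun f => fcoef f (k + l)) fg.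
rewrite fE gE mulrACA -exprD fcoefXnM ltnn subnn fcoefM big_ord1 fcoef0.
by rewrite mulf_eq0 (negPf f'0) (negPf g'0).
Qed.
HB.instance Definition _ := GRing.ComUnitRing_isIntegral.Build (fps R) fps_integral.

End FpsDomain.

Lemma fpsX_neq0 (R : comNzRingType) : fpsX R != 0.
Proof.
by apply/eqP => /(congr1 (fun f => fcoef f 1)) /eqP; rewrite /= oner_eq0.
Qed.

Lemma fpsX_nunit (R : comUnitRingType) : fpsX R \isn't a GRing.unit.
Proof. by rewrite fps_unitE /= unitr0. Qed.

Section FpsMap.
Variables (R R' : comNzRingType) (f : {rmorphism R -> R'}).

Definition fps_map (x : fps R) : fps R' := Fps (fun n => f (fcoef x n)).

Lemma fps_map_is_zmod : zmod_morphism fps_map.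
Proof. by move=> x y; apply: fpsP => n /=; rewrite rmorphB. Qed.
Lemma fps_map_is_monoid : monoid_morphism fps_map.
Proof.
split=> [|x y]; apply: fpsP => n; first by rewrite /= rmorph_nat.
rewrite /= rmorph_sum; apply: eq_bigr => i _; exact: rmorphM.
Qed.
HB.instance Definition _ :=
  GRing.isZmodMorphism.Build (fps R) (fps R') fps_map fps_map_is_zmod.
HB.instance Definition _ :=
  GRing.isMonoidMorphism.Build (fps R) (fps R') fps_map fps_map_is_monoid.

Lemma fps_mapX : fps_map (fpsX R) = fpsX R'.
Proof. by apply: fpsP => n /=; rewrite rmorph_nat. Qed.

End FpsMap.

(** * Linear algebra over a discrete valuation ring *)

Section Dvr.
Variables (R : idomainType) (t : R).

Definition is_dvr : Prop :=
  [/\ t != 0, t \isn't a GRing.unit &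
   forall x : R, x != 0 -> exists k w, w \is a GRing.unit /\ x = w * t ^+ k].

Hypothesis dvr : is_dvr.

Lemma dvr_exp_inj k l w w' : w \is a GRing.unit -> w' \is a GRing.unit ->
  w * t ^+ k = w' * t ^+ l -> k = l.
Proof.
have [t0 tu _] := dvr.
wlog le_kl : k l w w' / (k <= l)%N => [H uw uw' e|uw uw' e].
  have [le|/ltnW le] := leqP k l; first exact: (H _ _ _ _ le uw uw').
  by symmetry; apply: (H _ _ _ _ le uw' uw).
apply/eqP; rewrite eqn_leq le_kl leqNgt; apply/negP => lt_kl.
case/negP: tu; have /(mulfI (expf_neq0 k t0)) e' :
    t ^+ k * w = t ^+ k * (t * (w' * t ^+ (l - k.+1))).
  rewrite mulrC e; have := subnKC lt_kl; move: (l - k.+1)%N => m <-.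
  by rewrite addSn exprS exprD; ring.
by move: uw; rewrite e' unitrM => /andP[].
Qed.

(** The value at [0] is the default [0] and carries no meaning. *)
Definition val (x : R) : nat :=
  xget 0%N [set k | exists2 w, w \is a GRing.unit & x = w * t ^+ k]%classic.

Lemma valE w k : w \is a GRing.unit -> val (w * t ^+ k) = k.
Proof.
move=> uw; rewrite /val; case: xgetP => [l _ [w' uw' e]|H].
  exact/esym/(dvr_exp_inj uw uw' e).
by case: (H k); exists w.
Qed.

Lemma val_dec x : x != 0 -> exists2 w, w \is a GRing.unit & x = w * t ^+ val x.
Proof.
by move=> x0; have [_ _ /(_ _ x0)[k [w [uw ->]]]] := dvr; exists w; rewrite ?valE.
Qed.

Lemma valM x y : x != 0 -> y != 0 -> val (x * y) = (val x + val y)%N.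
Proof.
move=> /val_dec[v uv ex] /val_dec[w uw ey]; rewrite {1}ex {1}ey mulrACA -exprD.
by rewrite valE // unitrM uv.
Qed.

Lemma val_unit x : x \is a GRing.unit -> val x = 0%N.
Proof. by move=> ux; rewrite -[x]mulr1 -(expr0 t) valE. Qed.

Lemma val0_unit x : x != 0 -> val x = 0%N -> x \is a GRing.unit.
Proof. by move=> /val_dec[w uw {2}->] ->; rewrite mulr1. Qed.

Lemma val_dvd x y : x != 0 -> y != 0 -> (val x <= val y)%N -> exists z, y = z * x.
Proof.
move=> /val_dec[v uv ex] /val_dec[w uw ey] le_xy.
exists (w * v^-1 * t ^+ (val y - val x)); rewrite {2}ex {1}ey.
by rewrite mulrACA -exprD subnK // divrK.
Qed.

Lemma dvr_total (x y : R) : (exists z, y = z * x) \/ (exists z, x = z * y).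
Proof.
have [->|x0] := eqVneq x 0; first by right; exists 0; rewrite mul0r.
have [->|y0] := eqVneq y 0; first by left; exists 0; rewrite mul0r.
have [le|/ltnW le] := leqP (val x) (val y).
  by left; apply: val_dvd.
by right; apply: val_dvd.
Qed.

End Dvr.

Lemma fps_dvr (F : fieldType) : is_dvr (fpsX F).
Proof.
split; [exact: fpsX_neq0 | exact: fpsX_nunit | move=> x /fps_order[k [g [g0 ->]]]].
by exists k, g; rewrite fps_unitE unitfE mulrC.
Qed.

Section Pivot.
Variable R : comPzRingType.
Hypothesis total_dvd : forall x y : R, (exists z, y = z * x) \/ (exists z, x = z * y).

Lemma exists_common_divisor (T : eqType) (f : T -> R) (x0 : T) (s : seq T) :
  exists2 i, i \in x0 :: s & forall j, j \in x0 :: s -> exists z, f j = z * f i.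
Proof.
elim: s x0 => [|x s IH] x0.
  exists x0; rewrite ?mem_head // => j; rewrite inE => /eqP ->.
  by exists 1; rewrite mul1r.
have [i i_s div_i] := IH x; have [[z e]|[z e]] := total_dvd (f x0) (f i).
  exists x0; rewrite ?mem_head // => j; rewrite inE => /orP[/eqP ->|/div_i[w ->]].
    by exists 1; rewrite mul1r.
  by exists (w * z); rewrite e mulrA.
exists i => [|j]; first by rewrite inE i_s orbT.
rewrite inE => /orP[/eqP ->|/div_i //].
by exists z.
Qed.

(** Some entry divides all the others; it is moved to the top and clears the rest. Only total
    divisibility is assumed, so that the lemma also serves the localisation at [(E)], which is
    handled as a mere commutative ring. *)
Lemma pivot_col m (v : 'cV[R]_(1 + m)) :
  exists (L L' : 'M[R]_(1 + m)) (g : 'M[R]_1),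
    [/\ L *m L' = 1%:M, L' *m L = 1%:M & L *m v = col_mx g 0].
Proof.
have [i _ div_i] := exists_common_divisor (fun j => v j 0) ord0 (enum 'I_(1 + m)).
have {}div_i j : exists z, v j 0 = z * v i 0.
  by apply: div_i; rewrite inE mem_enum orbT.
pose s : 'S_(1 + m) := tperm ord0 i.
have [w wdef] : exists w, w = perm_mx s *m v by eexists.
have w0 j : w j 0 = v (s j) 0.
  by rewrite wdef -row_permE mxE.
have div_w j : exists z, w j 0 = z * w ord0 0.
  by rewrite !w0 /s tpermL; apply: div_i.
have [q qE] := choice div_w.
pose Q : 'cV[R]_m := \col_j q (rshift 1 j).
have wE : dsubmx w = Q *m usubmx w.
  apply/matrixP => j k; rewrite [k]ord1 !mxE big_ord1 !mxE qE.
  by congr (_ * w _ _); apply: val_inj.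
pose E : 'M[R]_(1 + m) := block_mx 1%:M 0 (- Q) 1%:M.
pose E' : 'M[R]_(1 + m) := block_mx 1%:M 0 Q 1%:M.
have EE' : E *m E' = 1%:M.
  rewrite /E /E' mulmx_block !mul1mx !mulmx1 !mul0mx !mulmx0 !addr0 addNr add0r.
  by rewrite -scalar_mx_block.
have E'E : E' *m E = 1%:M.
  rewrite /E /E' mulmx_block !mul1mx !mulmx1 !mul0mx !mulmx0 !addr0 addrN add0r.
  by rewrite -scalar_mx_block.
have ss : (perm_mx s : 'M[R]_(1 + m)) *m perm_mx s = 1%:M.
  by rewrite -perm_mxM /s tperm2 perm_mx1.
exists (E *m perm_mx s), (perm_mx s *m E'), (usubmx w); split.
- by rewrite mulmxA -(mulmxA E) ss mulmx1.
- by rewrite mulmxA -(mulmxA _ E') E'E mulmx1.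
rewrite -mulmxA -wdef -[w in E *m w]vsubmxK /E mul_block_col !mul1mx mul0mx addr0.
by rewrite wE mulNmx addNr.
Qed.

End Pivot.

Section Rowinj.
Variable R : idomainType.

Definition rowinj m n (P : 'M[R]_(m, n)) : Prop :=
  forall v : 'rV[R]_m, v *m P = 0 -> v = 0.

Lemma rowinj_mulmx m n k (P : 'M[R]_(m, n)) : rowinj P ->
  forall X Y : 'M[R]_(k, m), X *m P = Y *m P -> X = Y.
Proof.
move=> Pi X Y e; apply/row_matrixP => i; apply/eqP; rewrite -subr_eq0; apply/eqP.
by apply: Pi; rewrite mulmxBl -!row_mul e subrr.
Qed.

(** With more rows than columns, padding by zero columns would give a singular square matrix, hence
    a nonzero row killed by [P]. *)
Lemma rowinj_le m n (P : 'M[R]_(m, n)) : rowinj P -> (m <= n)%N.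
Proof.
move=> Pi; rewrite leqNgt; apply/negP => lt_nm.
have [d dE] : exists d, (m = n + d.+1)%N.
  by exists (m - n).-1; rewrite prednK ?subn_gt0 // subnKC // ltnW.
subst m; pose Q := row_mx P (0 : 'M_(_, d.+1)).
have : \det Q^T == 0.
  apply/det0P; exists (delta_mx 0 (rshift n ord0)).
    apply/eqP => /matrixP /(_ 0 (rshift n ord0)) /eqP.
    by rewrite !mxE !eqxx oner_eq0.
  by rewrite -rowE tr_row_mx rowKd trmx0 row0.
rewrite det_tr => /det0P[v v0 vQ]; case/eqP: v0; apply: Pi.
by move: vQ; rewrite mul_mx_row -row_mx0 => /eq_row_mx[].
Qed.

Lemma rowinj_det n (P : 'M[R]_n) : rowinj P <-> \det P != 0.
Proof.
split=> [Pi|/det0P H v vP].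
  by apply/det0P => -[v v0 vP]; case/eqP: v0; apply: Pi.
by apply/eqP/negPn/negP => v0; apply: H; exists v.
Qed.

Lemma rowinj_mul m n k (P : 'M[R]_(m, n)) (Q : 'M[R]_(n, k)) :
  rowinj P -> rowinj Q -> rowinj (P *m Q).
Proof. by move=> Pi Qi v; rewrite mulmxA => /Qi /Pi. Qed.

Lemma rowinj_inv m n (L : 'M[R]_(m, n)) L' : L *m L' = 1%:M -> rowinj L.
Proof. by move=> LL' v vL; rewrite -[v]mulmx1 -LL' mulmxA vL mul0mx. Qed.

Lemma rowinj_mulr m n k (P : 'M[R]_(m, n)) (Q : 'M[R]_(n, k)) :
  rowinj (P *m Q) -> rowinj P.
Proof. by move=> PQ v vP; apply: PQ; rewrite mulmxA vP mul0mx. Qed.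

Lemma rowinj_block m1 m2 n1 n2 (Y : 'M[R]_(m1, n1)) (Z : 'M_(m1, n2))
    (W : 'M_(m2, n2)) : rowinj Y -> rowinj W -> rowinj (block_mx Y Z 0 W).
Proof.
move=> Yi Wi v; rewrite -[v]hsubmxK mul_row_block mulmx0 addr0.
rewrite -row_mx0 => /eq_row_mx[/Yi ->]; rewrite mul0mx add0r => /Wi ->.
by rewrite row_mx0.
Qed.

Lemma rowinj_dblock m1 m2 n1 n2 (Y : 'M[R]_(m1, n1)) (Z : 'M_(m1, n2))
    (W : 'M_(m2, n2)) : rowinj (block_mx Y Z 0 W) -> rowinj W.
Proof.
move=> Bi v vW; have /Bi : row_mx (0 : 'rV_m1) v *m block_mx Y Z 0 W = 0.
  by rewrite mul_row_block !mul0mx mulmx0 !add0r vW row_mx0.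
by rewrite -[RHS]row_mx0 => /eq_row_mx[].
Qed.

Hypothesis total_dvd : forall x y : R, (exists z, y = z * x) \/ (exists z, x = z * y).

(** Elimination by induction on the columns: a nonzero pivot contributes a row to [Y], a zero one
    leaves all rows to the next column. *)
Lemma row_echelon k m (P : 'M[R]_(m, k)) :
  exists y x (L : 'M[R]_(y + x, m)) (L' : 'M[R]_(m, y + x)) (Y : 'M[R]_(y, k)),
    [/\ L *m L' = 1%:M, L' *m L = 1%:M, L *m P = col_mx Y 0 & rowinj Y].
Proof.
elim: k m P => [|k IH] m P.
  exists 0%N, m, 1%:M, 1%:M, 0; split; rewrite ?mulmx1 //.
    by apply/matrixP => i [].
  by move=> v _; apply/matrixP => i [].
case: m P => [|m] P.
  exists 0%N, 0%N, 1%:M, 1%:M, 0; split; rewrite ?mulmx1 //.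
    by apply/matrixP => -[].
  by move=> v _; apply/matrixP => i [].
have [L [L' [g [LL' L'L Lv]]]] := pivot_col total_dvd (lsubmx (P : 'M_(1 + m, 1 + k))).
pose P' : 'M_(1 + m, k) := L *m rsubmx (P : 'M_(1 + m, 1 + k)).
have LP : L *m (P : 'M_(1 + m, 1 + k)) = row_mx (col_mx g 0) P'.
  by rewrite -[P in LHS](@hsubmxK _ (1 + m) 1 k) mul_mx_row Lv.
have [g0|gn0] := eqVneq (g 0 0) 0.
  have [y [x [L1 [L1' [Y [L1L1' L1'L1 LY Yi]]]]]] := IH _ P'.
  exists y, x, (L1 *m L), (L' *m L1'), (row_mx 0 Y : 'M_(y, 1 + k)); split.
  - by rewrite mulmxA -(mulmxA L1) LL' mulmx1.
  - by rewrite mulmxA -(mulmxA L') L1'L1 mulmx1.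
  - have gE : g = 0 by apply/matrixP => i j; rewrite !ord1 g0 mxE.
    rewrite -mulmxA; transitivity (L1 *m row_mx (0 : 'M_(_, 1)) P').
      by rewrite LP gE col_mx0.
    rewrite mul_mx_row mulmx0 LY.
    transitivity (row_mx (col_mx (0 : 'M_(y, 1)) (0 : 'M_(x, 1))) (col_mx Y 0)).
      by rewrite col_mx0.
    by rewrite -block_mxEh block_mxEv row_mx0.
  - move=> v vY; apply: Yi.
    have : row_mx (v *m (0 : 'M_(y, 1))) (v *m Y) = row_mx 0 0.
      by rewrite -mul_mx_row row_mx0.
    by case/eq_row_mx.
have [y [x [L1 [L1' [Y [L1L1' L1'L1 LY Yi]]]]]] := IH _ (dsubmx P').
pose A : 'M_(1 + (y + x), 1 + m) := block_mx 1%:M 0 0 L1.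
pose A' : 'M_(1 + m, 1 + (y + x)) := block_mx 1%:M 0 0 L1'.
have AA' : A *m A' = 1%:M.
  rewrite /A /A' mulmx_block.
  rewrite !mul1mx !mul0mx !mulmx0 !addr0 add0r L1L1'; exact/esym/scalar_mx_block.
have A'A : A' *m A = 1%:M.
  rewrite /A /A' mulmx_block.
  rewrite !mul1mx !mul0mx !mulmx0 !addr0 add0r L1'L1; exact/esym/scalar_mx_block.
exists y.+1, x, (A *m L), (L' *m A'), (block_mx g (usubmx P') 0 Y : 'M_(1 + y, 1 + k)).
split.
- by rewrite mulmxA -(mulmxA A) LL' mulmx1.
- by rewrite mulmxA -(mulmxA L') A'A mulmx1.
- rewrite -mulmxA; transitivity (A *m row_mx (col_mx g 0) P'); first by rewrite LP.
  rewrite -[P' in LHS]vsubmxK -block_mxEh /A mulmx_block.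
  rewrite !mul1mx !mul0mx !mulmx0 !addr0 !add0r LY block_mxEv.
  have -> : row_mx 0 (col_mx Y 0) = col_mx (row_mx (0 : 'M_(y, 1)) Y) (0 : 'M_(x, 1 + k)).
    transitivity (row_mx (col_mx (0 : 'M_(y, 1)) (0 : 'M_(x, 1))) (col_mx Y (0 : 'M_(x, k)))).
      by rewrite col_mx0.
    by rewrite -block_mxEh block_mxEv row_mx0.
  rewrite col_mxA (eq_irrelevance (esym (addnA 1 y x)) erefl) castmx_id.
  by rewrite -block_mxEv.
- suff : rowinj (block_mx g (usubmx P') 0 Y) by [].
  apply: rowinj_block => // v /matrixP/(_ 0 0); rewrite !mxE big_ord1 => /eqP.
  rewrite mulf_eq0 (negPf gn0) orbF => /eqP v0.
  by apply/matrixP => i j; rewrite !ord1 v0 mxE.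
Qed.

(** A basis of the row span adapted to the coordinates: [Y] spans its projection to the first [r] of
    them, [W] its intersection with the last [s]. *)
Lemma row_echelon2 r s m (P : 'M[R]_(m, r + s)) : rowinj P ->
  exists y x (L : 'M[R]_(y + x, m)) (L' : 'M[R]_(m, y + x))
         (Y : 'M[R]_(y, r)) (Z : 'M[R]_(y, s)) (W : 'M[R]_(x, s)),
    [/\ L *m L' = 1%:M, L' *m L = 1%:M, L *m P = block_mx Y Z 0 W, rowinj Y & rowinj W].
Proof.
move=> Pi; have [y [x [L [L' [Y [LL' L'L LY Yi]]]]]] := row_echelon (lsubmx P).
exists y, x, L, L', Y, (usubmx (L *m rsubmx P)), (dsubmx (L *m rsubmx P)).
have LP : L *m P = block_mx Y (usubmx (L *m rsubmx P)) 0 (dsubmx (L *m rsubmx P)).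
  by rewrite -[P in LHS]hsubmxK mul_mx_row LY block_mxEh vsubmxK.
split=> //; have : rowinj (L *m P) by apply: rowinj_mul (rowinj_inv LL') Pi.
by rewrite LP => /rowinj_dblock.
Qed.

(** Elimination on the columns of [P]. In the coordinates given by [U] the saturation of the row
    span is spanned by the first [r] basis vectors, and [L] is the matrix of the inclusion. *)
Lemma rowinj_saturation r n (P : 'M[R]_(r, n)) : rowinj P ->
  exists s (U : 'M[R]_(n, r + s)) (U' : 'M[R]_(r + s, n)) (L : 'M[R]_r),
    [/\ U *m U' = 1%:M, U' *m U = 1%:M, \det L != 0 & P *m U = row_mx L 0].
Proof.
move=> Pi; have [y [x [L [L' [Y [LL' L'L LY Yi]]]]]] := row_echelon P^T.
have tLL : L^T *m L'^T = 1%:M by rewrite -trmx_mul L'L trmx1.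
have tLL' : L'^T *m L^T = 1%:M by rewrite -trmx_mul LL' trmx1.
have PL : P *m L^T = row_mx Y^T 0.
  by rewrite -[P in LHS]trmxK -trmx_mul LY tr_col_mx trmx0.
have Yi' : rowinj Y^T.
  move=> v vY; have := rowinj_mul Pi (rowinj_inv tLL); apply.
  by rewrite PL mul_mx_row vY mulmx0 row_mx0.
have ey : y = r by apply/eqP; rewrite eqn_leq (rowinj_le Yi) (rowinj_le Yi').
subst y; exists x, L^T, L'^T, Y^T; split=> //.
exact/rowinj_det.
Qed.

End Rowinj.

(** * Slopes of Frobenius matrices over a discrete valuation ring *)

(* The lexicographic order on pairs (degree, rank): by slope, and for equal
   slopes the larger rank comes first. *)
Definition lexle (d r d' r' : nat) : Prop :=
  (d * r' <= d' * r)%N /\ ((d * r')%N = (d' * r)%N -> (r' <= r)%N).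

(** A natural number that orders pairs as [lexle] does: [n! / r] is an integer for [0 < r <= n], so
    the first factors give the slope times [n!], and [n.+1] leaves room for the tie-break
    [n - r]. *)
Definition slope_key (n d r : nat) : nat := (d * (n`! %/ r) * n.+1 + (n - r))%N.

Lemma slope_keyP n d r d' r' : (0 < r <= n)%N -> (0 < r' <= n)%N ->
  (slope_key n d r <= slope_key n d' r')%N -> lexle d r d' r'.
Proof.
move=> rn rn' le_k.
have [a aE] : exists a, n`! = (a * r)%N by apply/dvdnP; apply: dvdn_fact.
have [a' aE'] : exists a, n`! = (a * r')%N by apply/dvdnP; apply: dvdn_fact.
have N0 := fact_gt0 n.
have /andP[r0 le_rn] := rn; have /andP[r'0 le_rn'] := rn'.
move: le_k; rewrite /slope_key {1}aE {1}aE' !mulnK // => le_k.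
have le_a : (d * a <= d' * a')%N.
  rewrite leqNgt; apply/negP => lt_a.
  have : (d' * a' * n.+1 + (n - r') < d * a * n.+1 + (n - r))%N.
    have : ((d' * a').+1 * n.+1 <= d * a * n.+1)%N by rewrite leq_mul2r lt_a orbT.
    by rewrite mulSn; lia.
  by rewrite ltnNge le_k.
have e1 : (d * a * (r * r') = d * r' * n`!)%N by rewrite {1}aE; ring.
have e2 : (d' * a' * (r * r') = d' * r * n`!)%N by rewrite {1}aE'; ring.
have le_d : (d * r' <= d' * r)%N.
  by rewrite -(leq_pmul2r N0) -e1 -e2 leq_mul2r le_a orbT.
split=> // e; have ea : (d * a = d' * a')%N.
  by apply/eqP; rewrite -(eqn_pmul2r (_ : 0 < r * r')%N) ?muln_gt0 ?r0 // e1 e2 e.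
by move: le_k; rewrite ea leq_add2l; lia.
Qed.

Section PhiMatrix.
Variables (R : idomainType) (t : R) (phi : {rmorphism R -> R}) (q : nat).
Hypothesis dvr : is_dvr t.
Hypothesis q_gt1 : (1 < q)%N.
Hypothesis phi_neq0 : forall x, x != 0 -> phi x != 0.
Hypothesis phi_val : forall x, x != 0 -> val t (phi x) = (q * val t x)%N.

Local Notation "P ^p" := (map_mx phi P) (at level 2, format "P ^p").
Local Notation deg A := (val t (\det A)).

(* The rows of P span a submodule stable under v |-> phi(v) A, on which this
   map has matrix C in the basis given by these rows. *)
Definition phi_sub n r (A : 'M[R]_n) (P : 'M[R]_(r, n)) (C : 'M[R]_r) : Prop :=
  rowinj P /\ P^p *m A = C *m P.

(** All stable submodules are compared, saturated or not; saturating can only lower the degree, as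
    computed in [min_sub_block]. *)
Definition lex_bound n (A : 'M[R]_n) (d r : nat) : Prop :=
  forall r' (P : 'M[R]_(r', n)) C, (0 < r')%N -> phi_sub A P C ->
  lexle d r (deg C) r'.

Let detM n (A B : 'M[R]_n) : \det (A *m B) = \det A * \det B.
Proof. exact: det_mulmx. Qed.

Let det_phi n (A : 'M[R]_n) : \det A^p = phi (\det A).
Proof. exact: det_map_mx. Qed.

Let det_lb m n (A : 'M[R]_m) (B : 'M_(n, m)) (C : 'M_n) :
  \det (block_mx A 0 B C) = \det A * \det C.
Proof. exact: det_lblock. Qed.

Let det_ub m n (A : 'M[R]_m) (B : 'M_(m, n)) (C : 'M_n) :
  \det (block_mx A B 0 C) = \det A * \det C.
Proof. exact: det_ublock. Qed.

Lemma mulmx_det_inj m n (L : 'M[R]_m) (X Y : 'M_(m, n)) : \det L != 0 ->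
  L *m X = L *m Y -> X = Y.
Proof.
move=> L0 e; apply/matrixP => i j; apply: (mulfI L0).
have /matrixP/(_ i j) := congr1 (mulmx (\adj L)) e.
by rewrite !mulmxA mul_adj_mx !mul_scalar_mx !mxE.
Qed.

(** Column operations turn [P] into [(L 0)] with [det L] nonzero, and [phi] sends nonzero elements
    to nonzero elements. *)
Lemma rowinj_phi m n (P : 'M[R]_(m, n)) : rowinj P -> rowinj P^p.
Proof.
move=> Pi; have [s [U [U' [L [UU' U'U L0 PU]]]]] := rowinj_saturation (dvr_total dvr) Pi.
move=> v vP; have : v *m (P *m U)^p = 0 by rewrite map_mxM mulmxA vP mul0mx.
rewrite PU map_row_mx map_mx0 mul_mx_row mulmx0 -row_mx0 => /eq_row_mx[vL _].
have : rowinj L^p by apply/rowinj_det; rewrite det_phi; apply: phi_neq0.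
exact.
Qed.

Lemma phi_sub_det n r (A : 'M[R]_n) (P : 'M[R]_(r, n)) C : \det A != 0 ->
  phi_sub A P C -> \det C != 0.
Proof.
move=> /rowinj_det Ai [Pi e]; apply/rowinj_det; apply: (@rowinj_mulr _ _ _ _ _ P).
by rewrite -e; apply: rowinj_mul => //; apply: rowinj_phi.
Qed.

Lemma phi_sub_change n m r (A : 'M[R]_n) (P : 'M[R]_(r, m)) C
    (U : 'M[R]_(n, m)) (U' : 'M[R]_(m, n)) :
  U *m U' = 1%:M -> U' *m U = 1%:M ->
  phi_sub (U'^p *m A *m U) P C -> phi_sub A (P *m U') C.
Proof.
move=> UU' U'U [Pi e]; split; first by apply: rowinj_mul Pi (rowinj_inv U'U).
rewrite map_mxM mulmxA -e -[LHS]mulmx1 -UU' !mulmxA.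
by congr (_ *m _); rewrite -!mulmxA.
Qed.

Lemma lex_bound_change n m (A : 'M[R]_n) (U : 'M[R]_(n, m)) (U' : 'M[R]_(m, n)) d r :
  U *m U' = 1%:M -> U' *m U = 1%:M ->
  lex_bound A d r -> lex_bound (U'^p *m A *m U) d r.
Proof. by move=> UU' U'U bA k P C k0 /(phi_sub_change UU' U'U); apply: bA. Qed.

Lemma exists_min_sub n (A : 'M[R]_n) : (0 < n)%N ->
  exists r (P : 'M[R]_(r, n)) C, [/\ (0 < r)%N, phi_sub A P C &
    forall r' (P' : 'M[R]_(r', n)) C', (0 < r')%N -> phi_sub A P' C' ->
      (slope_key n (deg C) r <= slope_key n (deg C') r')%N].
Proof.
move=> n0; pose p k := `[< exists r (P : 'M[R]_(r, n)) C,
  [/\ (0 < r)%N, phi_sub A P C & k = slope_key n (deg C) r] >].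
have ex : exists k, p k.
  exists (slope_key n (deg A) n); apply/asboolP; exists n, 1%:M, A; split=> //.
  split; first by move=> v; rewrite mulmx1.
  by rewrite map_mx1 mul1mx mulmx1.
have [k /asboolP[r [P [C [r0 s ->]]]] kmin] := find_ex_minn ex.
exists r, P, C; split=> // r' P' C' r'0 s'; apply: kmin; apply/asboolP.
by exists r', P', C'.
Qed.

(** The saturation of the row span is again stable, with matrix [a], and [phi(L) a = C L] gives
    [deg C = deg a + (q - 1) val (det L)]. The lower bound on all stable submodules then forces
    [deg a = deg C]. *)
Lemma min_sub_block n (A : 'M[R]_n) r (P : 'M[R]_(r, n)) C : \det A != 0 ->
  (0 < r)%N -> phi_sub A P C -> lex_bound A (deg C) r ->
  exists s (U : 'M[R]_(n, r + s)) (U' : 'M[R]_(r + s, n)) a c d,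
    [/\ U *m U' = 1%:M, U' *m U = 1%:M, U'^p *m A *m U = block_mx a 0 c d
      & deg a = deg C].
Proof.
move=> A0 r0 sP bA; have [Pi e] := sP.
have [s [U [U' [L [UU' U'U L0 PU]]]]] := rowinj_saturation (dvr_total dvr) Pi.
pose A' := U'^p *m A *m U.
have PE : P = row_mx L 0 *m U' by rewrite -PU -mulmxA UU' mulmx1.
have Lp0 : \det L^p != 0 by rewrite det_phi; apply: phi_neq0.
have eA' : row_mx L^p 0 *m A' = C *m row_mx L 0.
  have -> : row_mx L^p 0 = (row_mx L (0 : 'M_(r, s)))^p.
    by rewrite map_row_mx map_mx0.
  have UUp : U^p *m U'^p = 1%:M by rewrite -map_mxM UU' map_mx1.
  by rewrite /A' -PU map_mxM !mulmxA -(mulmxA P^p) UUp mulmx1 e -!mulmxA.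
rewrite -[A']submxK mul_row_block !mul0mx !addr0 mul_mx_row mulmx0 in eA'.
have [eL eb] := eq_row_mx eA'.
have b0 : ursubmx A' = 0 by apply: (mulmx_det_inj Lp0); rewrite eb mulmx0.
exists s, U, U', (ulsubmx A'), (dlsubmx A'), (drsubmx A'); split=> //.
  by rewrite -b0 submxK.
have sA' : phi_sub A' (row_mx 1%:M 0) (ulsubmx A').
  split=> [v|]; first by rewrite mul_mx_row mulmx1 mulmx0 -row_mx0 => /eq_row_mx[].
  rewrite map_row_mx map_mx1 map_mx0 -[A' in LHS]submxK mul_row_block b0.
  by rewrite !mul1mx !mul0mx !addr0 mul_mx_row mulmx1 mulmx0.
have s1 := phi_sub_change UU' U'U sA'.
have a0 := phi_sub_det A0 s1; have C0 := phi_sub_det A0 sP.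
have [le_d _] := bA _ _ _ r0 s1; rewrite leq_pmul2r // in le_d.
have /(congr1 (val t)) := congr1 determinant eL.
rewrite !detM det_phi !(valM dvr) ?phi_neq0 // phi_val // => ed.
apply/eqP; rewrite eqn_leq le_d andbT.
have : (val t (\det L) <= q * val t (\det L))%N by rewrite leq_pmull // ltnW.
by lia.
Qed.

(** Determinants in [phi(Y) C = C1 Y] give [(q - 1) val (det Y) = 0], so [Y] is invertible and the
    rows of [(Y Z)] span the graph of [X = Y^-1 Z]. Stability of this graph is the equation for
    [X]. *)
Lemma flip_solve r s y (C : 'M[R]_r) (D : 'M[R]_s) B (Y : 'M[R]_(y, r))
    (Z : 'M[R]_(y, s)) C1 : \det C != 0 -> \det C1 != 0 ->
  y = r -> rowinj Y -> Y^p *m C = C1 *m Y -> Y^p *m B + Z^p *m D = C1 *m Z ->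
  deg C1 = deg C -> exists X : 'M[R]_(r, s), B + X^p *m D = C *m X.
Proof.
move=> C0 C10 ey; subst y => /rowinj_det Y0 eC eB dC.
have Yu : Y \in unitmx.
  rewrite unitmxE; apply: (val0_unit dvr Y0).
  have /(congr1 (val t)) := congr1 determinant eC.
  rewrite !detM det_phi !(valM dvr) ?phi_neq0 // phi_val // dC.
  move: (val t (\det Y)) => k; case: k => // k; rewrite mulnS.
  have : (1 * k <= q * k)%N by rewrite leq_mul2r (ltnW q_gt1) orbT.
  by lia.
exists (invmx Y *m Z); apply: (mulmx_det_inj (L := Y^p)).
  by rewrite det_phi phi_neq0.
rewrite mulmxDr !mulmxA -map_mxM !mulmxA mulmxV // mul1mx eB.
by rewrite eC -!mulmxA (mulmxA Y) mulmxV // mul1mx.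
Qed.

Section Block.
Variables (r s : nat) (C : 'M[R]_r) (F : 'M[R]_(s, r)) (D : 'M[R]_s).
Hypotheses (r_gt0 : (0 < r)%N) (C0 : \det C != 0) (D0 : \det D != 0).
Hypothesis bound : lex_bound (block_mx C 0 F D) (deg C) r.

Lemma block_sub_top y (Y : 'M[R]_(y, r)) C1 : phi_sub C Y C1 ->
  phi_sub (block_mx C 0 F D) (row_mx Y 0) C1.
Proof.
move=> [Yi e]; split=> [v|].
  by rewrite mul_mx_row mulmx0 -row_mx0 => /eq_row_mx[/Yi].
by rewrite map_row_mx map_mx0 mul_row_block !mul0mx !mulmx0 !addr0 e mul_mx_row mulmx0.
Qed.

Lemma block_top_slope y (Y : 'M[R]_(y, r)) C1 : (0 < y)%N -> phi_sub C Y C1 ->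
  (deg C * y <= deg C1 * r)%N.
Proof. by move=> y0 /block_sub_top sY; have [] := bound y0 sY. Qed.

(** The preimage of the span of [W] is an extension of it by [C], of rank [r + x > r]. Since [bound]
    prefers the larger rank among equal slopes, a tie is impossible and the inequality is strict. *)
Lemma block_bot_slope x (W : 'M[R]_(x, s)) C2 : (0 < x)%N -> phi_sub D W C2 ->
  (deg C * x < deg C2 * r)%N.
Proof.
move=> x0 sW; have [Wi e] := sW; have C20 := phi_sub_det D0 sW.
have sZ : phi_sub (block_mx C 0 F D) (block_mx 1%:M 0 0 W) (block_mx C 0 (W^p *m F) C2).
  split; first by apply: rowinj_block => // v; rewrite mulmx1.
  rewrite map_block_mx map_mx1 !map_mx0 !mulmx_block.
  by rewrite !mul1mx !mul0mx !mulmx1 !mulmx0 !addr0 !add0r e.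
have rx0 : (0 < r + x)%N by rewrite addn_gt0 r_gt0.
have [le_d eq_d] := bound rx0 sZ.
rewrite det_lb (valM dvr) // in le_d eq_d.
rewrite ltn_neqAle; apply/andP; split; last by lia.
apply/eqP => e'; have : (r + x <= r)%N by apply: eq_d; lia.
by lia.
Qed.

(** Here [D] is the submodule and [C] the quotient. The span of [P] is an extension of its image [Y]
    in [C] by its intersection [W] with [D]; the slope of [Y] is at least that of [C], the slope of
    [W] strictly larger. The key of [C] is therefore reached only if [W] vanishes and [Y] has full
    rank, which is the situation of [flip_solve]. *)
Lemma block_flip B r' (P : 'M[R]_(r', r + s)) C' : (0 < r')%N ->
  phi_sub (block_mx C B 0 D) P C' ->
  lexle (deg C) r (deg C') r' /\
  (lexle (deg C') r' (deg C) r -> exists X : 'M[R]_(r, s), B + X^p *m D = C *m X).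
Proof.
move=> r'0 sP; have [Pi e] := sP.
have A'0 : \det (block_mx C B 0 D) != 0 by rewrite det_ub mulf_neq0.
have C'0 := phi_sub_det A'0 sP.
have [y [x [L [L' [Y [Z [W [LL' L'L LP Yi Wi]]]]]]]] :=
  row_echelon2 (dvr_total dvr) Pi.
have er : (r' = y + x)%N.
  by apply/eqP; rewrite eqn_leq (rowinj_le (rowinj_inv L'L)) (rowinj_le (rowinj_inv LL')).
subst r'; pose C'' := L^p *m C' *m L'.
have e'' : (block_mx Y Z 0 W)^p *m block_mx C B 0 D = C'' *m block_mx Y Z 0 W.
  rewrite -LP map_mxM -mulmxA e /C'' -!mulmxA; congr (_ *m (_ *m _)).
  by rewrite mulmxA L'L mul1mx.
have Lu : \det L \is a GRing.unit.
  by apply/unitrPr; exists (\det L'); rewrite -detM LL' det1.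
(* [C''] is [C'] in another basis of the same submodule; [L] and [L'] have unit determinants. *)
have dC'' : deg C'' = deg C'.
  have := congr1 (fun M => deg M) (erefl (C'' *m L)).
  rewrite {1}/C'' -mulmxA L'L mulmx1 !detM det_phi.
  have L0 : \det L != 0 by apply/eqP => L0; rewrite L0 unitr0 in Lu.
  have L'0 : \det L' != 0.
    by apply: contraTneq (oner_neq0 R) => L'0; rewrite -(det1 R (y + x)) -LL' detM L'0 mulr0 eqxx.
  rewrite !(valM dvr) ?phi_neq0 ?mulf_neq0 ?phi_neq0 // phi_val // (val_unit dvr Lu).
  have -> : val t (\det L') = 0%N.
    by apply: (val_unit dvr); apply/unitrPr; exists (\det L); rewrite -detM L'L det1.
  by lia.
move: dC'' e''; rewrite -[C'']submxK; set c11 := ulsubmx _; set c12 := ursubmx _.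
set c21 := dlsubmx _; set c22 := drsubmx _ => dC''.
rewrite map_block_mx map_mx0 !mulmx_block !mulmx0 !mul0mx !addr0 !add0r.
move=> /eq_block_mx[e11 e12 e21 e22].
(* The intersection with [D] is itself stable: its image in the quotient is zero and the rows of [Y]
   are independent. *)
have c210 : c21 = 0 by apply: (rowinj_mulmx Yi); rewrite -e21 mul0mx.
rewrite c210 mul0mx add0r in e22.
rewrite c210 det_ub in dC''.
have sY : phi_sub C Y c11 by [].
have sW : phi_sub D W c22 by [].
have c110 := phi_sub_det C0 sY; have c220 := phi_sub_det D0 sW.
rewrite (valM dvr) // in dC''.
have ley := rowinj_le Yi.
(* A nonzero intersection with [D] makes the slope strictly larger than that of [C], which excludes
   the reverse comparison. *)
have [x0|x0] := posnP x; last first.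
  have lt2 := block_bot_slope x0 sW.
  have le1 : (deg C * y <= deg c11 * r)%N.
    have [y0|y0] := posnP y; last exact: block_top_slope y0 sY.
    by rewrite [X in (_ * X)%N]y0 muln0.
  have lt : (deg C * (y + x) < deg C' * r)%N by lia.
  split=> [|[]]; first by split; [apply: ltnW|move=> e'; lia].
  by rewrite leqNgt lt.
subst x; rewrite addn0 in r'0.
have d22 : deg c22 = 0%N by rewrite det_mx00 (val_unit dvr) ?unitr1.
have le1 := block_top_slope r'0 sY.
rewrite -dC'' d22 !addn0.
split=> [//|[le2 eq2]].
have ey : y = r.
  by apply/eqP; rewrite eqn_leq ley eq2 //; apply/eqP; rewrite eqn_leq le1 le2.
apply: (flip_solve C0 c110 ey Yi e11 (Z := Z)).
  by rewrite e12 (_ : c12 *m W = 0) ?addr0 //; apply/matrixP => i j; rewrite !mxE big_ord0.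
have e1 : (deg C * y = deg c11 * r)%N by apply/eqP; rewrite eqn_leq le1 le2.
by apply/eqP; rewrite -(eqn_pmul2r r_gt0) -e1 ey.
Qed.
End Block.
End PhiMatrix.

(** * Langton's reduction *)

Section Langton.
Variables (R : idomainType) (t : R) (phib : {rmorphism R -> R}) (q : nat).
Hypothesis dvr : is_dvr t.
Hypothesis q_gt1 : (1 < q)%N.
Hypothesis phib_neq0 : forall x, x != 0 -> phib x != 0.
Hypothesis phib_val : forall x, x != 0 -> val t (phib x) = (q * val t x)%N.

Variables (S : idomainType) (p : S) (phi : {rmorphism S -> S}) (rho : {rmorphism S -> R}).
Hypothesis p_neq0 : p != 0.
Hypothesis phi_p : phi p = p.
Hypothesis rho_surj : forall x, exists y, rho y = x.
Hypothesis rho_ker : forall x, rho x = 0 <-> exists y, x = p * y.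
Hypothesis rho_unit : forall x, rho x \is a GRing.unit -> x \is a GRing.unit.
Hypothesis rho_phi : forall x, rho (phi x) = phib (rho x).
Hypothesis p_separated : forall x : S, (forall n, exists y, x = p ^+ n * y) -> x = 0.
Hypothesis p_complete : forall x : nat -> S,
  (forall n, exists y, x n.+1 - x n = p ^+ n * y) ->
  exists l, forall n, exists y, l - x n = p ^+ n * y.

Local Notation "P ^phi" := (map_mx phi P) (at level 2, format "P ^phi").
Local Notation "P ^rho" := (map_mx rho P) (at level 2, format "P ^rho").
Local Notation deg A := (val t (\det A)).
Local Notation phi_sub := (phi_sub phib).
Local Notation lex_bound := (lex_bound t phib).

Let detM n (A B : 'M[S]_n) : \det (A *m B) = \det A * \det B.
Proof. exact: det_mulmx. Qed.

Let det_phi n (A : 'M[S]_n) : \det A^phi = phi (\det A).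
Proof. exact: det_map_mx. Qed.

Let det_rho n (A : 'M[S]_n) : \det A^rho = rho (\det A).
Proof. exact: det_map_mx. Qed.

Let rho_p : rho p = 0.
Proof. by apply/rho_ker; exists 1; rewrite mulr1. Qed.

Lemma map_rho_phi m n (X : 'M[S]_(m, n)) : X^phi^rho = map_mx phib X^rho.
Proof. by apply/matrixP => i j; rewrite !mxE rho_phi. Qed.

Lemma map_rho_surj m n (X : 'M[R]_(m, n)) : exists Y : 'M[S]_(m, n), Y^rho = X.
Proof.
have [f fE] := choice (fun ij : 'I_m * 'I_n => rho_surj (X ij.1 ij.2)).
by exists (\matrix_(i, j) f (i, j)); apply/matrixP => i j; rewrite !mxE fE.
Qed.

Lemma map_rho_ker m n (X : 'M[S]_(m, n)) : X^rho = 0 -> exists Y, X = p *: Y.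
Proof.
move=> /matrixP X0; have Xd ij : exists y, X ij.1 ij.2 = p * y.
  by apply/rho_ker; have := X0 ij.1 ij.2; rewrite !mxE.
have [f fE] := choice Xd.
by exists (\matrix_(i, j) f (i, j)); apply/matrixP => i j; rewrite !mxE -(fE (i, j)).
Qed.

Lemma mx_separated m n (X : 'M[S]_(m, n)) :
  (forall i, exists Y, X = p ^+ i *: Y) -> X = 0.
Proof.
move=> Xd; apply/matrixP => a b; rewrite mxE; apply: p_separated => i.
by have [Y ->] := Xd i; exists (Y a b); rewrite mxE.
Qed.

Lemma mx_complete m n (X : nat -> 'M[S]_(m, n)) :
  (forall i, exists Y, X i.+1 - X i = p ^+ i *: Y) ->
  exists L, forall i, exists Y, L - X i = p ^+ i *: Y.
Proof.
move=> Xd; have ex (ab : 'I_m * 'I_n) : exists l, forall i, exists y,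
    l - X i ab.1 ab.2 = p ^+ i * y.
  apply: p_complete => i; have [Y /matrixP/(_ ab.1 ab.2)] := Xd i.
  by rewrite !mxE => e; exists (Y ab.1 ab.2).
have [l lE] := choice ex.
exists (\matrix_(a, b) l (a, b)) => i.
have [y yE] := choice (fun ab => lE ab i).
exists (\matrix_(a, b) y (a, b)); apply/matrixP => a b.
by rewrite !mxE -(yE (a, b)).
Qed.

(** [p] is prime because the quotient [R] is a domain; each step strips a [p] off one of the two
    factors. *)
Lemma dvd_p_exp N (x y : S) : x * y = p ^+ N ->
  exists j w, w \is a GRing.unit /\ x = w * p ^+ j.
Proof.
elim: N x y => [|N IH] x y e.
  by exists 0%N, x; rewrite mulr1; split=> //; apply/unitrPr; exists y.
have : rho x * rho y = 0 by rewrite -rmorphM e exprS rmorphM rho_p mul0r.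
move/eqP; rewrite mulf_eq0 => /orP[] /eqP /rho_ker[z zE].
  have [j [w [uw e']]] : exists j w, w \is a GRing.unit /\ z = w * p ^+ j.
    by apply: (IH _ y); apply: (mulfI p_neq0); rewrite -exprS -e zE mulrA.
  by exists j.+1, w; rewrite zE e' exprS mulrCA.
by apply: (IH _ z); apply: (mulfI p_neq0); rewrite -exprS -e zE mulrCA.
Qed.

(* The rows of P span a lattice isogenous to the standard one, on which
   v |-> phi(v) A has matrix A'. *)
Definition sublattice n (A A' : 'M[S]_n) : Prop :=
  exists (P P' : 'M[S]_n) m,
    [/\ P *m P' = (p ^+ m)%:M, P' *m P = (p ^+ m)%:M & P^phi *m A = A' *m P].

Lemma sublattice_refl n (A : 'M[S]_n) : sublattice A A.
Proof. by exists 1%:M, 1%:M, 0%N; split; rewrite ?map_mx1 ?mulmx1 ?mul1mx. Qed.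

Lemma sublattice_trans n (A A' A'' : 'M[S]_n) :
  sublattice A A' -> sublattice A' A'' -> sublattice A A''.
Proof.
move=> [P [P' [m [PP' P'P e]]]] [Q [Q' [l [QQ' Q'Q e']]]].
exists (Q *m P), (P' *m Q'), (m + l)%N; split.
- by rewrite mulmxA -(mulmxA Q) PP' mul_mx_scalar -scalemxAl QQ' scale_scalar_mx -exprD.
- by rewrite mulmxA -(mulmxA P') Q'Q mul_mx_scalar -scalemxAl P'P scale_scalar_mx -exprD addnC.
by rewrite map_mxM -mulmxA e mulmxA e' mulmxA.
Qed.

(** [det P] divides a power of [p], so it is a unit [w] times [p^j]; as [phi] fixes [p], the factor
    [p^j] cancels from [phi(det P) det A = det A' det P]. *)
Lemma sublattice_det n (A A' : 'M[S]_n) : sublattice A A' ->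
  exists v w, [/\ v \is a GRing.unit, w \is a GRing.unit & v * \det A = w * \det A'].
Proof.
move=> [P [P' [m [PP' _ /(congr1 determinant)]]]]; rewrite !detM det_phi => e.
have [|j [w [uw wE]]] := @dvd_p_exp (m * n) (\det P) (\det P').
  by rewrite -detM PP' det_scalar exprM.
exists (phi w), w; split=> //; first exact: rmorph_unit.
apply: (mulfI (expf_neq0 j p_neq0)); move: e.
rewrite wE rmorphM rmorphXn phi_p => e.
by rewrite mulrCA mulrA e; ring.
Qed.

Lemma sublattice_deg n (A A' : 'M[S]_n) : sublattice A A' -> \det A^rho != 0 ->
  \det A'^rho != 0 /\ deg A'^rho = deg A^rho.
Proof.
move=> /sublattice_det[v [w [uv uw /(congr1 rho)]]]; rewrite !det_rho !rmorphM => e A0.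
have v0 : rho v != 0 by apply: contraTneq (rmorph_unit rho uv) => ->; rewrite unitr0.
have w0 : rho w != 0 by apply: contraTneq (rmorph_unit rho uw) => ->; rewrite unitr0.
have A'0 : rho (\det A') != 0.
  by apply: contra_neq A0 => A'0; apply: (mulfI v0); rewrite e A'0 !mulr0.
split=> //; move: e => /(congr1 (val t)).
rewrite !(valM dvr) // (val_unit dvr (rmorph_unit rho uv)).
by rewrite (val_unit dvr (rmorph_unit rho uw)) !add0n.
Qed.

Lemma sublattice_change n (A : 'M[S]_n) U U' : U *m U' = 1%:M ->
  sublattice A (U'^phi *m A *m U).
Proof.
move=> UU'; exists U', U, 0%N; split=> //; first exact: mulmx1C.
by rewrite -mulmxA UU' mulmx1.
Qed.

(* Sublattices preserve the degree, so the keys of minimal submodules are bounded, and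
   one can pick a lattice whose minimal submodule is lexicographically largest. *)
Lemma exists_optimal n (A : 'M[S]_n) : (0 < n)%N -> \det A^rho != 0 ->
  exists A' r (P : 'M[R]_(r, n)) C,
  [/\ sublattice A A', (0 < r)%N, phi_sub A'^rho P C, lex_bound A'^rho (deg C) r &
    forall A'', sublattice A A'' -> exists r' (P' : 'M[R]_(r', n)) C',
      [/\ (0 < r')%N, phi_sub A''^rho P' C' & lexle (deg C') r' (deg C) r]].
Proof.
move=> n0 A0.
have le_n r' (P' : 'M[R]_(r', n)) B C' : (0 < r')%N -> phi_sub B P' C' ->
    (0 < r' <= n)%N by move=> -> [/rowinj_le].
pose is_min A' k := exists r (P : 'M[R]_(r, n)) C,
  [/\ (0 < r)%N, phi_sub A'^rho P C, k = slope_key n (deg C) r &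
    forall r' (P' : 'M[R]_(r', n)) C', (0 < r')%N -> phi_sub A'^rho P' C' ->
      (k <= slope_key n (deg C') r')%N].
have ex_min A' : exists k, is_min A' k.
  have [r [P [C [r0 sP minP]]]] := exists_min_sub t phib A'^rho n0.
  by exists (slope_key n (deg C) r), r, P, C; split.
pose good k := `[< exists A', sublattice A A' /\ is_min A' k >].
have ex : exists k, good k.
  have [k kmin] := ex_min A; exists k; apply/asboolP; exists A; split=> //.
  exact: sublattice_refl.
have bd k : good k -> (k <= slope_key n (deg A^rho) n)%N.
  move=> /asboolP[A' [sA' [r [P [C [r0 sP kE kmin]]]]]].
  have [A'0 <-] := sublattice_deg sA' A0; apply: (kmin n 1%:M _ n0).
  split; first by move=> v; rewrite mulmx1.
  by rewrite map_mx1 mul1mx mulmx1.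
have [k /asboolP[A' [sA' [r [P [C [r0 sP kE kmin]]]]]] kmax] := ex_maxnP ex bd.
exists A', r, P, C; split=> //.
  move=> r' P' C' r'0 sP'; apply: (@slope_keyP n) (le_n _ _ _ _ r0 sP) (le_n _ _ _ _ r'0 sP') _.
  by rewrite -kE; apply: kmin sP'.
move=> A'' sA''; have [k' [r' [P' [C' [r'0 sP' k'E k'min]]]]] := ex_min A''.
exists r', P', C'; split=> //.
apply: (@slope_keyP n) (le_n _ _ _ _ r'0 sP') (le_n _ _ _ _ r0 sP) _.
rewrite -kE -k'E; apply: kmax; apply/asboolP; exists A''; split=> //.
by exists r', P', C'.
Qed.

Lemma block_shear r s (C : 'M[S]_r) B (F : 'M_(s, r)) D (X Y : 'M_(r, s)) :
  block_mx 1%:M X 0 1%:M *m block_mx C B F D *m block_mx 1%:M (- Y) 0 1%:M =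
  block_mx (C + X *m F) (B + X *m D - C *m Y - X *m F *m Y) F (D - F *m Y).
Proof.
rewrite !mulmx_block !mul1mx !mul0mx !mulmx1 !mulmx0 !add0r !addr0 !mulmxN.
rewrite mulmxDl; move: (C *m Y) (X *m F *m Y) (X *m D) (F *m Y) => a b c d.
by congr block_mx; apply/matrixP => i j; rewrite !mxE; ring.
Qed.

(** * Splitting off the minimal submodule by p-adic approximation *)

Section Split.
Variables (r s : nat) (C : 'M[S]_r) (B : 'M[S]_(r, s)) (F : 'M[S]_(s, r)) (D : 'M[S]_s).

(* The upper right block after the base change block_mx 1 Y 0 1; a zero splits off C. *)
Definition obstruction (Y : 'M[S]_(r, s)) : 'M[S]_(r, s) :=
  B + Y^phi *m D - C *m Y - Y^phi *m F *m Y.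

(** The obstruction is quadratic in [Y]. When [Y] and [c] vanish modulo [p], the coefficient of [c]
    reduces to [Z^phi D - C Z], the expression controlled by [block_flip]. *)
Lemma obstructionD (c : S) Y Z : phi c = c ->
  obstruction (Y + c *: Z) = obstruction Y +
    c *: (Z^phi *m D - C *m Z - Z^phi *m F *m Y - Y^phi *m F *m Z - c *: (Z^phi *m F *m Z)).
Proof.
move=> phic; rewrite /obstruction map_mxD map_mxZ phic !mulmxDl !mulmxDr.
rewrite -!scalemxAl -!scalemxAr !scalerBr !scalerA.
move: (Y^phi *m D) (Z^phi *m D) (C *m Y) (C *m Z) => a b d e.
move: (Y^phi *m F *m Y) (Y^phi *m F *m Z) (Z^phi *m F *m Y) (Z^phi *m F *m Z) => g h i j.
by apply/matrixP => x y; rewrite !mxE; ring.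
Qed.

Hypotheses (r_gt0 : (0 < r)%N) (C0 : \det C^rho != 0) (D0 : \det D^rho != 0).
Hypothesis B0 : B^rho = 0.
Hypothesis bound : lex_bound (block_mx C B F D)^rho (deg C^rho) r.
Hypothesis optimal : forall A'', sublattice (block_mx C B F D) A'' ->
  exists r' (P' : 'M[R]_(r', r + s)) C',
    [/\ (0 < r')%N, phi_sub A''^rho P' C' & lexle (deg C') r' (deg C^rho) r].

Let T (Y : 'M[S]_(r, s)) : 'M[S]_(r + s) := block_mx 1%:M Y 0 1%:M.

Let TN Y : T Y *m T (- Y) = 1%:M.
Proof.
rewrite /T mulmx_block !mul1mx !mul0mx !mulmx1 !mulmx0 !add0r !addr0 addNr.
exact/esym/scalar_mx_block.
Qed.

Lemma sublattice_shear Y : sublattice (block_mx C B F D)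
  (block_mx (C + Y^phi *m F) (obstruction Y) F (D - F *m Y)).
Proof.
have := sublattice_change (block_mx C B F D) (mulmx1C (TN Y)).
by rewrite /T map_block_mx map_mx0 !map_mx1 block_shear.
Qed.

(* Conjugating the shear by diag(1, p^(i+1)) gives a sublattice whose reduction is
   block_mx C Z 0 D; by optimality its minimal submodule splits this extension mod p,
   and a splitting is exactly the correction X needed at the next order. *)
Lemma obstruction_step i Y Y1 Z : Y = p *: Y1 -> obstruction Y = p ^+ i.+1 *: Z ->
  exists X Z', obstruction (Y + p ^+ i.+1 *: X) = p ^+ i.+2 *: Z'.
Proof.
move=> YE oE; set c := p ^+ i.+1.
have phic : phi c = c by rewrite rmorphXn phi_p.
have rhoc : rho c = 0 by rewrite /c exprS rmorphM rho_p mul0r.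
have rhoY : Y^rho = 0 by rewrite YE map_mxZ rho_p scale0r.
have rhoYphi : Y^phi^rho = 0 by rewrite map_rho_phi rhoY map_mx0.
pose C' := C + Y^phi *m F; pose D' := D - F *m Y.
have C'E : C'^rho = C^rho by rewrite map_mxD map_mxM rhoYphi mul0mx addr0.
have D'E : D'^rho = D^rho by rewrite map_mxB map_mxM rhoY mulmx0 subr0.
have sA : sublattice (block_mx C B F D) (block_mx C' Z (c *: F) D').
  apply: sublattice_trans (sublattice_shear Y) _.
  exists (block_mx 1%:M 0 0 c%:M), (block_mx c%:M 0 0 1%:M), i.+1; split.
  - rewrite mulmx_block !mul1mx !mulmx1 !mul0mx !mulmx0 !addr0 !add0r -/c.
    exact/esym/scalar_mx_block.
  - rewrite mulmx_block !mul1mx !mulmx1 !mul0mx !mulmx0 !addr0 !add0r -/c.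
    exact/esym/scalar_mx_block.
  rewrite map_block_mx !map_mx0 map_mx1 map_scalar_mx phic !mulmx_block.
  rewrite !mul1mx !mulmx1 !mul0mx !mulmx0 !addr0 !add0r oE.
  by rewrite !mul_scalar_mx !mul_mx_scalar.
have [r' [P' [C1 [r'0 sP lexP]]]] := optimal sA.
rewrite map_block_mx C'E D'E map_mxZ rhoc scale0r in sP.
have bound' : lex_bound (block_mx C^rho 0 F^rho D^rho) (deg C^rho) r.
  by rewrite -B0 -map_block_mx.
have [_ /(_ lexP)[Xb XbE]] :=
  block_flip dvr q_gt1 phib_neq0 phib_val r_gt0 C0 D0 bound' r'0 sP.
have [X XE] := map_rho_surj Xb.
rewrite -XE -map_rho_phi in XbE.
(* Coefficient of [c] in the new obstruction. Modulo [p] both [Y] and [c] vanish, which leaves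
   [Z + X^phi D - C X], zero by the choice of [X]. *)
pose Q := Z + (X^phi *m D - C *m X - X^phi *m F *m Y - Y^phi *m F *m X
               - c *: (X^phi *m F *m X)).
have [|Z' Z'E] := @map_rho_ker _ _ Q.
  rewrite /Q map_mxD !map_mxB map_mxZ !map_mxM rhoYphi rhoY rhoc.
  rewrite !mul0mx mulmx0 scale0r !subr0 addrA XbE subrr //.
exists X, Z'; rewrite obstructionD // oE -scalerDr -/Q Z'E scalerA.
by rewrite [p ^+ i.+2]exprSr.
Qed.

(** The corrections [p^(i+1) X] add up to a limit whose obstruction is divisible by every power of
    [p]. The invariant [good] keeps [Y] divisible by [p], so the base change stays trivial modulo
    [p]. *)
Lemma exists_splitting : exists Y, Y^rho = 0 /\ obstruction Y = 0.
Proof.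
pose good (i : nat) (Y : 'M[S]_(r, s)) :=
  (exists Y1, Y = p *: Y1) /\ exists Z, obstruction Y = p ^+ i.+1 *: Z.
have good0 : good 0%N 0.
  split; first by exists 0; rewrite scaler0.
  have [B1 B1E] := map_rho_ker B0; exists B1.
  rewrite /obstruction map_mx0 !mul0mx !mulmx0 addr0 !subr0 //.
(* The stage is stored with the approximation and its invariant, so that [choice] gives a function
   that can be iterated. *)
have step (iY : {iY : nat * 'M[S]_(r, s) | good iY.1 iY.2}) :
  exists iY' : {iY : nat * 'M[S]_(r, s) | good iY.1 iY.2},
    (sval iY').1 = (sval iY).1.+1 /\
    exists X, (sval iY').2 - (sval iY).2 = p ^+ (sval iY).1.+1 *: X.
  case: iY => -[i Y] /= [[Y1 YE] [Z ZE]].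
  have [X [Z' Z'E]] := obstruction_step YE ZE.
  have g' : good i.+1 (Y + p ^+ i.+1 *: X).
    split; last by exists Z'.
    by exists (Y1 + p ^+ i *: X); rewrite scalerDr scalerA -exprS YE.
  exists (exist (fun iY : nat * 'M[S]_(r, s) => good iY.1 iY.2)
    (i.+1, (Y + p ^+ i.+1 *: X : 'M[S]_(r, s))) g'); split=> //=.
  by exists X; rewrite addrC addKr.
have [f fE] := choice step.
pose x n := iter n f
  (exist (fun iY : nat * 'M[S]_(r, s) => good iY.1 iY.2) (0%N, (0 : 'M[S]_(r, s))) good0).
have x1 n : (sval (x n)).1 = n.
  by elim: n => //= n IH; rewrite (fE (x n)).1 IH.
have [Y YE] : exists L, forall i, exists Z, L - (sval (x i)).2 = p ^+ i *: Z.
  apply: mx_complete => i; have [_ [X ->]] := fE (x i).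
  by exists (p *: X); rewrite x1 scalerA exprSr.
have YE' i : exists Z, Y = (sval (x i)).2 + p ^+ i *: Z.
  by have [Z ZE] := YE i; exists Z; rewrite -ZE addrC subrK.
exists Y; split.
  have [Z ->] := YE' 1%N; have [[Y1 ->] _] := svalP (x 1%N).
  by rewrite map_mxD !map_mxZ rmorphXn rho_p expr1 !scale0r addr0.
apply: mx_separated => i; have [Z ->] := YE' i.
have [_ [Z1]] := svalP (x i); rewrite x1 => Z1E.
rewrite obstructionD ?rmorphXn ?phi_p // Z1E exprSr -scalerA -scalerDr.
by eexists.
Qed.

End Split.

(** * Matrices of type HN *)

Definition semistable_mx n (C : 'M[S]_n) : Prop :=
  forall y (Y : 'M[R]_(y, n)) C1, (0 < y)%N -> phi_sub C^rho Y C1 ->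
  (deg C^rho * y <= deg C1 * n)%N.

(* The last argument constrains the degree and rank of the first block. *)
Inductive mx_HN : forall n, 'M[S]_n -> (nat -> nat -> Prop) -> Prop :=
| mx_HN_nil (A : 'M[S]_0) b : mx_HN A b
| mx_HN_cons r s (C : 'M[S]_r) (F : 'M[S]_(s, r)) (D : 'M[S]_s) (b : nat -> nat -> Prop) :
    (0 < r)%N -> b (deg C^rho) r -> semistable_mx C ->
    mx_HN D (fun d r' => (deg C^rho * r' < d * r)%N) ->
    mx_HN (block_mx C 0 F D) b.

(** Passing to a sublattice of the quotient [D] leaves [C] and the zero block alone; only the gluing
    [F] changes. *)
Lemma sublattice_block r s (C : 'M[S]_r) (F : 'M[S]_(s, r)) (D D' : 'M[S]_s) :
  sublattice D D' -> exists F', sublattice (block_mx C 0 F D) (block_mx C 0 F' D').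
Proof.
move=> [Q [Q' [m [QQ' Q'Q e]]]]; exists (Q^phi *m F).
exists (block_mx 1%:M 0 0 Q), (block_mx (p ^+ m)%:M 0 0 Q'), m; split.
- rewrite mulmx_block !mul1mx !mul0mx !mulmx0 !addr0 !add0r QQ'.
  exact/esym/scalar_mx_block.
- rewrite mulmx_block !mulmx1 !mul0mx !mulmx0 !addr0 !add0r Q'Q.
  exact/esym/scalar_mx_block.
rewrite map_block_mx !map_mx0 map_mx1 !mulmx_block.
by rewrite !mul1mx !mulmx1 !mul0mx !mulmx0 !addr0 !add0r e.
Qed.

(** [b] is a property of all submodules of the reduction that is inherited by larger keys. The first
    block of the optimal lattice has a key at least that of some submodule of the reduction of [A],
    so it satisfies [b]. In the recursive call [b] says that the slope exceeds that of the block
    just split off; this is how the slopes come out strictly increasing. *)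
Theorem exists_mx_HN n (A : 'M[S]_n) (b : nat -> nat -> Prop) : \det A^rho != 0 ->
  (forall d r d' r', (0 < r)%N -> (0 < r')%N -> lexle d r d' r' ->
    b d r -> b d' r') ->
  (forall r (P : 'M[R]_(r, n)) C, (0 < r)%N -> phi_sub A^rho P C -> b (deg C) r) ->
  exists A', sublattice A A' /\ mx_HN A' b.
Proof.
elim/ltn_ind: n A b => n IH A b A0 b_mono b_sub.
have [n0|n0] := posnP n.
  by subst n; exists A; split; [apply: sublattice_refl | constructor].
have [A1 [r [P [Ca [sA r0 sP bound optimal]]]]] := exists_optimal n0 A0.
have [A10 _] := sublattice_deg sA A0.
have [s [U [U' [a [c [d [UU' U'U UAU da]]]]]]] :=
  min_sub_block dvr q_gt1 phib_neq0 phib_val A10 r0 sP bound.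
have en : n = (r + s)%N.
  by apply/eqP; rewrite eqn_leq (rowinj_le (rowinj_inv UU')) (rowinj_le (rowinj_inv U'U)).
subst n.
(* Any lift of [U] is invertible, its determinant being a unit modulo [p]. *)
have [V VE] := map_rho_surj U.
have Vu : V \in unitmx.
  rewrite unitmxE; apply: rho_unit; rewrite -det_rho VE.
  by apply/unitrPr; exists (\det U'); rewrite -det_mulmx UU' det1.
have V'E : (invmx V)^rho = U'.
  rewrite -[LHS]mul1mx -U'U -mulmxA -VE -map_mxM mulmxV // map_mx1 mulmx1 //.
pose A2 := (invmx V)^phi *m A1 *m V.
have sA2 : sublattice A A2.
  exact: sublattice_trans sA (sublattice_change A1 (mulmxV Vu)).
have A2E : A2^rho = block_mx a 0 c d.
  by rewrite -UAU /A2 !map_mxM map_rho_phi V'E VE.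
have bound2 : lex_bound A2^rho (deg a) r.
  rewrite A2E -UAU da; exact: lex_bound_change.
have [A20 _] := sublattice_deg sA2 A0.
have eA2 := submxK A2.
have rhoC : (ulsubmx A2)^rho = a by rewrite map_ulsubmx A2E block_mxKul.
have rhoB : (ursubmx A2)^rho = 0 by rewrite map_ursubmx A2E block_mxKur.
have rhoF : (dlsubmx A2)^rho = c by rewrite map_dlsubmx A2E block_mxKdl.
have rhoD : (drsubmx A2)^rho = d by rewrite map_drsubmx A2E block_mxKdr.
have /andP[a0 d0] : (\det a != 0) && (\det d != 0).
  by move: A20; rewrite A2E det_lblock mulf_eq0 negb_or.
move: (ulsubmx A2) (ursubmx A2) (dlsubmx A2) (drsubmx A2) eA2 rhoC rhoB rhoF rhoD.
move=> C B F D eA2 rhoC rhoB rhoF rhoD; rewrite -eA2 in bound2 sA2.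
have [||||Y [rhoY oY]] := @exists_splitting r s C B F D r0 _ _ rhoB _ _.
- by rewrite rhoC.
- by rewrite rhoD.
- by rewrite rhoC.
(* Optimality is inherited: a sublattice of the block matrix is also a sublattice of [A]. *)
- move=> A'' sA''; have [r' [P' [C' [r'0 sP' lexP]]]] := optimal _ (sublattice_trans sA2 sA'').
  by exists r', P', C'; rewrite rhoC da.
have := sublattice_shear C B F D Y; rewrite oY.
set C3 := C + _; set D3 := D - _ => sA3.
have rhoC3 : C3^rho = a.
  by rewrite map_mxD map_mxM map_rho_phi rhoY map_mx0 mul0mx addr0.
have rhoD3 : D3^rho = d by rewrite map_mxB map_mxM rhoY mulmx0 subr0.
rewrite map_block_mx rhoC rhoB rhoF rhoD in bound2.
have lt_sn : (s < r + s)%N by rewrite -[X in (X < _)%N]add0n ltn_add2r.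
have [|||D4 [sD4 HD4]] := IH s lt_sn D3 (fun d r' => (deg a * r' < d * r)%N).
- by rewrite rhoD3.
- move=> d1 r1 d2 r2 r10 r20 [le12 _] lt1.
  rewrite -(ltn_pmul2r r10) mulnAC; apply: (@leq_trans (d1 * r * r2)).
    by rewrite ltn_pmul2r.
  by rewrite mulnAC [X in (_ <= X)%N]mulnAC leq_mul2r le12 orbT.
- move=> x W C2 x0; rewrite rhoD3 => sW.
  exact: (block_bot_slope dvr q_gt1 phib_neq0 r0 a0 d0 bound2 x0 sW).
have [F4 sA4] := sublattice_block C3 F sD4.
exists (block_mx C3 0 F4 D4); split.
  exact: sublattice_trans (sublattice_trans sA2 sA3) sA4.
constructor => //; rewrite ?rhoC3 //.
  have [r' [P' [C' [r'0 sP' lexP]]]] := optimal _ (sublattice_refl A).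
  by apply: (b_mono _ _ _ _ r'0 r0 _ (b_sub _ _ _ r'0 sP')); rewrite da.
move=> y Y' C1 y0; rewrite rhoC3 => sY.
exact: (block_top_slope bound2 y0 sY).
Qed.
End Langton.

(** * The rings W(k)[[u]] and k[[u]] *)

Section PadicUnits.
Variables (p : nat) (A : comNzRingType).
Hypothesis Ac : padic_complete p A.

Lemma padic_separated (x : A) : (forall n, exists y, x = p%:R ^+ n * y) -> x = 0.
Proof. exact: Ac.1. Qed.

Lemma padic_one_sub (x : A) : exists y, y * (1 - p%:R * x) = 1.
Proof.
have [l lE] : exists l, forall n, pdvd p n (l - \sum_(i < n) (p%:R * x) ^+ i).
  apply: Ac.2 => n; exists (x ^+ n).
  by rewrite big_ord_recr /= addrAC subrr add0r exprMn.
exists l; apply/eqP; rewrite -subr_eq0; apply/eqP; apply: padic_separated => n.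
have [y yE] := lE n; exists (y * (1 - p%:R * x) - x ^+ n).
have -> : l = p%:R ^+ n * y + \sum_(i < n) (p%:R * x) ^+ i by rewrite -yE subrK.
rewrite mulrDl [X in _ + X - 1](_ : _ = 1 - p%:R ^+ n * x ^+ n); first by ring.
by rewrite mulrC -opprB mulNr -subrX1 opprB exprMn.
Qed.

End PadicUnits.

Section StrictRing.
Variables (p : nat) (A : comNzRingType) (k : fieldType) (red : {rmorphism A -> k}).
Hypothesis As : strict_p_ring p red.

Lemma strict_ker (x : A) : red x = 0 <-> exists y, x = p%:R * y.
Proof. exact: spr_ker As x. Qed.

Lemma strict_red_p : red p%:R = 0.
Proof. by apply/strict_ker; exists 1; rewrite mulr1. Qed.

Lemma strict_p_neq0 : p%:R != 0 :> A.
Proof.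
apply/eqP => p0; have /eqP := oner_neq0 A; apply.
by apply: (spr_reg As); rewrite p0 mul0r.
Qed.

(** A lift [y] of the inverse of [red x] gives [y x = 1 - p z], which a geometric series inverts. *)
Lemma strict_unit (x : A) : red x != 0 -> exists y, y * x = 1.
Proof.
move=> x0; have [y yE] := spr_surj As (red x)^-1.
have /strict_ker[z zE] : red (1 - y * x) = 0.
  by rewrite rmorphB rmorph1 rmorphM yE mulVf // subrr.
have [w wE] := padic_one_sub (spr_complete As) z.
by exists (w * y); rewrite -mulrA -[y * x](subKr 1) zE.
Qed.

Lemma fps_separated (x : fps A) :
  (forall n, exists y, x = p%:R ^+ n * y) -> x = 0.
Proof.
move=> xd; apply: fpsP => i; apply: (padic_separated (spr_complete As)) => n.
have [y ->] := xd n; exists (fcoef y i).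
by rewrite -natrX -(rmorph_nat (@fpsC A)) fcoefC0 natrX.
Qed.

Lemma fcoef_pM n (y : fps A) i : fcoef (p%:R ^+ n * y) i = p%:R ^+ n * fcoef y i.
Proof. by rewrite -natrX -(rmorph_nat (@fpsC A)) fcoefC0 natrX. Qed.

Lemma fcoef_p1 (y : fps A) i : fcoef (p%:R * y) i = p%:R * fcoef y i.
Proof. exact: (fcoef_pM 1). Qed.

Lemma fps_complete (x : nat -> fps A) :
  (forall n, exists y, x n.+1 - x n = p%:R ^+ n * y) ->
  exists l, forall n, exists y, l - x n = p%:R ^+ n * y.
Proof.
move=> xd; have ex i : exists l, forall n, pdvd p n (l - fcoef (x n) i).
  apply: (spr_complete As).2 => n; have [y yE] := xd n; exists (fcoef y i).
  by rewrite -fcoefB yE fcoef_pM.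
have [l lE] := choice ex; exists (Fps l) => n.
have [y yE] := choice (fun i => lE i n); exists (Fps y); apply: fpsP => i.
by rewrite fcoef_pM /= yE.
Qed.

Lemma fps_map_surj (x : fps k) : exists y, fps_map red y = x.
Proof.
have [f fE] := choice (fun n => spr_surj As (fcoef x n)).
by exists (Fps f); apply: fpsP => n /=.
Qed.

Lemma fps_map_ker (x : fps A) : fps_map red x = 0 <-> exists y, x = p%:R * y.
Proof.
split=> [x0|[y ->]]; last first.
  apply: fpsP => n; change (red (fcoef (p%:R * y) n) = 0).
  by rewrite fcoef_p1 rmorphM strict_red_p mul0r.
have xd n : exists y, fcoef x n = p%:R * y.
  by apply/strict_ker; have := congr1 (fun f => fcoef f n) x0.
have [y yE] := choice xd; exists (Fps y); apply: fpsP => n.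
by rewrite fcoef_p1 yE.
Qed.

End StrictRing.

Section Base.
Variable D : kisin_base.
Local Notation p := (res_char D).
Local Notation W := (Wk D).
Local Notation k := (kf D).

Definition rhoS : {rmorphism fps W -> fps k} := fps_map (Wk_red D).

Lemma res_char_pchar : p \in [pchar k].
Proof.
rewrite inE res_char_prime /=; apply/eqP.
by rewrite -(strict_red_p (Wk_strict D)) rmorph_nat.
Qed.

Definition phiW : {rmorphism fps W -> fps W} := @phiS D.

Definition phik (x : fps k) : fps k := fps_frob (pFrobenius_aut res_char_pchar) p x.
HB.instance Definition _ := GRing.isZmodMorphism.Build (fps k) (fps k) phik
  (fps_frob_is_zmod (pFrobenius_aut res_char_pchar) p).
HB.instance Definition _ := GRing.isMonoidMorphism.Build (fps k) (fps k) phik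
  (fps_frob_is_monoid (pFrobenius_aut res_char_pchar) (prime_gt0 (res_char_prime D))).

Lemma rhoS_phi x : rhoS (phiW x) = phik (rhoS x).
Proof.
apply: fpsP => n /=; case: ifP => _; last by rewrite rmorph0.
by rewrite frobWP pFrobenius_autE.
Qed.

Lemma phikX : phik (fpsX k) = fpsX k ^+ p.
Proof.
rewrite -[RHS]mulr1; apply: fpsP => n; rewrite fcoefXnM fcoef1 /=.
have p0 := prime_gt0 (res_char_prime D).
case: ifP => [/dvdnP[m ->]|].
  rewrite mulnK //; case: m => [|[|m]].
  - by rewrite mul0n p0 /= pFrobenius_autE expr0n gtn_eqF.
  - by rewrite mul1n ltnn subnn /= pFrobenius_autE expr1n.
  rewrite ifF; last by rewrite mulSn ltnNge leq_addr.
  rewrite [(_ == 1)%N]/= pFrobenius_autE expr0n gtn_eqF //.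
  by rewrite mulSn addKn mulSn addn_eq0 gtn_eqF.
case: ltnP => // le_pn ndiv; case: eqP => // /eqP; rewrite subn_eq0 => le_np.
have e : n = p by apply/eqP; rewrite eqn_leq le_np.
by rewrite e dvdnn in ndiv.
Qed.

Local Notation u := (fpsX k).
Let dvr := fps_dvr k.

Lemma phik_dec w i : phik (w * u ^+ i) = phik w * u ^+ (p * i).
Proof. by rewrite rmorphM rmorphXn /= phikX exprM. Qed.

Lemma phik_neq0 x : x != 0 -> phik x != 0.
Proof.
move=> /(val_dec dvr)[w uw ->]; rewrite phik_dec mulf_neq0 ?expf_neq0 ?fpsX_neq0 //.
by apply/eqP => w0; have /= := rmorph_unit phik uw; rewrite w0 unitr0.
Qed.

Lemma phik_val x : x != 0 -> val u (phik x) = (p * val u x)%N.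
Proof.
move=> /(val_dec dvr)[w uw {1}->]; rewrite phik_dec (valE dvr) //.
exact: rmorph_unit.
Qed.

Lemma rhoS_unit x : rhoS x \is a GRing.unit -> x \is a GRing.unit.
Proof.
rewrite !fps_unitE /= unitfE => /(strict_unit (Wk_strict D))[y yx].
by apply/unitrPr; exists y; rewrite mulrC.
Qed.

Definition Ew : fps W := ES D.
(** The absolute ramification index of [K], by [p_eq_unif]. *)
Definition eE : nat := (size (Eis D)).-1.

(** The Eisenstein condition. It is what turns [E]-degrees into [u]-adic valuations of the
    reduction. *)
Lemma rhoS_E : rhoS Ew = u ^+ eE.
Proof.
apply: fpsP => n; rewrite -[_ ^+ _]mulr1 fcoefXnM fcoef1 /=.
case: ltnP => [/(Eis_lower)|].
  by rewrite /pdvd expr1 => /(strict_ker (Wk_strict D)).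
rewrite leq_eqVlt => /orP[/eqP <-|lt_n].
  by rewrite subnn; have /monicP := Eis_monic D; rewrite /lead_coef => ->; rewrite rmorph1.
rewrite subn_eq0 leqNgt lt_n nth_default ?rmorph0 //.
by move: lt_n; rewrite /eE; case: (size _).
Qed.

(** Invertibility of [A] after [E] is inverted, the matrix form of bounded [E]-height. *)
Definition E_invertible n (A : 'M[fps W]_n) : Prop :=
  exists m b, \det A * b = Ew ^+ m.

Lemma E_invertible_rho n (A : 'M[fps W]_n) : E_invertible A -> \det (map_mx rhoS A) != 0.
Proof.
move=> [m [b /(congr1 rhoS)]]; rewrite rmorphM rmorphXn /= rhoS_E => e.
have -> : \det (map_mx rhoS A) = rhoS (\det A) by exact: det_map_mx.
apply/eqP => A0; move: e; rewrite A0 mul0r => /esym/eqP.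
by rewrite !expf_eq0 (negPf (fpsX_neq0 k)) !andbF.
Qed.

Lemma Eis_size : (1 < size (Eis D))%N.
Proof.
rewrite ltnNge; apply/negP => le1; have /monicP := Eis_monic D.
have [s0|s1] : size (Eis D) = 0%N \/ size (Eis D) = 1%N.
  by case: (size _) le1 => [|[]]; [left|right|].
  by rewrite /lead_coef s0 nth_default ?s0 // => /esym/eqP; rewrite oner_eq0.
rewrite /lead_coef s1 /= Eis_const => /(congr1 (Wk_red D)).
rewrite rmorphM (strict_red_p (Wk_strict D)) mul0r rmorph1 => /esym/eqP.
by rewrite oner_eq0.
Qed.

Lemma eE_gt0 : (0 < eE)%N.
Proof. by rewrite /eE; have := Eis_size; case: (size _) => [|[]]. Qed.

Definition pS : fps W := p%:R.

Lemma pS_neq0 : pS != 0.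
Proof.
apply/eqP => /(congr1 (fun f => fcoef f 0)) /eqP.
rewrite /pS -[p%:R]mulr1 fcoef_p1 fcoef1 mulr1.
exact/negP/(strict_p_neq0 (Wk_strict D)).
Qed.

Lemma phiW_p : phiW pS = pS. Proof. exact: rmorph_nat. Qed.

Notation base_sublattice := (@sublattice (fps W) pS phiW).
Notation base_HN := (@mx_HN _ u phik (fps W) rhoS).

Lemma base_exists_HN n (A : 'M[fps W]_n) : E_invertible A ->
  exists A', base_sublattice A A' /\ base_HN A' (fun _ _ => True).
Proof.
move=> /E_invertible_rho A0.
apply: (exists_mx_HN (fps_dvr k) (prime_gt1 (res_char_prime D)) phik_neq0 phik_val
  pS_neq0 phiW_p (fps_map_surj (Wk_strict D)) (fps_map_ker (Wk_strict D))
  rhoS_unit rhoS_phi (fps_separated (Wk_strict D)) (fps_complete (Wk_strict D)) A0) => //.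
Qed.

End Base.

(** * The ring of integers of K and the ideal (E(u)) *)

Section Integers.
Variable D : kisin_base.
Local Notation p := (res_char D).
Local Notation W := (Wk D).
Local Notation L := (Kf D).
Local Notation Zp := (Zp D).
Local Notation pi := (unif D).
Local Notation e := (eE D).
Local Notation Ww := (WkK D).

Definition OK (x : L) : Prop := int_closure L x.

Definition incl : {rmorphism Zp -> L} := (in_alg L \o @tofrac Zp)%FUN.

Lemma OKE x : OK x <-> integralOver incl x. Proof. by []. Qed.

Lemma OKD x y : OK x -> OK y -> OK (x + y).
Proof. by rewrite !OKE; apply: integral_add. Qed.
Lemma OKB x y : OK x -> OK y -> OK (x - y).
Proof. by rewrite !OKE; apply: integral_sub. Qed.
Lemma OKM x y : OK x -> OK y -> OK (x * y).
Proof. by rewrite !OKE; apply: integral_mul. Qed.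
Lemma OK_nat n : OK n%:R.
Proof. by rewrite OKE; apply: integral_nat. Qed.
Lemma OK_incl z : OK (incl z).
Proof. by rewrite OKE; apply: integral_id. Qed.
Lemma OKX x n : OK x -> OK (x ^+ n).
Proof.
move=> Ox; elim: n => [|n IH]; first exact: (OK_nat 1).
by rewrite exprS; apply: OKM.
Qed.
Lemma OK_sum n (F : 'I_n -> L) : (forall i, OK (F i)) -> OK (\sum_i F i).
Proof. by move=> OF; elim/big_ind: _ => //; [exact: (OK_nat 0) | exact: OKD]. Qed.

Lemma incl_inj : injective incl.
Proof. by move=> x y /fmorph_inj/eqP; rewrite tofrac_eq => /eqP. Qed.

Lemma pL_neq0 : p%:R != 0 :> L.
Proof.
rewrite -(rmorph_nat incl) -(rmorph0 incl) (inj_eq incl_inj).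
exact: strict_p_neq0 (Zp_strict D).
Qed.

Lemma WkK_ker (w : W) y : OK y -> Ww w = pi * y -> exists w', w = p%:R * w'.
Proof.
move=> Oy wE; apply/(strict_ker (Wk_strict D)); apply/WkK_res_ker.
by exists y.
Qed.

Lemma OK_unit x : OK x -> ~ (exists2 y, OK y & x = pi * y) -> x != 0 /\ OK x^-1.
Proof.
move=> Ox nx; apply: contrapT => nu; apply: nx.
by apply/unifP.
Qed.

(** Solve [E(pi) = 0] for the constant term: [p (c0 + pi z) = - pi^e], and the bracket is a unit of
    the integers of [K] because [c0] is a unit of [W]. *)
Lemma p_eq_unif :
  exists v v', [/\ OK v, OK v', v * v' = 1 & p%:R = pi ^+ e * v].
Proof.
have Opi : OK pi := unif_int D.
have := Eis_root D; rewrite /root horner_coef size_map_poly_id0 => [/eqP|]; last first.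
  by have /monicP -> := Eis_monic D; rewrite rmorph1 oner_neq0.
have := Eis_size D; have := eE_gt0 D; rewrite /eE; case es: (size _) => [|[|n]] //= _ _.
have ei : e = n.+1 by rewrite /eE es.
have /choice[b bE] (i : 'I_n.+1) : exists b, (Eis D)`_i = p%:R * b.
  apply/(strict_ker (Wk_strict D)); apply/(strict_ker (Wk_strict D)).
  have [|y] := @Eis_lower D i; first by rewrite es /=.
  by rewrite expr1 => ->; exists y.
rewrite big_ord_recr /= coef_map /= -ei.
have -> : (Eis D)`_e = 1 by have /monicP := Eis_monic D.
rewrite rmorph1 mul1r ei => sum0.
pose z := \sum_(i < n) Ww (b (lift ord0 i)) * pi ^+ i.
have Oz : OK z by apply: OK_sum => i; apply: OKM; [exact: WkK_int | exact: OKX].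
pose w := Ww (Eis_c0 D) + pi * z.
have wE : p%:R * w = - pi ^+ n.+1.
  apply/eqP; rewrite -addr_eq0; apply/eqP; rewrite -sum0; congr (_ + _).
  rewrite big_ord_recl /= coef_map /= Eis_const rmorphM rmorph_nat expr0 mulr1.
  rewrite /w mulrDr; congr (_ + _); rewrite /z !mulr_sumr; apply: eq_bigr => i _.
  rewrite coef_map /= (bE (lift ord0 i)) rmorphM rmorph_nat /= exprS; ring.
have [||w0 Ow] := @OK_unit w.
- by apply: OKD; [exact: WkK_int | exact: OKM].
(* Otherwise [pi] divides the image of [c0], so [p] divides [c0] in [W], against [c0] being a
   unit. *)
- move=> [y Oy wy]; have [||c0' c0E] := @WkK_ker (Eis_c0 D) (y - z).
  + exact: OKB.
  + by rewrite mulrBr -wy /w addrK.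
  have /(congr1 (Wk_red D)) := c0E; rewrite rmorphM (strict_red_p (Wk_strict D)) mul0r.
  move=> red0; have := rmorph_unit (Wk_red D) (Eis_c0_unit D).
  by rewrite red0 unitr0.
have OKN x : OK x -> OK (- x).
  by move=> Ox; rewrite -[- x]add0r; apply: OKB => //; exact: (OK_nat 0).
exists (- w^-1), (- w); split; try exact: OKN; first by apply/OKN/OKD => //; [exact: WkK_int | exact: OKM].
  by rewrite mulrNN mulVf.
by apply: (mulIf w0); rewrite wE mulrN mulNr mulfVK.
Qed.

(** Modulo [pi^(i+1)] only the term of index [i] survives: later terms carry a higher power of [pi],
    and earlier coefficients are already divisible by [p], hence by [pi^e]. *)
Lemma unif_free_step (c : 'I_e -> W) : \sum_i Ww (c i) * pi ^+ i = 0 ->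
  forall i, exists w, c i = p%:R * w.
Proof.
move=> sum0; have [v [_ [Ov _ _ pE]]] := p_eq_unif; have Opi : OK pi := unif_int D.
suff H n : forall i : 'I_e, (i < n)%N -> exists w, c i = p%:R * w.
  by move=> i; apply: (H i.+1).
elim: n => // n IH i; rewrite ltnS leq_eqVlt => /orP[/eqP ein|]; last exact: IH.
have term (j : 'I_e) : exists2 y, OK y &
    Ww (c j) * pi ^+ j = if j == i then Ww (c i) * pi ^+ i else pi ^+ i.+1 * y.
  case: eqP => [->|/eqP nji]; first by exists 0 => //; exact: (OK_nat 0).
  have [lt_ij|le_ji] := ltnP i j.
    exists (Ww (c j) * pi ^+ (j - i.+1)).
      by apply: OKM; [exact: WkK_int | exact: OKX].
    by rewrite mulrCA -exprD subnKC.
  have lt_jn : (j < n)%N by rewrite -ein ltn_neqAle le_ji andbT.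
  have [w ->] := IH j lt_jn.
  exists (Ww w * v * pi ^+ (e - i.+1) * pi ^+ j).
    by do !apply: OKM => //; [exact: WkK_int | exact: OKX | exact: OKX].
  rewrite rmorphM rmorph_nat pE.
  have -> : pi ^+ e = pi ^+ i.+1 * pi ^+ (e - i.+1) by rewrite -exprD subnKC.
  ring.
have [f Of fE] : exists2 f, (forall j, OK (f j)) & forall j,
    Ww (c j) * pi ^+ j = if j == i then Ww (c i) * pi ^+ i else pi ^+ i.+1 * f j.
  have /choice[f fE] (j : 'I_e) : exists y, OK y /\
     Ww (c j) * pi ^+ j = if j == i then Ww (c i) * pi ^+ i else pi ^+ i.+1 * y.
    by have [y] := term j; exists y.
  by exists f => j; have [] := fE j.
apply: (@WkK_ker _ (- \sum_(j | j != i) f j)).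
  rewrite -sumrN big_mkcond; apply: OK_sum => j.
  case: ifP => _; last exact: (OK_nat 0).
  by rewrite -[- _]add0r; apply: OKB => //; exact: (OK_nat 0).
apply: (mulIf (expf_neq0 i (unif_neq0 D))).
move: sum0; rewrite (bigD1 i) //= => /eqP; rewrite addr_eq0 => /eqP ->.
rewrite mulrN mulNr; congr (- _); rewrite mulrAC -exprS mulr_sumr.
by apply: eq_bigr => j nji; rewrite fE (negPf nji).
Qed.

(** Divide the relation by [p] and repeat: the coefficients are divisible by every power of [p]. *)
Lemma unif_free (c : 'I_e -> W) : \sum_i Ww (c i) * pi ^+ i = 0 -> forall i, c i = 0.
Proof.
move=> sum0 i; apply: (padic_separated (spr_complete (Wk_strict D))) => n.
elim: n c sum0 i => [|n IH] c sum0 i; first by exists (c i); rewrite mul1r.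
have [d dE] := choice (unif_free_step sum0).
have [|w wE] := IH d _ i.
  apply: (mulfI pL_neq0); rewrite mulr0 -[RHS]sum0 mulr_sumr; apply: eq_bigr => j _.
  by rewrite dE rmorphM rmorph_nat mulrA.
by exists w; rewrite dE wE exprS mulrA.
Qed.

Lemma incl_nonzero_mul (z : Zp) : z != 0 -> exists m y, z * y = p%:R ^+ m.
Proof.
move=> z0; apply: contrapT => H; case/eqP: z0.
apply: (padic_separated (spr_complete (Zp_strict D))) => n.
elim: n => [|n [y yE]]; first by exists z; rewrite mul1r.
have [y0|yn0] := eqVneq (Zp_red D y) 0.
  have /(strict_ker (Zp_strict D))[w wE] := y0.
  by exists w; rewrite yE wE exprSr mulrA.
have [y' yy'] := strict_unit (Zp_strict D) yn0.
by case: H; exists n, y'; rewrite yE -mulrA [y * _]mulrC yy' mulr1.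
Qed.

Lemma frac_numden (a : {fraction Zp}) :
  exists n d : Zp, d != 0 /\ a * tofrac d = tofrac n.
Proof.
elim/quotW: a => x; exists \n_x, \d_x; split; first exact: denom_ratioP.
unlock tofrac; rewrite -[LHS]FracField.pi_mul; apply/eqP.
rewrite FracField.equivf_def /FracField.mulf /= !numden_Ratio ?(oner_neq0, mulr1) //.
- by rewrite mulrC.
all: exact: denom_ratioP.
Qed.

Lemma frac_pM (a : {fraction Zp}) : exists m z, p%:R ^+ m * a = tofrac z.
Proof.
have [n [d [d0 aE]]] := frac_numden a.
have [m [y dy]] := incl_nonzero_mul d0; exists m, (y * n).
rewrite -(rmorph_nat (@tofrac Zp)) -rmorphXn /= -dy !rmorphM /= -aE.
ring.
Qed.

(** If [p^M] clears the denominators of the minimal polynomial [P] of degree [d], the monic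
    polynomial with root [p^M x] has the integral coefficients [p^(M (d - i)) P_i]. *)
Lemma OK_pM (x : L) : exists m, OK (p%:R ^+ m * x).
Proof.
have /polyOver1P[P PE] := minPolyOver 1 x.
have Pm : P \is monic.
  have := monic_minPoly 1 x; by rewrite PE !monicE lead_coef_map fmorph_eq1.
have /choice[m mE] (i : nat) : exists m, exists z, p%:R ^+ m * P`_i = tofrac z.
  exact: frac_pM.
pose d := (size P).-1; pose M := (\sum_(i < d) m i)%N; exists M; rewrite OKE.
have /choice[z zE] (i : nat) : exists z, (i < d)%N -> p%:R ^+ M * P`_i = tofrac z.
  have [lt_id|] := ltnP i d; last by exists 0.
  have [z zE] := mE i; exists (p%:R ^+ (M - m i) * z) => _.
  rewrite rmorphM rmorphXn /= rmorph_nat -zE mulrA -exprD subnK //.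
  by rewrite /M (bigD1 (Ordinal lt_id)) //= leq_addr.
have sP : size P = d.+1.
  by rewrite /d prednK // lt0n size_poly_eq0 monic_neq0.
have Pd : P`_d = 1 by have /monicP := Pm; rewrite /lead_coef sP.
(* The exponent is [M (d - i) - M], since one factor [p^M] is already contained in [z i]. *)
pose Q : {poly Zp} := 'X^d + \poly_(i < d) (p%:R ^+ (M * (d - i).-1) * z i).
have sQ : (size (\poly_(i < d) (p%:R ^+ (M * (d - i).-1) * z i)%R) <= d)%N.
  exact: size_poly.
exists Q.
  by rewrite monicE lead_coefDl ?size_polyXn ?ltnS // lead_coefXn.
rewrite /root; apply/eqP; have /rootP := root_minPoly 1 x.
rewrite PE horner_coef size_map_poly sP big_ord_recr /= coef_map /= Pd scale1r mul1r => Px.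
have mapQ : map_poly incl (\poly_(i < d) (p%:R ^+ (M * (d - i).-1) * z i)) =
    \poly_(i < d) incl (p%:R ^+ (M * (d - i).-1) * z i)%R.
  by apply/polyP => i; rewrite coef_map !coef_poly; case: ifP => _ //; exact: rmorph0.
rewrite rmorphD /= map_polyXn mapQ hornerD hornerXn horner_poly.
transitivity (p%:R ^+ (M * d) *
    (\sum_(i < d) (map_poly (in_alg L) P)`_i * x ^+ i + x ^+ d)); last first.
  by rewrite Px mulr0.
rewrite mulrDr addrC [X in _ + X]exprMn -exprM mulr_sumr.
congr (_ + _); apply: eq_bigr => i _.
have zi : incl (z i) = p%:R ^+ M * in_alg L P`_i.
  change (in_alg L (tofrac (z i)) = p%:R ^+ M * in_alg L P`_i).
  by rewrite -zE // rmorphM rmorphXn rmorph_nat.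
rewrite rmorphM rmorphXn rmorph_nat coef_map zi exprMn -exprM.
have -> : (M * d = M * (d - i).-1 + M + M * i)%N.
  by rewrite -mulnSr -mulnDr prednK ?subn_gt0 // subnK // ltnW.
rewrite !exprD; move: (x ^+ i) => b.
move: (p%:R ^+ (M * (d - i).-1)) (p%:R ^+ M) (p%:R ^+ (M * i)) => c1 c2 c3.
by rewrite -!mulrA; congr (_ * (_ * _)); exact: mulrCA.
Qed.

(** If [x] is nonzero, [p^m x^-1] is integral for some [m]; divisibility of [x] by [p^(m+1)] would
    then make [p^-1] integral, although [p] is a multiple of [pi]. *)
Lemma OK_separated x : (forall n, exists2 y, OK y & x = p%:R ^+ n * y) -> x = 0.
Proof.
move=> xd; apply/eqP/negPn/negP => x0.
have [m Om] := OK_pM x^-1; have [y Oy xE] := xd m.+1.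
have : OK p%:R^-1.
  have := OKM Om Oy.
  rewrite (_ : _ * y = p%:R^-1) //; apply: (mulIf x0).
  by rewrite mulrAC mulfVK // [in RHS]xE exprS -mulrA mulKf // pL_neq0.
have [v [_ [Ov _ _ pE]]] := p_eq_unif.
have Ovp : OK (pi ^+ e.-1 * v) by apply: OKM => //; apply: OKX; exact: unif_int.
have : exists2 y, OK y & p%:R = pi * y.
  by exists (pi ^+ e.-1 * v) => //; rewrite mulrA -exprS prednK ?eE_gt0.
by move/(unifP (OK_nat p)) => n Op; apply: n; split=> //; exact: pL_neq0.
Qed.

End Integers.

(** * Minimal systems of generators *)

Section Generators.
Variables (R : comPzRingType) (V : lmodType R).

Definition generates n (s : 'I_n -> V) : Prop :=
  forall x, exists a : 'I_n -> R, x = \sum_i a i *: s i.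

Lemma fingen_generates : fingen V -> exists n (s : 'I_n -> V), generates s.
Proof.
move=> [s sE]; exists (size s), (fun i => s`_i) => x; have [c ->] := sE x.
by exists (fun i => c i).
Qed.

(** With the least possible number of generators, a relation with an invertible coefficient would
    eliminate one of them. Over a local ring this puts all relations in the maximal ideal. *)
Lemma minimal_generators n (s : 'I_n -> V) : generates s ->
  exists m (s' : 'I_m -> V), generates s' /\
    forall a, \sum_i a i *: s' i = 0 -> forall i, ~ exists b, b * a i = 1.
Proof.
move=> gs; pose P m := `[< exists s' : 'I_m -> V, generates s' >].
have ex : exists m, P m by exists n; apply/asboolP; exists s.
have [m /asboolP[s' gs'] mmin] := find_ex_minn ex.
exists m, s'; split=> //; case: m s' gs' mmin => [|m] s' gs' mmin a rel i [b ba].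
  by case: i ba.
suff : P m by move/mmin; rewrite ltnn.
apply/asboolP; exists (fun j => s' (lift i j)) => x.
have [c ->] := gs' x; exists (fun j => c (lift i j) - c i * b * a (lift i j)).
have sum_lift (F : 'I_m.+1 -> V) : \sum_j F j = F i + \sum_j F (lift i j).
  rewrite (bigD1_ord i) //=.
have si : s' i = - (b *: \sum_j a (lift i j) *: s' (lift i j)).
  apply/eqP; rewrite -addr_eq0 -[s' i]scale1r -ba -scalerA -scalerDr.
  by rewrite -(sum_lift (fun j => a j *: s' j)) rel scaler0.
rewrite sum_lift si scalerN scalerA scaler_sumr addrC -sumrB; apply: eq_bigr => j _.
by rewrite scalerBl scalerA.
Qed.

End Generators.

(** * The degree of K as ramification index times residue degree *)

Section Degree.
Variable D : kisin_base.
Local Notation p := (res_char D).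
Local Notation W := (Wk D).
Local Notation k := (kf D).
Local Notation L := (Kf D).
Local Notation Zp := (Zp D).
Local Notation pi := (unif D).
Local Notation e := (eE D).
Local Notation Ww := (WkK D).

Definition actk : {rmorphism Zp -> k} := (Wk_red D \o ZpWk D)%FUN.

Lemma actk_p z : actk (p%:R * z) = 0.
Proof.
rewrite rmorphM rmorph_nat -(rmorph_nat (Wk_red D)).
by rewrite (strict_red_p (Wk_strict D)) mul0r.
Qed.

Lemma Zp_dvd_or_unit (z : Zp) : (exists y, z = p%:R * y) \/ exists y, y * z = 1.
Proof.
have [/(strict_ker (Zp_strict D))|/(strict_unit (Zp_strict D))] := eqVneq (Zp_red D z) 0.
  by left.
by right.
Qed.

(** A minimal generating family of the finite field [k] over [Z_p]. A coefficient of a relation is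
    not invertible, hence divisible by [p]. Scalars stay in [Z_p] because the family is later lifted
    to [W] and used to compute lengths over [Z_p]. *)
Lemma exists_res_basis : exists f (om : 'I_f -> k),
  (forall c, exists a, c = \sum_j actk (a j) * om j) /\
  (forall a, \sum_j actk (a j) * om j = 0 -> forall j, exists b, a j = p%:R * b).
Proof.
pose V : lmodType Zp := restr actk k^o.
have : generates (fun i : 'I_#|{: k}| => enum_val i : V).
  move=> x; exists (fun i => (enum_val i == x)%:R).
  rewrite (bigD1 (enum_rank (x : k))) //= enum_rankK eqxx scale1r big1 ?addr0 // => i nix.
  rewrite [_ == x](_ : _ = false) ?scale0r //; apply: contraNF nix => /eqP <-.
  by rewrite enum_valK.
move=> /minimal_generators[f [om [gen ind]]]; exists f, om; split=> [|a rel j].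
  exact: gen.
by have [|/(ind a rel)] := Zp_dvd_or_unit (a j).
Qed.

(** The residue degree [f] of [K], as the size of a chosen basis. *)
Definition res_deg : nat := projT1 (cid exists_res_basis).

Lemma exists_res_lifts : exists om : 'I_res_deg -> W,
  (forall c, exists a, c = \sum_j actk (a j) * Wk_red D (om j)) /\
  (forall a, \sum_j actk (a j) * Wk_red D (om j) = 0 ->
     forall j, exists b, a j = p%:R * b).
Proof.
rewrite /res_deg; case: cid => f /= [om [gen ind]].
have [o oE] := choice (fun j => spr_surj (Wk_strict D) (om j)).
exists o; split=> [c|a].
  by have [a ->] := gen c; exists a; apply: eq_bigr => j _; rewrite oE.
by under eq_bigr do rewrite oE; apply: ind.
Qed.

Section Basis.
Variable om : 'I_res_deg -> W.
Hypothesis gen : forall c, exists a, c = \sum_j actk (a j) * Wk_red D (om j).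
Hypothesis ind : forall a, \sum_j actk (a j) * Wk_red D (om j) = 0 ->
     forall j, exists b, a j = p%:R * b.

Lemma om_free a : \sum_j ZpWk D (a j) * om j = 0 -> forall j, a j = 0.
Proof.
move=> sum0 j; apply: (padic_separated (spr_complete (Zp_strict D))) => n.
elim: n a sum0 j => [|n IH] a sum0 j; first by exists (a j); rewrite mul1r.
have [|b bE] := choice (ind (a := a) _).
  rewrite -[RHS](rmorph0 (Wk_red D)) -[X in Wk_red D X]sum0 rmorph_sum.
  by apply: eq_bigr => i _; rewrite rmorphM.
have [|c cE] := IH b _ j.
  apply: (mulfI (strict_p_neq0 (Wk_strict D))); rewrite mulr0 -[RHS]sum0 mulr_sumr.
  by apply: eq_bigr => i _; rewrite bE rmorphM rmorph_nat mulrA.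
by exists c; rewrite bE cE exprS mulrA.
Qed.

Definition bas (i : 'I_e) (j : 'I_res_deg) : L := Ww (om j) * pi ^+ i.

Lemma bas_sum (z : 'I_e -> 'I_res_deg -> Zp) :
  \sum_i \sum_j incl D (z i j) * bas i j =
  \sum_i Ww (\sum_j ZpWk D (z i j) * om j) * pi ^+ i.
Proof.
apply: eq_bigr => i _; rewrite rmorph_sum mulr_suml; apply: eq_bigr => j _.
rewrite /bas mulrA rmorphM; congr (_ * _ * _); exact/esym/(WkK_Zp (z i j)).
Qed.

Lemma bas_free (z : 'I_e -> 'I_res_deg -> Zp) :
  \sum_i \sum_j incl D (z i j) * bas i j = 0 -> forall i j, z i j = 0.
Proof. by rewrite bas_sum => /unif_free H i; apply: om_free; apply: H. Qed.

Lemma OK_expand n x : (n <= e)%N -> OK x ->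
  exists (w : 'I_n -> W) y, OK y /\ x = \sum_i Ww (w i) * pi ^+ i + pi ^+ n * y.
Proof.
elim: n => [|n IH] le_ne Ox.
  by exists (fun=> 0), x; rewrite big_ord0 add0r expr0 mul1r.
have [w [y [Oy ->]]] := IH (ltnW le_ne) Ox.
have [v [y' Oy' yE]] := WkK_res_surj Oy.
exists (fun i : 'I_n.+1 => if insub (i : nat) is Some j then w j else v), y'; split=> //.
rewrite big_ord_recr /= insubN ?ltnn //.
have -> : y = Ww v + pi * y' by rewrite -yE addrC subrK.
rewrite mulrDr mulrA -exprSr [_ * Ww v]mulrC addrA; congr (_ + _ + _).
by apply: eq_bigr => i _; rewrite valK.
Qed.

(** Expand up to [pi^e], which is [p] times a unit, and rewrite each [W]-coefficient modulo [p] in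
    the lifted residue basis [om]. *)
Lemma OK_approx x : OK x -> exists (z : 'I_e -> 'I_res_deg -> Zp) y,
  OK y /\ x = \sum_i \sum_j incl D (z i j) * bas i j + p%:R * y.
Proof.
move=> Ox; have [w [y [Oy xE]]] := OK_expand (leqnn e) Ox.
have [v [v' [Ov Ov' vv' pE]]] := p_eq_unif D.
have /choice[z zE] (i : 'I_e) : exists z : 'I_res_deg -> Zp,
    exists w', w i - \sum_j ZpWk D (z j) * om j = p%:R * w'.
  have [a aE] := gen (Wk_red D (w i)); exists a.
  apply/(strict_ker (Wk_strict D)); rewrite rmorphB rmorph_sum aE.
  by apply/eqP; rewrite subr_eq0; apply/eqP; apply: eq_bigr => j _; rewrite rmorphM.
have [w' w'E] := choice zE.
exists z, (\sum_i Ww (w' i) * pi ^+ i + v' * y); split.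
  apply: OKD; last exact: OKM.
  apply: OK_sum => i; apply: OKM; [exact: WkK_int | apply: OKX; exact: unif_int].
rewrite bas_sum mulrDr addrA mulr_sumr -big_split /= xE; congr (_ + _).
  apply: eq_bigr => i _; rewrite mulrA -mulrDl; congr (_ * _).
  by rewrite -(rmorph_nat Ww) -rmorphM -rmorphD -w'E addrC subrK.
by rewrite pE mulrA -[_ * v * v']mulrA vv' mulr1.
Qed.

(** Iterate the approximation: the coordinates converge in [Z_p], and [OK_separated] shows that the
    limit represents [x]. *)
Lemma OK_span x : OK x -> exists z : 'I_e -> 'I_res_deg -> Zp,
  x = \sum_i \sum_j incl D (z i j) * bas i j.
Proof.
move=> Ox; have ex (y : {y | OK y}) : exists zy' : ('I_e -> 'I_res_deg -> Zp) * {y | OK y},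
    sval y = \sum_i \sum_j incl D (zy'.1 i j) * bas i j + p%:R * sval zy'.2.
  have [z [y' [Oy' yE]]] := OK_approx (svalP y).
  by exists (z, exist _ y' Oy').
have [F FE] := choice ex.
pose y n := iter n (fun y => (F y).2) (exist _ x Ox).
pose Z n i j := \sum_(m < n) p%:R ^+ m * (F (y m)).1 i j.
have xE n : x = \sum_i \sum_j incl D (Z n i j) * bas i j + p%:R ^+ n * sval (y n).
  elim: n => [|n IH].
    rewrite mul1r big1 ?add0r // => i _; rewrite big1 // => j _.
    by rewrite /Z big_ord0 rmorph0 mul0r.
  rewrite {1}IH (FE (y n)) mulrDr mulrA -exprSr addrA; congr (_ + _).
  rewrite mulr_sumr -big_split; apply: eq_bigr => i _.
  rewrite mulr_sumr -big_split; apply: eq_bigr => j _.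
  have -> : Z n.+1 i j = Z n i j + p%:R ^+ n * (F (y n)).1 i j.
    by rewrite /Z big_ord_recr.
  by rewrite (rmorphD (incl D)) (rmorphM (incl D)) (rmorphXn (incl D)) rmorph_nat mulrDl mulrA.
have lim i j : exists l, forall n, exists t, l - Z n i j = p%:R ^+ n * t.
  apply: (spr_complete (Zp_strict D)).2 => n; exists ((F (y n)).1 i j).
  by rewrite /Z big_ord_recr /= addrAC subrr add0r.
have [l lE] := choice (fun ij => lim ij.1 ij.2).
exists (fun i j => l (i, j)); apply/eqP; rewrite -subr_eq0; apply/eqP.
apply: OK_separated => n.
have [t tE] := choice (fun ij => lE ij n).
exists (sval (y n) - \sum_i \sum_j incl D (t (i, j)) * bas i j).
  apply: OKB; first exact: svalP (y n).
  apply: OK_sum => i; apply: OK_sum => j; apply: OKM; first exact: OK_incl.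
  by apply: OKM; [exact: WkK_int | apply: OKX; exact: unif_int].
have key : \sum_i \sum_j incl D (l (i, j)) * bas i j -
    \sum_i \sum_j incl D (Z n i j) * bas i j =
    p%:R ^+ n * \sum_i \sum_j incl D (t (i, j)) * bas i j.
  rewrite mulr_sumr -sumrB; apply: eq_bigr => i _.
  rewrite mulr_sumr -sumrB; apply: eq_bigr => j _.
  rewrite -mulrBl -(rmorphB (incl D)) (tE (i, j)).
  by rewrite (rmorphM (incl D)) (rmorphXn (incl D)) rmorph_nat mulrA.
by rewrite {1}(xE n) mulrBr -key opprB addrCA addrA.
Qed.

(** The products [om_j pi^i] are independent over [Z_p] and span the integral elements; clearing
    denominators by powers of [p] makes them a basis of [K] over [Q_p]. *)
Lemma dim_Kf_bas : \dim {:L} = (e * res_deg)%N.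
Proof.
pose g (A : 'M[{fraction Zp}]_(e, res_deg)) : L := \sum_i \sum_j A i j *: bas i j.
have g_lin : linear g.
  move=> a A B; rewrite /g scaler_sumr -big_split; apply: eq_bigr => i _.
  rewrite scaler_sumr -big_split; apply: eq_bigr => j _.
  by rewrite !mxE scalerDl scalerA.
pose gM := GRing.isLinear.Build _ _ _ _ g g_lin.
pose G : {linear _ -> _} := HB.pack g gM.
have inclE (z : Zp) x : tofrac z *: x = incl D z * x.
  by rewrite -mulr_algl.
have Gker : lker (linfun G) = 0%VS.
  apply/eqP/lker0P => A B; rewrite !lfunE /= => e1.
  apply/eqP; rewrite -subr_eq0; apply/eqP; have {e1} : g (A - B) = 0.
    by rewrite -[g]/(G : _ -> _) raddfB /= e1 subrr.
  move: (A - B) => {A B} A gA.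
  have /choice[m mE] (ij : 'I_e * 'I_res_deg) :
    exists m, exists z, p%:R ^+ m * A ij.1 ij.2 = tofrac z by exact: frac_pM.
  pose M := (\sum_ij m ij)%N.
  have /choice[z zE] (ij : 'I_e * 'I_res_deg) : exists z, p%:R ^+ M * A ij.1 ij.2 = tofrac z.
    have [z zE] := mE ij; exists (p%:R ^+ (M - m ij) * z).
    rewrite rmorphM rmorphXn /= rmorph_nat -zE mulrA -exprD subnK //.
    by rewrite /M (bigD1 ij) //= leq_addr.
  have z0 : forall i j, z (i, j) = 0.
    apply: (bas_free (z := fun i j => z (i, j))).
    transitivity ((p%:R ^+ M : {fraction Zp}) *: g A); last by rewrite gA scaler0.
    rewrite /g scaler_sumr.
    apply: eq_bigr => i _; rewrite scaler_sumr; apply: eq_bigr => j _.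
    by rewrite scalerA (zE (i, j)) inclE.
  apply/matrixP => i j; rewrite mxE.
  have p0 : p%:R ^+ M != 0 :> {fraction Zp}.
    rewrite expf_neq0 // -(rmorph_nat (@tofrac Zp)) tofrac_eq0.
    exact: strict_p_neq0 (Zp_strict D).
  by apply: (mulfI p0); rewrite (zE (i, j)) z0 rmorph0 mulr0.
have Gimg : limg (linfun G) = fullv.
  apply/vspaceP => x; rewrite memvf; have [m Om] := OK_pM x.
  have [z zE] := OK_span Om.
  have p0 : p%:R ^+ m != 0 :> {fraction Zp}.
    rewrite expf_neq0 // -(rmorph_nat (@tofrac Zp)) tofrac_eq0.
    exact: strict_p_neq0 (Zp_strict D).
  apply/memv_imgP; exists ((p%:R ^+ m)^-1 *: \matrix_(i, j) tofrac (z i j)); first exact: memvf.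
  rewrite lfunE linearZ; change (x = (p%:R ^+ m)^-1 *: g (\matrix_(i, j) tofrac (z i j))).
  rewrite /g.
  under eq_bigr do under eq_bigr do rewrite mxE inclE.
  have pE : (p%:R ^+ m : {fraction Zp}) *: x = p%:R ^+ m * x.
    by rewrite -mulr_algl -[_%:A]/(in_alg L _) rmorphXn rmorph_nat.
  by rewrite -zE -pE scalerA mulVf // scale1r.
have := limg_dim_eq (f := linfun G) (U := fullv).
rewrite Gker capv0 => /(_ erefl); rewrite -Gimg => ->.
by rewrite dimvf.
Qed.
End Basis.

(** Torsion degrees are lengths over [Z_p] divided by the degree of [K], and [k[[u]]/u] has length
    [f]; this identity turns them into valuations divided by [e]. *)
Lemma degKE : degK D = (e * res_deg)%N.
Proof.
have [om [gen ind]] := exists_res_lifts.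
exact: dim_Kf_bas gen ind.
Qed.

Lemma res_deg_gt0 : (0 < res_deg)%N.
Proof.
rewrite lt0n; apply/eqP => f0; have [om [gen _]] := exists_res_lifts.
have [a /eqP] := gen 1; rewrite big1 ?oner_eq0 // => j _.
by have := ltn_ord j; rewrite [X in (_ < X)%N]f0.
Qed.

End Degree.

(** * Weierstrass division by E(u) and primality of the ideal it generates *)

Section Eisenstein.
Variable D : kisin_base.
Local Notation p := (res_char D).
Local Notation W := (Wk D).
Local Notation k := (kf D).
Local Notation S := (fps W).
Local Notation e := (eE D).
Local Notation E := (Ew D).
Local Notation rho := (rhoS D).
Local Notation pi := (unif D).

Definition low (f : S) : Prop := forall i, (e <= i)%N -> fcoef f i = 0.

Lemma rho_ker (x : S) : rho x = 0 <-> exists y, x = p%:R * y.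
Proof. exact: fps_map_ker (Wk_strict D) x. Qed.

Lemma fcoef_p (y : S) i : fcoef (p%:R * y) i = p%:R * fcoef y i.
Proof. exact: fcoef_p1. Qed.

Lemma fcoef_pn n (y : S) i : fcoef (p%:R ^+ n * y) i = p%:R ^+ n * fcoef y i.
Proof. exact: fcoef_pM. Qed.

(** Division by [u^e] is a shift of coefficients, and [E] differs from [u^e] by a multiple of
    [p]. *)
Lemma weierstrass_step (f : S) : exists (q r f' : S), low r /\ f = q * E + r + p%:R * f'.
Proof.
pose r : S := Fps (fun i => if (i < e)%N then fcoef f i else 0).
pose q := fps_shift e f.
have fE : f = q * fpsX W ^+ e + r.
  apply: fpsP => i; rewrite fcoefD mulrC fcoefXnM /=.
  by case: ltnP => [_|le]; rewrite ?add0r // subnK ?addr0.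
have /rho_ker[g gE] : rho (q * (fpsX W ^+ e - E)) = 0.
  by rewrite rmorphM rmorphB rmorphXn /= rhoS_E fps_mapX subrr mulr0.
exists q, r, g; split; first by move=> i le_ei; rewrite /= ltnNge le_ei.
by rewrite -gE {1}fE mulrBr; ring.
Qed.

(** The error [p f'] is divided again; quotients and remainders converge p-adically, and the
    vanishing of the high coefficients passes to the limit. *)
Lemma weierstrass_division (f : S) : exists q r, low r /\ f = q * E + r.
Proof.
have /choice[F FE] (g : S) : exists qrf : S * S * S,
    low qrf.1.2 /\ g = qrf.1.1 * E + qrf.1.2 + p%:R * qrf.2.
  by have [q [r [g' [lr gE]]]] := weierstrass_step g; exists (q, r, g').
pose y n := iter n (fun g => (F g).2) f.
pose Q n := \sum_(i < n) p%:R ^+ i * (F (y i)).1.1.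
pose T n := \sum_(i < n) p%:R ^+ i * (F (y i)).1.2.
have QS n : Q n.+1 = Q n + p%:R ^+ n * (F (y n)).1.1 by rewrite /Q big_ord_recr.
have TS n : T n.+1 = T n + p%:R ^+ n * (F (y n)).1.2 by rewrite /T big_ord_recr.
have fE n : f = Q n * E + T n + p%:R ^+ n * y n.
  elim: n => [|n IH]; first by rewrite /Q /T !big_ord0 mul0r !add0r mul1r.
  rewrite {1}IH {1}(FE (y n)).2 QS TS exprS [y n.+1]/=.
  move: (Q n) (T n) (y n) (p%:R ^+ n) => a b c d; ring.
have limQ : exists l, forall n, exists z, l - Q n = p%:R ^+ n * z.
  apply: (fps_complete (Wk_strict D)) => n; exists (F (y n)).1.1.
  by rewrite QS addrAC subrr add0r.
have limT : exists l, forall n, exists z, l - T n = p%:R ^+ n * z.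
  apply: (fps_complete (Wk_strict D)) => n; exists (F (y n)).1.2.
  by rewrite TS addrAC subrr add0r.
have [q qE] := limQ; have [r rE] := limT; exists q, r; split.
  move=> i le_ei; apply: (padic_separated (spr_complete (Wk_strict D))) => n.
  have [z zE] := rE n; exists (fcoef z i); rewrite -[LHS]subr0.
  have <- : fcoef (T n) i = 0.
    elim: n {z zE} => [|n IH]; first by rewrite /T big_ord0.
    by rewrite TS fcoefD IH fcoef_pn (FE (y n)).1 // mulr0 addr0.
  by rewrite -fcoefB zE fcoef_pn.
apply/eqP; rewrite -subr_eq0; apply/eqP.
apply: (fps_separated (Wk_strict D)) => n.
have [z zE] := qE n; have [z' zE'] := rE n.
exists (y n - z * E - z').
have -> : q = Q n + p%:R ^+ n * z by rewrite -zE addrC subrK.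
have -> : r = T n + p%:R ^+ n * z' by rewrite -zE' addrC subrK.
rewrite {1}(fE n).
move: (Q n) (T n) (y n) (p%:R ^+ n) => a b c d; ring.
Qed.

Lemma rho_E_inj (q : S) r : low r -> rho (q * E) = rho r -> rho q = 0 /\ rho r = 0.
Proof.
move=> lr; rewrite rmorphM rhoS_E => h.
have r0 : rho r = 0.
  apply: fpsP => i; have [le_ei|lt_ie] := leqP e i.
    by rewrite /= lr // rmorph0.
  by rewrite -h mulrC fcoefXnM lt_ie.
split=> //; apply/eqP; move/eqP: h.
by rewrite r0 mulf_eq0 expf_eq0 (negPf (fpsX_neq0 k)) andbF orbF.
Qed.

(** Modulo [p] the equation reads [q u^e = r] with [r] of degree below [e], so [q] and [r] vanish
    there; divide by [p] and repeat. *)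
Lemma weierstrass_unique (q r : S) : low r -> q * E = r -> r = 0.
Proof.
move=> lr qE; apply: (fps_separated (Wk_strict D)) => n.
elim: n q r lr qE => [|n IH] q r lr qE; first by exists r; rewrite mul1r.
have [/rho_ker[q' q'E] /rho_ker[r' r'E]] := rho_E_inj lr (congr1 rho qE).
have pS0 : (p%:R : S) != 0 := pS_neq0 D.
have [|| y yE] := IH q' r'.
- move=> i le_ei; apply: (mulfI (strict_p_neq0 (Wk_strict D))).
  by rewrite -fcoef_p -r'E lr // mulr0.
- by apply: (mulfI pS0); rewrite -r'E -qE q'E mulrA.
by exists y; rewrite r'E yE exprS mulrA.
Qed.

Definition Eideal (x : S) : Prop := exists y, x = y * E.

Lemma fps_of_polyM (P Q : {poly W}) : fps_of_poly (P * Q) = fps_of_poly P * fps_of_poly Q.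
Proof. by apply: fpsP => n; rewrite fcoefM /= coefM. Qed.

Lemma fps_of_polyD (P Q : {poly W}) : fps_of_poly (P + Q) = fps_of_poly P + fps_of_poly Q.
Proof. by apply: fpsP => n; rewrite fcoefD /= coefD. Qed.

Lemma low_poly r : low r -> exists P : {poly W}, (size P <= e)%N /\ r = fps_of_poly P.
Proof.
move=> lr; exists (fps_trunc e r); split; first exact: size_poly.
apply: fpsP => i /=; have [le_ei|lt_ie] := leqP e i.
  by rewrite lr // nth_default // (leq_trans (size_poly _ _)).
by rewrite coef_fps_trunc.
Qed.

Lemma eval_unif0 (P : {poly W}) : (size P <= e)%N ->
  (map_poly (WkK D) P).[pi] = 0 -> P = 0.
Proof.
move=> sP; have -> : map_poly (WkK D) P = \poly_(i < e) WkK D P`_i.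
  apply/polyP => i; rewrite coef_map coef_poly; case: ltnP => le_ei //.
  by rewrite nth_default; [exact: rmorph0 | exact: leq_trans sP le_ei].
rewrite horner_poly => /unif_free H; apply/polyP => i; rewrite coef0.
have [le_ei|lt_ie] := leqP e i; first by rewrite nth_default //; exact: leq_trans sP le_ei.
exact: (H (Ordinal lt_ie)).
Qed.

(** The quotient by [E] embeds in [K] by evaluation at [pi], performed on remainders only since
    these are polynomials. The product of the two remainders is a multiple of [E] by uniqueness of
    division, so it vanishes at [pi]; evaluation is injective in degrees below [e]. *)
Lemma Eideal_prime (x y : S) : Eideal (x * y) -> Eideal x \/ Eideal y.
Proof.
move=> [z zE].
have [q1 [r1 [lr1 xE]]] := weierstrass_division x.
have [q2 [r2 [lr2 yE]]] := weierstrass_division y.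
have [P1 [sP1 r1E]] := low_poly lr1; have [P2 [sP2 r2E]] := low_poly lr2.
have Em : lead_coef (Eis D) \is a GRing.unit.
  by have /monicP -> := Eis_monic D; rewrite unitr1.
pose Q := P1 * P2 %/ Eis D; pose T := P1 * P2 %% Eis D.
have PE : P1 * P2 = Q * Eis D + T by exact: Pdiv.IdomainUnit.divp_eq.
have sT : (size T <= e)%N.
  have E0 : Eis D != 0 by rewrite monic_neq0 // Eis_monic.
  have : (size T < size (Eis D))%N by rewrite ltn_modp.
  by rewrite /eE; have := Eis_size D; case: (size (Eis D)).
have T0 : fps_of_poly T = 0 :> S.
  apply: (@weierstrass_unique (z - q1 * y - r1 * q2 - fps_of_poly Q)).
    by move=> i le_ei /=; rewrite nth_default // (leq_trans sT).
  have : r1 * r2 = fps_of_poly Q * E + fps_of_poly T.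
    by rewrite r1E r2E -fps_of_polyM PE fps_of_polyD fps_of_polyM.
  move=> h; have -> : fps_of_poly T = r1 * r2 - fps_of_poly Q * E by rewrite h addrC addKr.
  rewrite 3!mulrBl -zE {1}xE yE; ring.
have {}T0 : T = 0.
  apply/polyP => i; rewrite coef0.
  by have := congr1 (fun f : S => fcoef f i) T0.
have /eqP : (map_poly (WkK D) P1).[pi] * (map_poly (WkK D) P2).[pi] = 0.
  rewrite -hornerM -rmorphM PE T0 addr0 rmorphM hornerM.
  by have /rootP -> := Eis_root D; rewrite mulr0.
have fp0 : fps_of_poly 0 = 0 :> S by apply: fpsP => i; rewrite /= coef0.
rewrite mulf_eq0 => /orP[] /eqP /eval_unif0 P0; [left|right].
  by exists q1; rewrite xE r1E P0 // fp0 addr0.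
by exists q2; rewrite yE r2E P0 // fp0 addr0.
Qed.

Lemma Eideal1 : ~ Eideal 1.
Proof.
move=> [y /(congr1 rho)]; rewrite rmorph1 rmorphM rhoS_E => /(congr1 (fun f => fcoef f 0)).
rewrite mulrC fcoefXnM eE_gt0 fcoef1 => /eqP.
by rewrite oner_eq0.
Qed.

Lemma E_neq0 : E != 0.
Proof.
apply/eqP => E0; have := congr1 rho E0; rewrite rhoS_E rmorph0 => /eqP.
by rewrite expf_eq0 (negPf (fpsX_neq0 k)) andbF.
Qed.

(** Modulo [p] such an [x] is divisible by all powers of [u], so [p] divides it; as [E] is nonzero
    modulo [p], the quotient by [p] satisfies the same hypothesis. *)
Lemma E_separated (x : S) : (forall n, exists y, x = y * E ^+ n) -> x = 0.
Proof.
move=> xd; apply: (fps_separated (Wk_strict D)) => m.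
elim: m x xd => [|m IH] x xd; first by exists x; rewrite mul1r.
have /rho_ker[x' x'E] : rho x = 0.
  apply: fpsP => i; have [y ->] := xd i.+1.
  have -> : rho (y * E ^+ i.+1) = fpsX k ^+ (e * i.+1) * rho y.
    by rewrite rmorphM rmorphXn /= rhoS_E -exprM mulrC.
  rewrite fcoefXnM ifT //.
  by apply: leq_pmull; exact: eE_gt0.
have [|z zE] := IH x'; last by exists z; rewrite x'E zE exprS mulrA.
move=> n; have [y yE] := xd n.
have /rho_ker[y' y'E] : rho y = 0.
  have /eqP : rho (y * E ^+ n) = 0 by rewrite -yE; apply/rho_ker; exists x'.
  rewrite rmorphM rmorphXn /= rhoS_E mulf_eq0 !expf_eq0 (negPf (fpsX_neq0 k)).
  by rewrite !andbF orbF => /eqP.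
exists y'; have pS0 : (p%:R : S) != 0 := pS_neq0 D.
by apply: (mulfI pS0); rewrite -x'E yE y'E mulrA.
Qed.

Lemma E_decompose (x : S) : x != 0 -> exists n y, ~ Eideal y /\ x = y * E ^+ n.
Proof.
move=> x0; apply: contrapT => H; case/eqP: x0; apply: E_separated.
elim=> [|n [y yE]]; first by exists x; rewrite mulr1.
have [[z zE]|ny] := pselect (Eideal y); last by case: H; exists n, y.
by exists z; rewrite yE zE exprS mulrA.
Qed.

Lemma dvd_E_exp m (x y : S) : x * y = E ^+ m ->
  exists j w, w \is a GRing.unit /\ x = w * E ^+ j.
Proof.
elim: m x y => [|m IH] x y h.
  by exists 0%N, x; rewrite mulr1; split=> //; apply/unitrPr; exists y.
have /Eideal_prime[[z zE]|[z zE]] : Eideal (x * y) by exists (E ^+ m); rewrite h exprSr.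
  have [|j [w [uw e']]] := IH z y.
    by apply: (mulfI E_neq0); rewrite -exprS -h zE; ring.
  by exists j.+1, w; rewrite zE e' exprSr mulrA.
by apply: (IH x z); apply: (mulfI E_neq0); rewrite -exprS -h zE; ring.
Qed.

End Eisenstein.

(** * Base change *)

Section TensLift.
Variables (R A : comPzRingType) (f : {rmorphism R -> A}).
Variables (N : lmodType A) (M : lmodType R) (T : lmodType A).

Lemma tens_ten_sum s : tens_pi f s = \sum_(z <- s) ten f (z.1 : N) (z.2 : M).
Proof.
elim: s => [|z s IH]; first by rewrite big_nil.
by rewrite big_cons -IH [RHS]tens_addE; case: z.
Qed.

(** Formal sums are identified when no balanced map separates them, so the sum of [b] over a
    representative is well defined. *)
Lemma tens_lift (b : N -> M -> T) : balanced f b ->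
  exists L : {linear tens f N M -> T}, forall n m, L (ten f n m) = b n m.
Proof.
move=> bb; pose l (x : tens f N M) := bsum b (repr x).
have lE s : l (tens_pi f s) = bsum b s by exact: repr_tens.
have l_lin : linear l.
  move=> a x y; have [s ->] := tensP x; have [t ->] := tensP y.
  rewrite [X in l (X + _)]tens_scaleE [X in l X]tens_addE !lE bsum_cat.
  by rewrite (bsum_scale _ _ bb).
pose lM := GRing.isLinear.Build _ _ _ _ l l_lin.
pose L : {linear tens f N M -> T} := HB.pack l lM.
exists L => n m; rewrite -[LHS]/(l (ten f n m)) /ten lE /bsum big_cons big_nil /=.
by rewrite addr0.
Qed.

Lemma tens_ext (L L' : {linear tens f N M -> T}) :
  (forall n m, L (ten f n m) = L' (ten f n m)) -> L =1 L'.
Proof.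
move=> e x; have [s ->] := tensP x; rewrite tens_ten_sum !linear_sum.
by apply: eq_bigr => z _; apply: e.
Qed.

End TensLift.

Section BaseChange.
Variables (R A : comPzRingType) (f : {rmorphism R -> A}).

Lemma ten_balanced (N : lmodType A) (M : lmodType R) : balanced f (@ten R A f N M).
Proof.
split=> *; [rewrite [RHS]tens_addE|rewrite [RHS]tens_addE|rewrite [RHS]tens_scaleE|];
  apply/tens_eq => T b bb; rewrite /bsum /= !big_cons !big_nil /= ?addr0.
- exact: (balDl bb).
- exact: (balDr bb).
- by [].
- exact: (bal_mid bb).
Qed.

Section Semilinear.
Variables (M : lmodType R) (T : lmodType A).

Definition semilinear_over (h : M -> T) : Prop :=
  forall r x y, h (r *: x + y) = f r *: h x + h y.

Lemma semilinearD h x y : semilinear_over h -> h (x + y) = h x + h y.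
Proof. by move=> hs; have := hs 1 x y; rewrite scale1r rmorph1 scale1r. Qed.

Lemma semilinear0 h : semilinear_over h -> h 0 = 0.
Proof.
move=> hs; apply: (addrI (h 0)).
by rewrite -(semilinearD _ _ hs) !addr0.
Qed.

Lemma semilinearZ h r x : semilinear_over h -> h (r *: x) = f r *: h x.
Proof. by move=> hs; rewrite -[r *: x]addr0 hs (semilinear0 hs) addr0. Qed.

Lemma semilinear_sum h (I : Type) (s : seq I) (a : I -> R) (x : I -> M) :
  semilinear_over h -> h (\sum_(i <- s) a i *: x i) = \sum_(i <- s) f (a i) *: h (x i).
Proof.
move=> hs; elim: s => [|i s IH]; first by rewrite !big_nil (semilinear0 hs).
by rewrite !big_cons hs IH.
Qed.

Lemma bchange_lift h : semilinear_over h ->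
  exists L : {linear bchange f M -> T}, forall m, L (bc1 f m) = h m.
Proof.
move=> hs; have [L LE] : exists L : {linear bchange f M -> T},
    forall (a : A^o) m, L (ten f a m) = (a : A) *: h m.
  apply: tens_lift; split.
  - by move=> *; rewrite scalerDl.
  - by move=> *; rewrite (semilinearD _ _ hs) scalerDr.
  - by move=> *; rewrite scalerA.
  - by move=> r n m; rewrite (semilinearZ _ _ hs) scalerA mulrC.
by exists L => m; rewrite LE scale1r.
Qed.

Lemma ten_bc1 (a : A) (m : M) : ten f (a : A^o) m = a *: bc1 f m.
Proof.
have [_ _ tZ _] := ten_balanced A^o M.
by rewrite /bc1 -tZ /GRing.scale /= mulr1.
Qed.

Lemma bchange_ext (L L' : {linear bchange f M -> T}) :
  (forall m, L (bc1 f m) = L' (bc1 f m)) -> L =1 L'.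
Proof. by move=> e; apply: tens_ext => a m; rewrite ten_bc1 !linearZ /= e. Qed.

End Semilinear.

Lemma bc1_semilinear (M : lmodType R) : semilinear_over (@bc1 R A f M).
Proof.
have [_ tDr _ tmid] := ten_balanced A^o M.
move=> r x y; rewrite {1}/bc1 tDr; congr (_ + _).
rewrite -tmid -ten_bc1; congr (ten f _ _).
by rewrite /GRing.scale /= mulr1.
Qed.

Lemma bc1Z (M : lmodType R) r (x : M) : bc1 f (r *: x) = f r *: bc1 f x.
Proof. exact: semilinearZ (@bc1_semilinear M). Qed.

Lemma bc1_0 (M : lmodType R) : bc1 f (0 : M) = 0.
Proof. exact: semilinear0 (@bc1_semilinear M). Qed.

Lemma bchange_span (M : lmodType R) (x : bchange f M) :
  exists s : seq (A * M), x = \sum_(z <- s) z.1 *: bc1 f z.2.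
Proof.
have [s ->] := tensP x; exists s; rewrite tens_ten_sum.
by apply: eq_bigr => z _; rewrite ten_bc1.
Qed.

Lemma bchange_map1 (M M' : lmodType R) (h : {linear M -> M'}) m :
  bchange_map f h (bc1 f m) = bc1 f (h m).
Proof. by rewrite [LHS]tens_mapE. Qed.

Lemma bchange_map_comp (M M' M'' : lmodType R) (h : {linear M -> M'})
    (h' : {linear M' -> M''}) (h'' : {linear M -> M''}) :
  (forall m, h'' m = h' (h m)) ->
  forall x, bchange_map f h'' x = bchange_map f h' (bchange_map f h x).
Proof.
move=> e x; pose L : {linear _ -> _} := (bchange_map f h' \o bchange_map f h)%FUN.
rewrite -[RHS]/(L x); move: x; apply: bchange_ext => m.
by rewrite [RHS]/= !bchange_map1 e.
Qed.

Lemma bchange_map_scale (M : lmodType R) (h : {linear M -> M}) r :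
  (forall m, h m = r *: m) -> forall x, bchange_map f h x = f r *: x.
Proof.
move=> e x; pose L : {linear bchange f M -> bchange f M} := (f r \*: idfun).
rewrite -[RHS]/(L x); move: x; apply: bchange_ext => m.
by rewrite bchange_map1 e bc1Z.
Qed.

End BaseChange.

(** * Localization *)

Section Loc.
Variables (R : comNzRingType) (T : set R).

Lemma to_loc_inv (s : R) (ds : denom T s) : to_loc T s * frac 1 ds = 1.
Proof.
rewrite -[LHS]/(loc_mul _ _) /to_loc loc_mulE; apply: frac_eq1; ring.
Qed.

Lemma fracE (a s : R) (ds : denom T s) : frac a ds = to_loc T a * frac 1 ds.
Proof.
rewrite -[RHS]/(loc_mul _ _) /to_loc loc_mulE; apply: frac_eq1; ring.
Qed.

Lemma loc_lift (A : comUnitRingType) (f : {rmorphism R -> A}) :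
  (forall s, denom T s -> f s \is a GRing.unit) ->
  exists F : {rmorphism loc T -> A}, forall a, F (to_loc T a) = f a.
Proof.
move=> fu; pose g (x : loc T) := f (lnum x) / f (lden x).
have gE a s (ds : denom T s) : g (frac a ds) = f a / f s.
  have /esym/frac_eq[w dw e] := frac_repr (frac a ds).
  have ul := fu _ (ldenP (frac a ds)); have us := fu _ ds.
  have := congr1 f e; rewrite !rmorphM => /(mulrI (fu w dw)) e'.
  apply: (mulIr us); rewrite divrK //; apply: (mulIr ul).
  by rewrite -e' /g mulrAC divrK.
have g_zmod : zmod_morphism g.
  move=> x y; have [a [s [ds ->]]] := fracP x; have [b [t [dt ->]]] := fracP y.
  rewrite -[frac a ds - _]/(loc_add _ (loc_opp _)) loc_oppE loc_addE !gE.
  have us := fu _ ds; have ut := fu _ dt.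
  apply: (mulIr (_ : f s * f t \is a GRing.unit)); first by rewrite unitrM us.
  rewrite rmorphM divrK ?unitrM ?us // mulrBl mulrA divrK // [f s * f t]mulrC mulrA divrK //.
  by rewrite rmorphD !rmorphM rmorphN mulNr.
have g_monoid : monoid_morphism g.
  split; first by rewrite -[1]/(frac 1 (denom1 T)) gE rmorph1 divr1.
  move=> x y; have [a [s [ds ->]]] := fracP x; have [b [t [dt ->]]] := fracP y.
  rewrite -[frac a ds * _]/(loc_mul _ _) loc_mulE !gE !rmorphM.
  by rewrite invrM ?fu // [(f t)^-1 * _]mulrC mulrACA.
pose gz := GRing.isZmodMorphism.Build _ _ g g_zmod.
pose gm := GRing.isMonoidMorphism.Build _ _ g g_monoid.
pose G : {rmorphism loc T -> A} := HB.pack g gz gm.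
exists G => a; rewrite -[LHS]/(g (to_loc T a)) /to_loc gE.
by rewrite rmorph1 divr1.
Qed.

End Loc.

Lemma denom_set1 (R : comNzRingType) (a s : R) : denom [set a] s -> exists n, s = a ^+ n.
Proof.
elim=> [|x y -> _ [n ->]]; first by exists 0%N.
by exists n.+1; rewrite exprS.
Qed.

Lemma denom_expr (R : comNzRingType) (a : R) n : denom [set a] (a ^+ n).
Proof.
elim: n => [|n IH]; first exact: denom1.
by rewrite exprS; apply: denomM.
Qed.

(** Two maps inverse to each other up to [r] become inverse, up to a unit, once [r] is inverted.
    This serves Frobenius with [r = E^b] and isogenies with [r = p^m]. *)
Lemma bijective_up_to (R : comNzRingType) (T : set R) (M N : lmodType R)
    (h : {linear M -> N}) (g : {linear N -> M}) r : denom T r ->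
  (forall m, g (h m) = r *: m) -> (forall n, h (g n) = r *: n) ->
  bijective (bchange_map (to_loc T) h).
Proof.
move=> dr gh hg; pose v : loc T := frac 1 dr.
have vr : v * to_loc T r = 1 by rewrite mulrC; apply: to_loc_inv.
exists (fun x => v *: bchange_map (to_loc T) g x) => x.
  rewrite -(bchange_map_comp (h'' := (g \o h)%FUN)) //.
  by rewrite (bchange_map_scale (r := r)) ?scalerA ?vr ?scale1r.
rewrite linearZ /= -(bchange_map_comp (h'' := (h \o g)%FUN)) //.
by rewrite (bchange_map_scale (r := r)) ?scalerA ?vr ?scale1r.
Qed.

(** * Modules with an explicit Frobenius matrix *)

Section PhiModules.
Variable D : kisin_base.
Local Notation S := (SS D).
Local Notation E := (ES D).
Local Notation toE := (to_loc [set E]).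

(* The twisting coefficient tS = c0^-1 E and its inverse in S[1/E]. *)
Definition tinv : loc [set E] :=
  toE (fpsC (Eis_c0 D)) * frac 1 (@denomT S [set E] E erefl).

Definition tS : S := fpsC (Eis_c0 D)^-1 * E.

Lemma c0V : fpsC (Eis_c0 D)^-1 * fpsC (Eis_c0 D) = 1 :> S.
Proof.
rewrite -(rmorphM (@fpsC (Wk D))) mulVr ?Eis_c0_unit //.
exact: rmorph1.
Qed.

Lemma tS_tinv : toE tS * tinv = 1.
Proof.
rewrite /tS /tinv rmorphM mulrACA -rmorphM c0V rmorph1 mul1r.
exact: to_loc_inv.
Qed.

Lemma E_tinv : toE E * tinv = toE (fpsC (Eis_c0 D)).
Proof. by rewrite /tinv mulrCA to_loc_inv mulr1. Qed.

Lemma twist_coef_tS r : twist_coef D (Posz r) = toE (tS ^+ r).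
Proof. by rewrite rmorphXn. Qed.

Lemma invE_ext (M : lmodType S) (T : lmodType (loc [set E]))
    (L L' : {linear invE (phi_pull M) -> T}) :
  (forall m, L (to_invE (bc1 (@phiS D) m)) = L' (to_invE (bc1 (@phiS D) m))) -> L =1 L'.
Proof.
move=> e; apply: bchange_ext => x; have [s ->] := bchange_span x.
rewrite (semilinear_sum _ _ _ (@bc1_semilinear _ _ toE (phi_pull M))) !linear_sum.
by apply: eq_bigr => z _; rewrite !linearZ; congr (_ *: _); apply: e.
Qed.

Lemma is_morphP (M N : phi_module D) (f : {linear M -> N}) :
  (forall m, frob N (to_invE (bc1 (@phiS D) (f m))) =
     bchange_map toE f (frob M (to_invE (bc1 (@phiS D) m)))) -> is_morph f.
Proof.
move=> e; rewrite /is_morph.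
pose L : {linear _ -> _} :=
  (frob N \o bchange_map toE (bchange_map (@phiS D) f))%FUN.
pose L' : {linear _ -> _} := (bchange_map toE f \o frob M)%FUN.
have : L =1 L'; last exact.
by apply: invE_ext => m; rewrite /= /to_invE !bchange_map1; apply: e.
Qed.

Section Pmod.
Variables (M : lmodType S) (h : M -> M).
Hypothesis hs : semilinear_over (@phiS D) h.

Definition lin_of : {linear phi_pull M -> M} := projT1 (cid (bchange_lift hs)).

Lemma lin_ofE m : lin_of (bc1 (@phiS D) m) = h m.
Proof. by rewrite /lin_of; case: cid. Qed.

Definition pmod (c : loc [set E]) : phi_module D :=
  @PhiModule D M (c \*: bchange_map toE lin_of).

Lemma pmod_frobE c (x : phi_pull M) :
  frob (pmod c) (to_invE x) = c *: to_invE (lin_of x : pmod c).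
Proof. by rewrite /= /to_invE bchange_map1. Qed.

Lemma pmod_frob c m :
  frob (pmod c) (to_invE (bc1 (@phiS D) (m : pmod c))) = c *: to_invE (h m : pmod c).
Proof. by rewrite pmod_frobE lin_ofE. Qed.

Variables (g : {linear M -> phi_pull M}) (b : nat).
Hypothesis lin_g : forall m, lin_of (g m) = E ^+ b *: m.
Hypothesis g_lin : forall x, g (lin_of x) = E ^+ b *: x.

Lemma pmod_bijective a : bijective (frob (pmod (tinv ^+ a))).
Proof.
have [F' FK KF] := bijective_up_to (denom_expr E b) g_lin lin_g.
have tt : toE tS ^+ a * tinv ^+ a = 1 by rewrite -exprMn tS_tinv expr1n.
exists (fun x => F' (toE tS ^+ a *: x)) => x /=.
  by rewrite scalerA tt scale1r FK.
by rewrite KF scalerA mulrC tt scale1r.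
Qed.

(** [E] times [tinv] is the constant [c0], so [E^a] clears [tinv^a]; in the other direction [tinv^a]
    is cancelled by putting [tS^a] into the source. *)
Lemma pmod_bounded a : bounded_height (pmod (tinv ^+ a)).
Proof.
exists a, b; split=> [x|m].
  exists (fpsC (Eis_c0 D) ^+ a *: lin_of x).
  rewrite pmod_frobE scalerA rmorphXn -exprMn E_tinv -rmorphXn.
  by rewrite /to_invE bc1Z.
exists (tS ^+ a *: g m).
rewrite pmod_frobE linearZ /= lin_g /to_invE !bc1Z !scalerA; congr (_ *: _).
have tta : toE (tS ^+ a) * tinv ^+ a = 1 by rewrite rmorphXn -exprMn tS_tinv expr1n.
by rewrite mulrCA mulrA [X in _ = X * _]tta mul1r.
Qed.

End Pmod.

Lemma generates_fingen (R : comPzRingType) (V : lmodType R) n (s : 'I_n -> V) :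
  generates s -> fingen V.
Proof.
move=> gs; exists [seq s i | i <- enum 'I_n] => x; have [a ->] := gs x.
exists (fun i => if insub i is Some j then a j else 0).
have sz : size [seq s i | i <- enum 'I_n] = n by rewrite size_map size_enum_ord.
rewrite sz; apply: eq_bigr => i _; rewrite valK (nth_map i) ?size_enum_ord //.
by rewrite nth_ord_enum.
Qed.

Section Rows.
Variables (R : idomainType) (rho : {rmorphism S -> R}) (phiR : {rmorphism R -> R}).
Hypothesis rho_surj : forall x, exists y, rho y = x.
Hypothesis rho_phi : forall x, rho (phiS x) = phiR (rho x).
Hypothesis rho_E : rho E != 0.
Hypothesis rho_u : rho (uS D) != 0.
Hypothesis rho_ker : forall x, rho x = 0 -> exists y z, x = phiS y * z /\ rho y = 0.

(** Rows over [R] with scalars acting through [rho]. The case [R = W[[u]]] gives the flat models,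
    the case [R = k[[u]]] those killed by [p]. *)
Definition RV n : lmodType S := restr rho 'rV[R]_n.

Lemma RV_scale n (r : S) (x : RV n) : r *: x = (rho r *: (x : 'rV[R]_n) : 'rV[R]_n).
Proof. by []. Qed.

(** As [rho E] is nonzero, the localisation maps on to rows over the fraction field of [R], in which
    the rows over [R] embed. *)
Lemma RV_toE_inj n : injective (@to_invE D (RV n)).
Proof.
have [|F FE] := @loc_lift S [set E] _ (@tofrac R \o rho)%FUN.
  move=> s /denom_set1[k ->]; rewrite unitfE rmorphXn expf_neq0 //=.
  by rewrite tofrac_eq0.
pose T : lmodType _ := restr F 'rV[{fraction R}]_n.
have [|L LE] := @bchange_lift _ _ toE (RV n) T (fun v : 'rV[R]_n => map_mx (@tofrac R) v).
  move=> r x y; rewrite RV_scale map_mxD map_mxZ; congr (_ + _).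
  by rewrite -[RHS]/(F _ *: _) FE.
move=> x y /(congr1 L); rewrite !LE => /matrixP e; apply/matrixP => i j.
by have := e i j; rewrite !mxE => /eqP; rewrite tofrac_eq => /eqP.
Qed.

Lemma RV_basis n (x : 'rV[R]_n) (r : 'I_n -> S) : (forall i, rho (r i) = x 0 i) ->
  (x : RV n) = \sum_i r i *: (delta_mx 0 i : RV n).
Proof.
move=> rE; rewrite {1}[x]row_sum_delta; apply: eq_bigr => i _.
by rewrite RV_scale rE.
Qed.

Lemma RV_lift n (x : 'rV[R]_n) : exists r : 'I_n -> S, forall i, rho (r i) = x 0 i.
Proof. by have [r rE] := choice (fun i => rho_surj (x 0 i)); exists r. Qed.

Lemma RV_generates n : generates (fun i : 'I_n => delta_mx 0 i : RV n).
Proof. by move=> x; have [r rE] := RV_lift x; exists r; apply: RV_basis. Qed.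

Lemma RV_u_torsion_free n : u_torsion_free (RV n).
Proof.
move=> x /matrixP e; apply/matrixP => i j; apply: (mulfI rho_u).
by have := e i j; rewrite !mxE mulr0.
Qed.

Section Matrix.
Variables (n : nat) (A : 'M[R]_n).

Definition row_frob (v : RV n) : RV n := map_mx phiR (v : 'rV[R]_n) *m A.

Lemma row_frob_semilinear : semilinear_over (@phiS D) row_frob.
Proof.
move=> r x y; rewrite /row_frob RV_scale map_mxD map_mxZ mulmxDl -scalemxAl.
by rewrite RV_scale rho_phi.
Qed.

(* The division by tS^a makes the a-th twist effective with matrix A. *)
Definition row_module (a : nat) : phi_module D := pmod row_frob_semilinear (tinv ^+ a).

Variables (B : 'M[R]_n) (b : nat).
Hypotheses (AB : A *m B = (rho E ^+ b)%:M) (BA : B *m A = (rho E ^+ b)%:M).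

(** Write [x = phi(y) z] with [rho y = 0]; then [y] moves across the tensor sign and kills [m]. *)
Lemma pull_ker (x : S) (m : RV n) : rho x = 0 ->
  x *: bc1 (@phiS D) m = 0 :> phi_pull (RV n).
Proof.
move=> /rho_ker[y [z [-> y0]]]; rewrite mulrC -scalerA -bc1Z RV_scale y0 scale0r.
by rewrite bc1_0 scaler0.
Qed.

(** Right multiplication by [B], with entries lifted to [W[[u]]]; by [pull_ker] the choice of lifts
    does not matter, which makes the map linear. *)
Lemma exists_lin_inverse : exists g : {linear RV n -> phi_pull (RV n)},
  (forall m, lin_of row_frob_semilinear (g m) = E ^+ b *: m) /\
  (forall x, g (lin_of row_frob_semilinear x) = E ^+ b *: x).
Proof.
have [s sE] := choice rho_surj.
pose e i : phi_pull (RV n) := bc1 (@phiS D) (delta_mx 0 i : RV n).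
pose g (v : RV n) := \sum_i s (((v : 'rV[R]_n) *m B) 0 i) *: e i.
have gP (v : RV n) (r : 'I_n -> S) : (forall i, rho (r i) = ((v : 'rV[R]_n) *m B) 0 i) ->
    g v = \sum_i r i *: e i.
  move=> rE; apply: eq_bigr => i _; apply/eqP; rewrite -subr_eq0 -scalerBl.
  by rewrite pull_ker // rmorphB sE rE subrr.
have g_lin : linear g.
  move=> c x y.
  rewrite (@gP _ (fun i => c * s (((x : 'rV[R]_n) *m B) 0 i) + s (((y : 'rV[R]_n) *m B) 0 i))).
    rewrite /g scaler_sumr -big_split; apply: eq_bigr => i _.
    by rewrite scalerDl scalerA.
  by move=> i; rewrite rmorphD rmorphM !sE RV_scale mulmxDl -scalemxAl !mxE.
pose gM := GRing.isLinear.Build _ _ _ _ g g_lin.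
pose G : {linear RV n -> phi_pull (RV n)} := HB.pack g gM.
have GE v : G v = g v by [].
exists G; split=> [m|x].
  rewrite GE /g linear_sum.
  transitivity ((m : 'rV[R]_n) *m B *m A : RV n).
    rewrite [X in _ = X *m A]row_sum_delta mulmx_suml; apply: eq_bigr => i _.
    rewrite linearZ /= lin_ofE RV_scale sE /row_frob map_delta_mx -scalemxAl.
    by [].
  by rewrite -mulmxA BA mul_mx_scalar RV_scale rmorphXn.
pose L : {linear phi_pull (RV n) -> phi_pull (RV n)} := (G \o lin_of row_frob_semilinear)%FUN.
pose L' : {linear phi_pull (RV n) -> phi_pull (RV n)} := (E ^+ b \*: idfun).
have : L =1 L'; last exact.
apply: bchange_ext => m; rewrite -[LHS]/(G (lin_of row_frob_semilinear (bc1 (@phiS D) m))).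
rewrite lin_ofE GE -[RHS]/(E ^+ b *: bc1 (@phiS D) m).
have [r rE] := RV_lift m.
rewrite [m in RHS](RV_basis rE).
rewrite (semilinear_sum _ _ _ (@bc1_semilinear _ _ (@phiS D) (RV n))) scaler_sumr.
rewrite (@gP _ (fun i => E ^+ b * phiS (r i))).
  by apply: eq_bigr => i _; rewrite scalerA.
move=> i; rewrite rmorphM rmorphXn rho_phi rE /row_frob -mulmxA AB mul_mx_scalar !mxE.
by [].
Qed.

Lemma row_module_kisin a : kisin (row_module a).
Proof.
have [g [lin_g g_lin]] := exists_lin_inverse.
split.
- exact: generates_fingen (@RV_generates n).
- exact: RV_u_torsion_free.
- exact: pmod_bijective lin_g g_lin a.
- exact: pmod_bounded lin_g a.
Qed.

End Matrix.
End Rows.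
End PhiModules.

(** * Quotients and flatness *)

Section Quotm.
Variables (R : comPzRingType) (M : lmodType R) (P : set M).

Lemma to_quotm_comb a x y :
  to_quotm P (a *: x + y) = a *: to_quotm P x + to_quotm P y.
Proof.
by rewrite -[RHS]/(quotm_add (quotm_scale a (to_quotm P x)) (to_quotm P y))
  quotm_scaleE quotm_addE.
Qed.

Lemma to_quotm_linear : exists q : {linear M -> quotm P}, forall x, q x = to_quotm P x.
Proof.
pose qM := GRing.isLinear.Build _ _ _ _ (to_quotm P) to_quotm_comb.
pose q : {linear M -> quotm P} := HB.pack (to_quotm P) qM.
by exists q.
Qed.

Lemma to_quotm0 x : to_quotm P x = 0 <-> gen_submod P x.
Proof.
rewrite -[0]/(to_quotm P 0); split=> [/to_quotm_eq|h]; first by rewrite subr0.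
by apply/to_quotm_eq; rewrite subr0.
Qed.

Lemma gen_submod_ker (X : lmodType R) (h : {linear M -> X}) x :
  (forall x, P x -> h x = 0) -> gen_submod P x -> h x = 0.
Proof.
move=> hP gx; apply: (gx [set x | h x = 0]%classic); last exact: hP.
by split=> [|a y z hy hz]; rewrite /= ?linear0 // linearP hy hz scaler0 addr0.
Qed.

Lemma quotm_lift (X : lmodType R) (h : {linear M -> X}) : (forall x, P x -> h x = 0) ->
  exists H : {linear quotm P -> X}, forall x, H (to_quotm P x) = h x.
Proof.
move=> hP; pose H (q : quotm P) := h (repr q).
have HE x : H (to_quotm P x) = h x.
  have : gen_submod P (repr (to_quotm P x) - x).
    by apply/to_quotm_eq; rewrite /to_quotm reprK.
  by move/(gen_submod_ker hP)/eqP; rewrite linearB subr_eq0 => /eqP.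
have H_lin : linear H.
  move=> a x y; have [x' ->] := to_quotmP x; have [y' ->] := to_quotmP y.
  by rewrite -to_quotm_comb !HE linearP.
pose HM := GRing.isLinear.Build _ _ _ _ H H_lin.
pose HL : {linear quotm P -> X} := HB.pack H HM.
by exists HL => x; apply: HE.
Qed.

End Quotm.

Section Submod.
Variables (R : comPzRingType) (M : lmodType R) (P : set M).
Hypothesis sP : is_submod P.

Lemma submodD x y : P x -> P y -> P (x + y).
Proof. by move=> Px Py; have := sP.2 1 x y Px Py; rewrite scale1r. Qed.
Lemma submodZ a x : P x -> P (a *: x).
Proof. by move=> Px; have := sP.2 a x 0 Px sP.1; rewrite addr0. Qed.
Lemma submodB x y : P x -> P y -> P (x - y).
Proof. by move=> Px Py; apply: submodD => //; rewrite -scaleN1r; apply: submodZ. Qed.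
Lemma gen_submod_id : gen_submod P = P.
Proof.
apply/seteqP; split=> x; last by move=> Px Q _; apply.
by apply.
Qed.

End Submod.

(** * Finitely generated flat modules over a local ring are free *)

Section FlatFree.
Variables (R : comNzRingType) (kk : fieldType) (res : {rmorphism R -> kk}).
Hypothesis res_unit : forall x, res x != 0 -> exists y, y * x = 1.

(* For the ideal I of coefficients of a relation, I (x) M -> M is injective; this places the
   relation a in I K, with K the relation module. As K reduces to zero, a = a C with C
   reducing to zero, so a = 0 because 1 - C is invertible. *)
Lemma flat_relation (M : lmodType R) n (s : 'I_n -> M) : flat M -> generates s ->
  (forall a, \sum_i a i *: s i = 0 -> forall i, ~ exists b, b * a i = 1) ->
  forall a, \sum_i a i *: s i = 0 -> forall i, a i = 0.
Proof.
move=> flM gs minrel a rel.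
have res0 c : ~ (exists b, b * c = 1) -> res c = 0.
  by move=> nu; apply/eqP/negPn/negP => /res_unit.
pose al (c : 'rV[R]_n) : R^o := \sum_i c 0 i * a i.
have al_lin : linear al.
  move=> c x y; rewrite /al scaler_sumr -big_split; apply: eq_bigr => i _.
  by rewrite !mxE mulrDl /GRing.scale /= mulrA.
pose alM := GRing.isLinear.Build _ _ _ _ al al_lin.
pose Al : {linear 'rV[R]_n -> R^o} := HB.pack al alM.
(* The quotient of [R^n] by [K0] is the ideal generated by the [a i], and [g] is its inclusion in
   [R]. *)
pose K0 : set 'rV[R]_n := [set c | Al c = 0]%classic.
have [g gE] := @quotm_lift _ _ K0 _ Al (fun _ h => h).
have g_inj : injective g.
  move=> x y; have [x' ->] := to_quotmP x; have [y' ->] := to_quotmP y.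
  rewrite !gE => e; apply/to_quotm_eq => Q _; apply.
  by change (Al (x' - y') = 0); rewrite linearB e subrr.
pose N : lmodType R := quotm K0.
pose ep i : N := to_quotm K0 (delta_mx 0 i).
have epE i : g (ep i) = a i.
  rewrite gE -[LHS]/(al _) /al (bigD1 i) //= mxE !eqxx mul1r big1 ?addr0 // => j nji.
  by rewrite mxE (negPf nji) andbF mul0r.
have [tDl tDr tZ tmid] := ten_balanced (idfun : {rmorphism R -> R}) R^o M.
have [tDl' tDr' tZ' tmid'] := ten_balanced (idfun : {rmorphism R -> R}) N M.
(* The image in the tensor product of [R] and [M] is [1] tensor the relation, hence zero; flatness
   gives the vanishing. *)
have t0 : \sum_i ten (idfun : {rmorphism R -> R}) (ep i) (s i) = 0.
  apply: (flM _ _ _ g_inj); rewrite linear0 linear_sum /=.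
  transitivity (ten (idfun : {rmorphism R -> R}) (1 : R^o) (\sum_i a i *: s i)).
    elim/big_rec2: _ => [|i y x _ ->].
      by apply: (addrI (ten idfun (1 : R^o) (0 : M))); rewrite -tDr !addr0.
    rewrite tDr; congr (_ + _); rewrite -tmid [LHS]tens_mapE /= epE.
    by congr (ten _ _ _); rewrite /GRing.scale /= mulr1.
  by rewrite rel; apply: (addrI (ten idfun (1 : R^o) (0 : M))); rewrite -tDr !addr0.
pose IK : set 'rV[R]_n := [set x | exists i (r : 'rV[R]_n), \sum_j r 0 j *: s j = 0 /\ x = a i *: r]%classic.
have [q qE] := to_quotm_linear IK.
have /choice[lft lftE] (m : M) : exists v : 'rV[R]_n, m = \sum_j v 0 j *: s j.
  by have [c ->] := gs m; exists (\row_j c j); apply: eq_bigr => j _; rewrite mxE.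
have qIK (nu : N) (r : 'rV[R]_n) : \sum_j r 0 j *: s j = 0 -> q ((g nu : R) *: r) = 0.
  move=> rr; have [c ->] := to_quotmP nu; rewrite gE -[Al c]/(\sum_i c 0 i * a i).
  rewrite scaler_suml linear_sum big1 // => i _; rewrite -scalerA linearZ_LR qE.
  have -> : to_quotm IK (a i *: r) = 0 by apply/to_quotm0 => Q _; apply; exists i, r.
  by rewrite scaler0.
(* Lift [m] to a vector and multiply by [g nu]. Two lifts differ by a relation, whose multiples by
   the ideal lie in [IK]; hence [b] is balanced. *)
pose b (nu : N) (m : M) : quotm IK := q ((g nu : R) *: lft m).
have bE nu m (v : 'rV[R]_n) : m = \sum_j v 0 j *: s j -> b nu m = q ((g nu : R) *: v).
  move=> mE; apply/eqP; rewrite -subr_eq0 -linearB -scalerBr qIK //.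
  under eq_bigr do rewrite !mxE scalerBl.
  by rewrite sumrB -lftE -mE subrr.
have gZ c nu : g (c *: nu) = c * (g nu : R) :> R by rewrite linearZ_LR.
have bb : balanced (idfun : {rmorphism R -> R}) b.
  split=> [nu nu' m|nu m m'|c nu m|r nu m].
  - by rewrite /b linearD scalerDl linearD.
  - rewrite (@bE _ _ (lft m + lft m')) ?scalerDr ?linearD //.
    rewrite {1}[m]lftE {1}[m']lftE -big_split; apply: eq_bigr => j _.
    by rewrite !mxE scalerDl.
  - transitivity (q (c *: ((g nu : R) *: lft m))); last by rewrite linearZ_LR.
    by rewrite scalerA /b gZ.
  - rewrite [RHS](@bE _ _ (r *: lft m)).
      by rewrite scalerA mulrC /b gZ.
    rewrite {1}[m]lftE scaler_sumr; apply: eq_bigr => j _.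
    by rewrite !mxE scalerA.
have [L LE] := tens_lift bb.
have aIK : gen_submod IK (\row_j a j).
  apply/to_quotm0; rewrite -qE; have := congr1 L t0; rewrite linear0 linear_sum => <-.
  transitivity (q (\sum_i a i *: delta_mx 0 i)).
    by congr (q _); apply/rowP => j; rewrite mxE summxE (bigD1 j) //= !mxE !eqxx mulr1
      big1 ?addr0 // => i nij; rewrite !mxE eq_sym (negPf nij) andbF mulr0.
  rewrite linear_sum; apply: eq_bigr => i _; rewrite LE (@bE _ _ (delta_mx 0 i)) ?epE //.
  rewrite (bigD1 i) //= mxE !eqxx scale1r big1 ?addr0 // => j nji.
  by rewrite mxE (negPf nji) andbF scale0r.
(* [Q] is a submodule containing [IK]: relations reduce to zero, so [a_i r] is [a] times a matrix
   reducing to zero. *)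
pose Q : set 'rV[R]_n := [set x | exists C : 'M[R]_n, map_mx res C = 0 /\ x = (\row_j a j) *m C]%classic.
have [C [C0 aC]] : Q (\row_j a j).
  apply: aIK.
    split=> [|c x y [C [C0 ->]] [C' [C'0 ->]]].
      by exists 0; rewrite map_mx0 mulmx0.
    exists (c *: C + C'); rewrite map_mxD map_mxZ C0 C'0 scaler0 addr0; split=> //.
    by rewrite mulmxDr scalemxAr.
  move=> x [i [r [rr ->]]]; exists (\matrix_(i', j) (if i' == i then r 0 j else 0)); split.
    apply/matrixP => i' j; rewrite !mxE; case: eqP => _; last exact: rmorph0.
    exact: res0 (minrel (fun j => r 0 j) rr j).
  apply/rowP => j; rewrite !mxE (bigD1 i) //= !mxE eqxx big1 ?addr0 // => i' ni.
  by rewrite !mxE (negPf ni) mulr0.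
have [d dE] : exists d, d * \det (1%:M - C) = 1.
  apply: res_unit; rewrite -det_map_mx map_mxB C0 subr0 map_mx1 det1.
  exact: oner_neq0.
have a0 : \row_j a j *m (1%:M - C) = 0 by rewrite mulmxBr mulmx1 -aC subrr.
have := congr1 (fun v => v *m \adj (1%:M - C)) a0.
rewrite -mulmxA mul_mx_adj mul0mx mul_mx_scalar => /rowP e0 i.
have {e0} : \det (1%:M - C) * a i = 0 by have := e0 i; rewrite !mxE.
by move=> e0; rewrite -[a i]mul1r -dE -mulrA e0 mulr0.
Qed.

Lemma flat_free (M : lmodType R) : fingen M -> flat M ->
  exists n (s : 'I_n -> M), generates s /\
    forall a, \sum_i a i *: s i = 0 -> forall i, a i = 0.
Proof.
move=> /fingen_generates[n [s /minimal_generators[m [s' [gs minrel]]]]] flM.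
by exists m, s'; split=> //; apply: flat_relation.
Qed.

End FlatFree.

Local Open Scope classical_set_scope.

(** * Length *)

Section Rlen.
Variable Z : comPzRingType.

(* X / Y has a composition series of length n *)
Definition rlen (V : lmodType Z) (X Y : set V) (n : nat) : Prop :=
  exists c : nat -> set V, [/\ c 0%N = Y, c n = X,
    forall i, (i <= n)%N -> is_submod (c i) &
    forall i, (i < n)%N -> c i `<` c i.+1 /\
      forall Q, is_submod Q -> c i `<=` Q -> Q `<=` c i.+1 -> Q = c i \/ Q = c i.+1].

Lemma rlen0 (V : lmodType Z) (X : set V) : is_submod X -> rlen X X 0.
Proof. by move=> sX; exists (fun=> X); split=> // i; rewrite ltn0. Qed.

Lemma rlen_trans (V : lmodType Z) (X Y W : set V) a b :
  rlen X Y a -> rlen Y W b -> rlen X W (a + b).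
Proof.
move=> [c [c0 ca cs cc]] [d [d0 db ds dc]].
exists (fun i => if (i <= b)%N then d i else c (i - b)%N); split=> //.
- case: leqP => h; last by rewrite addnK.
  have a0 : a = 0%N by lia.
  by rewrite a0 add0n db -c0 -ca a0.
- by move=> i le_i; case: leqP => h; [apply: ds | apply: cs; lia].
move=> i lt_i; case: (ltngtP i b) => [lt_ib|lt_bi|ei].
- exact: dc.
- by rewrite subSn; [apply: cc; lia | exact: ltnW].
by rewrite ei subSn // subnn db -c0; apply: cc; lia.
Qed.

Lemma is_submod_preim (V V' : lmodType Z) (h : {linear V -> V'}) (X : set V') :
  is_submod X -> is_submod (h @^-1` X).
Proof.
move=> sX; split=> [|a x y hx hy]; rewrite /preimage /= ?linear0; first exact: sX.1.
by rewrite linearP; apply: sX.2.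
Qed.

Lemma is_submod_image (V V' : lmodType Z) (h : {linear V -> V'}) (X : set V) :
  is_submod X -> is_submod (h @` X).
Proof.
move=> sX; split=> [|a _ _ [x Xx <-] [y Xy <-]].
  by exists 0; [exact: sX.1 | rewrite linear0].
by exists (a *: x + y); [exact: sX.2 | rewrite linearP].
Qed.

Lemma is_submodI (V : lmodType Z) (X Y : set V) :
  is_submod X -> is_submod Y -> is_submod (X `&` Y).
Proof.
move=> sX sY; split=> [|a x y [Xx Yx] [Xy Yy]]; first by split; [exact: sX.1|exact: sY.1].
by split; [exact: sX.2 | exact: sY.2].
Qed.

Lemma chain_mono (V : lmodType Z) (c : nat -> set V) n :
  (forall i, (i < n)%N -> c i `<` c i.+1) ->
  forall i j, (i <= j)%N -> (j <= n)%N -> c i `<=` c j.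
Proof.
move=> cc i j le_ij; rewrite -(subnKC le_ij).
elim: (j - i)%N => [|d IH] le_jn; first by rewrite addn0.
rewrite addnS in le_jn *; apply: (@subset_trans _ (c (i + d)%N)); first exact/IH/ltnW.
by have [] := cc _ le_jn.
Qed.

Lemma rlen_image (V V' : lmodType Z) (h : {linear V -> V'}) (X Y : set V) n :
  (forall x, h x = 0 -> Y x) -> rlen X Y n -> rlen (h @` X) (h @` Y) n.
Proof.
move=> hY [c [c0 cn cs cc]]; have cm := chain_mono (fun i lt => (cc i lt).1).
have hc i x : (i <= n)%N -> h x = 0 -> c i x.
  by move=> le_in /hY; rewrite -c0; apply: cm.
exists (fun i => h @` c i); split=> [||i le_in|i lt_in].
- by rewrite c0.
- by rewrite cn.
- exact: is_submod_image (cs i le_in).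
have [[cl cn'] ccs] := cc i lt_in.
have si := cs i (ltnW lt_in).
split.
  split; first exact: image_subset.
  move=> sub; apply: cn' => x cx; have [|y cy e] := sub (h x); first by exists x.
  rewrite -[x](subrK y) addrC; apply: submodD => //; apply: hc (ltnW lt_in) _.
  by rewrite linearB e subrr.
move=> Q sQ cQ Qc; pose Q' := h @^-1` Q `&` c i.+1.
have sQ' : is_submod Q' by apply: is_submodI (cs _ lt_in); apply: is_submod_preim.
have QE : Q = h @` Q'.
  apply/seteqP; split=> [y Qy|_ [x [Qx _] <-] //].
  by have [x cx hx] := Qc y Qy; exists x => //; split=> //; rewrite /preimage /= hx.
have [||e|e] := ccs Q' sQ'.
- by move=> x cx; split; [apply: cQ; exists x | apply: cl].
- by move=> x [].
- by left; rewrite QE e.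
by right; rewrite QE e.
Qed.

Lemma rlen_preim (V V' : lmodType Z) (h : {linear V -> V'}) (X Y : set V') n :
  (forall y, exists x, h x = y) -> rlen X Y n -> rlen (h @^-1` X) (h @^-1` Y) n.
Proof.
move=> hs [c [c0 cn cs cc]]; exists (fun i => h @^-1` c i); split=> [||i le_in|i lt_in].
- by rewrite c0.
- by rewrite cn.
- exact: is_submod_preim (cs i le_in).
have [[cl cn'] ccs] := cc i lt_in; split.
  split; first by move=> x; apply: cl.
  by move=> sub; apply: cn' => y cy; have [x xy] := hs y; rewrite -xy; apply: sub; rewrite /preimage /= xy.
move=> Q sQ cQ Qc.
have QE : Q = h @^-1` (h @` Q).
  apply/seteqP; split=> [x Qx|x [y Qy e]]; first by exists x.
  rewrite -[x](subrK y); apply: submodD => //; apply: cQ; rewrite /preimage /=.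
  by rewrite linearB e subrr; have [] := cs i (ltnW lt_in).
have [||e|e] := ccs (h @` Q) (is_submod_image h sQ).
- by move=> y cy; have [x xy] := hs y; exists x => //; apply: cQ; rewrite /preimage /= xy.
- by move=> _ [x Qx <-]; apply: Qc.
- by left; rewrite QE e.
by right; rewrite QE e.
Qed.

(** [lam P] counts the steps of the composition series at which [P] contributes a new element. It
    strictly increases with [P], hence bounds the length of every chain. *)
Lemma rlen_has_length (V : lmodType Z) n : rlen [set: V] [set 0] n -> has_length V n.
Proof.
move=> [c [c0 cn cs cc]]; split.
  by exists c; split=> // i lt_in; have [] := cc i lt_in.
move=> m d [ds dd].
pose b (P : set V) i := `[< exists x, [/\ P x, c i.+1 x & ~ c i x] >].
pose lam P := (\sum_(i < n) b P i)%N.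
have b_le (P P' : set V) i : P `<=` P' -> (b P i <= b P' i)%N.
  move=> PP'; rewrite /b; case: asboolP => // -[x [Px cx ncx]].
  by case: asboolP => // H; case: H; exists x; split=> //; apply: PP'.
have lam_lt (P P' : set V) : is_submod P -> is_submod P' -> P `<` P' -> (lam P < lam P')%N.
  move=> sP sP' [PP' nP'P]; have le : (lam P <= lam P')%N by apply: leq_sum => i _; apply: b_le.
  rewrite ltn_neqAle le andbT; apply/eqP => eq_lam; apply: nP'P.
  have eq_b (i : 'I_n) : b P i = b P' i.
    apply/eqP; rewrite -[_ == _]negbK; apply/negP => ne; move/eqP: eq_lam; apply/negP.
    rewrite neq_ltn; apply/orP; left; rewrite /lam (bigD1 i) //= [X in (_ < X)%N](bigD1 i) //=.
    rewrite -addSn leq_add //; last by apply: leq_sum => j _; apply: b_le.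
    by have := b_le P P' i PP'; move: ne; case: (b P i); case: (b P' i).
  have H i : (i <= n)%N -> P' `&` c i `<=` P.
    elim: i => [|i IH] le_in x [P'x cx].
      by move: cx; rewrite c0 => ->; exact: sP.1.
    have [cix|ncix] := pselect (c i x); first exact: IH (ltnW le_in) _ (conj P'x cix).
    have : b P i by rewrite (eq_b (Ordinal le_in)); apply/asboolP; exists x.
    move=> /asboolP[y [Py cy ncy]]; have [[cl _] ccs] := cc i le_in.
    (* [Q] is [c i] plus the part of [P] inside [c i.+1]. It contains [y], so simplicity of the
       factor makes it all of [c i.+1]. *)
    pose Q := [set z | exists a w, [/\ c i a, P w, c i.+1 w & z = a + w]].
    have sQ : is_submod Q.
      split=> [|r _ _ [a [w [ca Pw cw ->]]] [a' [w' [ca' Pw' cw' ->]]]].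
        exists 0, 0; split; rewrite ?addr0 //; first exact: (cs i (ltnW le_in)).1.
          exact: sP.1.
        exact: (cs _ le_in).1.
      exists (r *: a + a'), (r *: w + w'); split.
      - exact: (cs i (ltnW le_in)).2.
      - exact: sP.2.
      - exact: (cs _ le_in).2.
      by rewrite scalerDr addrACA.
    have QE : Q = c i.+1.
      have [||e|//] := ccs Q sQ.
      - move=> a ca; exists a, 0; split; rewrite ?addr0 //; first exact: sP.1.
        exact: (cs _ le_in).1.
      - by move=> _ [a [w [ca _ cw ->]]]; apply: submodD (cs _ le_in) _ _ _ cw; apply: cl.
      by case: ncy; rewrite -e; exists 0, y; split; rewrite ?add0r //; exact: (cs i (ltnW le_in)).1.
    move: cx; rewrite -QE => -[a [w [ca Pw cw xE]]]; rewrite xE.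
    apply: submodD => //; apply: IH (ltnW le_in) _ _; split=> //.
    have -> : a = x - w by rewrite xE addrK.
    by apply: submodB => //; apply: PP'.
  by move=> x P'x; apply: (H n) => //; split=> //; rewrite cn.
have lam_d i : (i <= m)%N -> (i <= lam (d i))%N.
  elim: i => // i IH le_im; apply: leq_ltn_trans (IH (ltnW le_im)) _.
  by apply: lam_lt (dd i le_im); apply: ds; rewrite // ltnW.
apply: leq_trans (lam_d m (leqnn m)) _; rewrite /lam.
rewrite -[X in (_ <= X)%N]card_ord -sum1_card; apply: leq_sum => i _.
exact: leq_b1.
Qed.

Lemma rlen_surj_has_length (V V' : lmodType Z) (h : {linear V -> V'}) (Y : set V) n :
  (forall y, exists x, h x = y) -> (forall x, h x = 0 <-> Y x) ->
  rlen setT Y n -> has_length V' n.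
Proof.
move=> hs hY /(@rlen_image _ _ h)H; apply: rlen_has_length.
have -> : [set: V'] = h @` setT.
  by apply/seteqP; split=> // y _; have [x <-] := hs y; exists x.
have -> : [set (0 : V')] = h @` Y.
  apply/seteqP; split=> [_ ->|_ [x Yx <-]]; last exact/hY.
  by exists 0; [apply/hY; rewrite linear0 | rewrite linear0].
by apply: H => x /hY.
Qed.

Lemma has_length_uniq (V : lmodType Z) m n : has_length V m -> has_length V n -> m = n.
Proof.
move=> [[c cm] mm] [[d dn] nn]; apply/eqP; rewrite eqn_leq (nn _ _ cm).
by rewrite (mm _ _ dn).
Qed.

Lemma mlengthE (V : lmodType Z) n : has_length V n -> mlength V = n.
Proof.
move=> hn; rewrite /mlength; case: xgetP => [m _ hm|H]; last by case: (H n).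
exact: has_length_uniq hm hn.
Qed.

(** [I] has the role of a maximal ideal killing the module, and [s] that of a basis over the residue
    field; the partial spans form the composition series. *)
Lemma rlen_basis (V : lmodType Z) (I : set Z) n (s : 'I_n -> V) :
  ~ I 1 -> (forall a, ~ I a -> exists b, I (b * a - 1)) ->
  generates s -> (forall a i, I a -> a *: s i = 0) ->
  (forall a, \sum_i a i *: s i = 0 -> forall i, I (a i)) ->
  rlen [set: V] [set 0] n.
Proof.
move=> I1 Iinv gs Is ind.
pose c k := [set x | exists a : 'I_n -> Z,
  (forall i : 'I_n, (k <= i)%N -> a i = 0) /\ x = \sum_i a i *: s i].
have cs k : is_submod (c k).
  split=> [|r _ _ [a [a0 ->]] [b [b0 ->]]].
    by exists (fun=> 0); split=> //; rewrite big1 // => i _; rewrite scale0r.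
  exists (fun i => r * a i + b i); split; first by move=> i ki; rewrite a0 // b0 // mulr0 addr0.
  rewrite scaler_sumr -big_split; apply: eq_bigr => i _ /=.
  by rewrite scalerDl scalerA.
exists c; split=> // [||k lt_kn].
- apply/seteqP; split=> [_ [a [a0 ->]]|_ ->]; last exact: (cs 0%N).1.
  by rewrite big1 // => i _; rewrite a0 // scale0r.
- apply/seteqP; split=> // x _; have [a ->] := gs x; exists a; split=> // i.
  by rewrite leqNgt ltn_ord.
pose kk := Ordinal lt_kn.
have le_c : c k `<=` c k.+1.
  by move=> _ [a [a0 ->]]; exists a; split=> // i ki; apply/a0/ltnW.
have sk : c k.+1 (s kk).
  exists (fun i => (i == kk)%:R); split.
    by move=> i ki; case: eqP => // ik; move: ki; rewrite ik /= ltnn.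
  by rewrite (bigD1 kk) //= eqxx scale1r big1 ?addr0 // => i /negPf ->; rewrite scale0r.
split.
  split=> // sub; have [a [a0 sE]] := sub _ sk.
  apply: I1; have := ind (fun i => (i == kk)%:R - a i) _ kk.
  rewrite eqxx a0 ?leqnn // subr0; apply.
  under eq_bigr do rewrite scalerBl; rewrite sumrB -sE (bigD1 kk) //= eqxx scale1r.
  by rewrite big1 ?addr0 ?subrr // => i /negPf ->; rewrite scale0r.
move=> Q sQ cQ Qc.
have dec x : c k.+1 x -> exists a y, c k y /\ x = a *: s kk + y.
  move=> [a [a0 ->]]; exists (a kk), (\sum_(i | i != kk) a i *: s i); split.
    exists (fun i => if i == kk then 0 else a i); split.
      move=> i ki; case: eqP => // /eqP ik; apply: a0.
      by rewrite ltn_neqAle ki andbT eq_sym; apply: contra ik => /eqP ik; apply/eqP/val_inj.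
    rewrite [RHS](bigD1 kk) //= eqxx scale0r add0r; apply: eq_bigr => i /negPf ik.
    by rewrite ik.
  by rewrite (bigD1 kk).
have [[x [Qx ncx]]|H] := pselect (exists x, Q x /\ ~ c k x); last first.
  by left; apply/seteqP; split=> // x Qx; apply: contrapT => ncx; apply: H; exists x.
right; apply/seteqP; split=> // y cy.
have [a [x' [cx' xE]]] := dec x (Qc x Qx).
have nIa : ~ I a.
  by move=> Ia; apply: ncx; rewrite xE Is // add0r.
have [b Ib] := Iinv a nIa.
have Qas : Q (a *: s kk) by rewrite -[_ *: _](addrK x') -xE; apply: submodB => //; apply: cQ.
have Qs : Q (s kk).
  have -> : s kk = b *: (a *: s kk) - (b * a - 1) *: s kk.
    by rewrite scalerBl scalerA scale1r subKr.
  by rewrite (Is _ _ Ib) subr0; apply: submodZ.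
have [a' [y' [cy' ->]]] := dec y cy.
by apply: submodD => //; [apply: submodZ | apply: cQ].
Qed.

End Rlen.

(** * The length of the cokernel of a matrix, from the valuation of its determinant *)

Section DvrLength.
Variables (R : comPzRingType) (t : R).
Hypothesis total_dvd : forall x y : R, (exists z, y = z * x) \/ (exists z, x = z * y).
Hypothesis t_reg : forall x : R, t * x = 0 -> x = 0.
Hypothesis t_dec : forall x : R, x = 0 \/ exists k w w', w * w' = 1 /\ x = w * t ^+ k.
Hypothesis t_nunit : forall x : R, x * t <> 1.

Variables (Z : comPzRingType) (zeta : {rmorphism Z -> R}) (l0 : nat).
Hypothesis base : rlen (V := restr zeta R^o) setT [set x | exists y : R, x = y * t] l0.

Definition VV n : lmodType Z := restr zeta 'rV[R]_n.

Definition rowsp m n (A : 'M[R]_(m, n)) : set (VV n) := [set v | exists w : 'rV[R]_m, v = w *m A].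

Lemma VV_scale n (z : Z) (x : VV n) : z *: x = (zeta z *: (x : 'rV[R]_n) : 'rV[R]_n).
Proof. by []. Qed.

Lemma mulmx_linear_VV m n (A : 'M[R]_(m, n)) :
  exists h : {linear VV m -> VV n}, forall v : 'rV[R]_m, h v = v *m A.
Proof.
pose h (v : VV m) : VV n := (v : 'rV[R]_m) *m A.
have h_lin : linear h.
  by move=> z x y; rewrite /h !VV_scale mulmxDl -scalemxAl.
pose hM := GRing.isLinear.Build _ _ _ _ h h_lin.
pose H : {linear VV m -> VV n} := HB.pack h hM.
by exists H.
Qed.

Definition regular (x : R) : Prop := forall y, x * y = 0 -> y = 0.

Lemma regular_tX k : regular (t ^+ k).
Proof.
elim: k => [|k IH] y; first by rewrite mul1r.
by rewrite exprS -mulrA => /t_reg/IH.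
Qed.

Lemma regular_dec k w w' : w * w' = 1 -> regular (w * t ^+ k).
Proof.
move=> ww' y; rewrite -mulrA => e; apply: (@regular_tX k).
by rewrite -[LHS]mul1r -ww' mulrAC e mul0r.
Qed.

Lemma regular_rowinj n (A : 'M[R]_n) (v : 'rV[R]_n) : regular (\det A) -> v *m A = 0 -> v = 0.
Proof.
move=> rA vA; have : v *m A *m \adj A = 0 by rewrite vA mul0mx.
rewrite -mulmxA mul_mx_adj mul_mx_scalar => /rowP e; apply/rowP => i.
by have := e i; rewrite !mxE => /rA.
Qed.

(** The cokernel of [A] has length [l0 * d] over [Z], where [l0] is the length of [R/t]. *)
Definition mlen n (A : 'M[R]_n) d : Prop := rlen setT (rowsp A) (l0 * d).

Lemma mlen_unit n (A A' : 'M[R]_n) : A' *m A = 1%:M -> mlen A 0.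
Proof.
move=> A'A; rewrite /mlen muln0.
have -> : rowsp A = setT.
  apply/seteqP; split=> // v _; exists ((v : 'rV[R]_n) *m A').
  by rewrite -mulmxA A'A mulmx1.
by apply: rlen0; split.
Qed.

(** Inside the row space of [B], that of [A B] is the image under [B] of the row space of [A];
    regularity of [det B] makes [B] injective. *)
Lemma mlen_mul n (A B : 'M[R]_n) a b : regular (\det B) ->
  mlen A a -> mlen B b -> mlen (A *m B) (a + b).
Proof.
move=> rB lA lB; rewrite /mlen mulnDr addnC; apply: rlen_trans lB _.
have [h hE] := mulmx_linear_VV B.
have -> : rowsp B = h @` setT.
  apply/seteqP; split=> [_ [w ->]|_ [w _ <-]]; last by exists w; rewrite hE.
  by exists w; rewrite ?hE.
have -> : rowsp (A *m B) = h @` rowsp A.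
  apply/seteqP; split=> [_ [w ->]|_ [_ [w ->] <-]].
    by exists (w *m A); [exists w | rewrite hE mulmxA].
  by exists w; rewrite hE mulmxA.
apply: rlen_image lA => x; rewrite hE => /(regular_rowinj rB) ->.
by exists 0; rewrite mul0mx.
Qed.

Lemma mlen_dblock m (A : 'M[R]_m) d :
  mlen A d -> mlen (block_mx (1%:M : 'M_1) 0 0 A) d.
Proof.
move=> lA; have [h hE] := mulmx_linear_VV (col_mx (0 : 'M_(1, m)) 1%:M).
have hrE (v : 'rV[R]_(1 + m)) : h v = rsubmx v.
  by rewrite hE -[v in LHS]hsubmxK mul_row_col mulmx0 add0r mulmx1.
have := rlen_preim (h := h) _ lA; rewrite /mlen.
have -> : h @^-1` setT = setT by [].
have -> : h @^-1` rowsp A = rowsp (block_mx (1%:M : 'M_1) 0 0 A).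
  apply/seteqP; split=> v.
    rewrite /preimage /= hrE => -[w wE]; exists (row_mx (lsubmx (v : 'rV[R]_(1 + m))) w).
    rewrite mul_row_block mulmx1 !mulmx0 addr0 add0r -wE.
    by rewrite hsubmxK.
  move=> [w ->]; rewrite /preimage /= hrE.
  exists (rsubmx w); rewrite -[w in rsubmx (w *m _)]hsubmxK mul_row_block !mulmx0 add0r.
  by rewrite row_mxKr.
apply => w; exists (row_mx 0 (w : 'rV[R]_m)).
by rewrite hrE row_mxKr.
Qed.

Lemma mlen_t m : mlen (block_mx (t%:M : 'M_1) 0 0 (1%:M : 'M_m)) 1.
Proof.
pose h (v : VV (1 + m)) : restr zeta R^o := (v : 'rV[R]_(1 + m)) 0 (lshift m 0).
have h_lin : linear h by move=> z x y; rewrite /h !mxE.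
pose hM := GRing.isLinear.Build _ _ _ _ h h_lin.
pose H : {linear VV (1 + m) -> restr zeta R^o} := HB.pack h hM.
have HE v : H v = h v by [].
have := rlen_preim (h := H) _ base; rewrite /mlen muln1.
have -> : H @^-1` setT = setT by [].
have -> : H @^-1` [set x | exists y : R, x = y * t] =
    rowsp (block_mx (t%:M : 'M_1) 0 0 (1%:M : 'M_m)).
  apply/seteqP; split=> v.
    rewrite /preimage /= => -[y yE]; exists (row_mx y%:M (rsubmx (v : 'rV[R]_(1 + m)))).
    rewrite mul_row_block mulmx1 !mulmx0 addr0 add0r.
    apply: etrans (esym (@hsubmxK _ 1 1 m v)) _.
    congr row_mx; apply/matrixP => i j; rewrite !ord1 mul_scalar_mx !mxE eqxx mulr1n.
    by rewrite -yE /h.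
  move=> [w ->]; rewrite /preimage /= /h -[w]hsubmxK mul_row_block !mulmx0 addr0.
  exists (lsubmx w 0 0); rewrite mul_mx_scalar.
  by rewrite row_mxEl !mxE mulrC.
apply => y; exists (row_mx (y : R)%:M 0); rewrite HE /h.
by rewrite row_mxEl mxE eqxx.
Qed.

Lemma det_diag1 m (x : R) : \det (block_mx (x%:M : 'M_1) 0 0 (1%:M : 'M_m)) = x.
Proof. by rewrite det_lblock det_scalar1 det1 mulr1. Qed.

Lemma mlen_tX m k : mlen (block_mx ((t ^+ k)%:M : 'M_1) 0 0 (1%:M : 'M_m)) k.
Proof.
elim: k => [|k IH].
  by apply: (@mlen_unit _ _ 1%:M); rewrite mul1mx -scalar_mx_block.
have -> : block_mx ((t ^+ k.+1)%:M : 'M_1) 0 0 (1%:M : 'M_m) =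
    block_mx (t%:M : 'M_1) 0 0 1%:M *m block_mx ((t ^+ k)%:M : 'M_1) 0 0 1%:M.
  rewrite mulmx_block !mulmx0 !mul0mx !mulmx1 !addr0 !add0r.
  by rewrite -scalar_mxM -exprS.
rewrite -add1n; apply: mlen_mul (mlen_t m) IH.
by rewrite det_diag1; apply: regular_tX.
Qed.

Lemma t_exp_inj k l w w' v v' : w * w' = 1 -> v * v' = 1 ->
  w * t ^+ k = v * t ^+ l -> k = l.
Proof.
wlog le_kl : k l w w' v v' / (k <= l)%N => [H ww' vv' e|ww' vv' e].
  have [le|/ltnW le] := leqP k l; first exact: (H _ _ _ _ _ _ le ww' vv' e).
  by symmetry; apply: (H _ _ _ _ _ _ le vv' ww' (esym e)).
apply/eqP; rewrite eqn_leq le_kl leqNgt; apply/negP => lt_kl.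
have [m lE] : exists m, (l = k + m.+1)%N by exists (l - k.+1)%N; lia.
apply: (@t_nunit (v * t ^+ m * w')).
have /eqP : t ^+ k * (w - v * t ^+ m.+1) = 0.
  by rewrite mulrBr [t ^+ k * w]mulrC e lE exprD; ring.
move=> /eqP/(@regular_tX k)/eqP; rewrite subr_eq0 => /eqP wE.
by rewrite -ww' wE exprS; ring.
Qed.

(** One pivot factors [A] into invertible matrices, [diag(t^k, 1)] and [diag(1, A2)]; lengths add
    along products just as exponents of [t] add in the determinant. *)
Lemma mlen_det n (A : 'M[R]_n) d w w' : w * w' = 1 -> \det A = w * t ^+ d -> mlen A d.
Proof.
elim: n A d w w' => [|m IH] A d w w' ww' dA.
  have -> : d = 0%N.
    symmetry; apply: (@t_exp_inj _ _ 1 1 w w') => //; first exact: mulr1.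
    by rewrite -dA mul1r det_mx00.
  by apply: (@mlen_unit _ _ 1%:M); apply/matrixP => -[].
have [L [L' [g [LL' L'L LA]]]] := pivot_col total_dvd (lsubmx (A : 'M_(1 + m))).
pose b := usubmx (L *m rsubmx (A : 'M_(1 + m))).
pose A2 := dsubmx (L *m rsubmx (A : 'M_(1 + m))).
have gE : g = (g 0 0)%:M by rewrite -mx11_scalar.
have LAE : L *m (A : 'M_(1 + m)) = block_mx g b 0 A2.
  by rewrite -[A in LHS](@hsubmxK _ (1 + m) 1 m) mul_mx_row LA block_mxEh vsubmxK.
have dLL' : \det L * \det L' = 1 by rewrite -det_mulmx LL' det1.
have dLA : \det L * (w * t ^+ d) = g 0 0 * \det A2.
  rewrite -dA -(@det_mulmx _ (1 + m)) LAE det_ublock; congr (_ * _).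
  by rewrite [in LHS]gE det_scalar1.
have dLw : (\det L * w) * (\det L' * w') = 1 by rewrite mulrACA dLL' ww' mulr1.
(* A factor of this product is a unit times a power of [t]: were it [0], regularity of the product
   would give [1 = 0], and the form holds trivially. *)
have dec0 x y : x * y = \det L * (w * t ^+ d) -> exists k v v', v * v' = 1 /\ x = v * t ^+ k.
  move=> xy; have [x0|//] := t_dec x.
  have : (\det L * w) * t ^+ d * 1 = 0 by rewrite mulr1 -mulrA -xy x0 mul0r.
  move/(regular_dec dLw) => one0; exists 0%N, 1, 1; rewrite !mulr1; split=> //.
  by rewrite x0 one0.
have [k [v [v' [vv' g0]]]] := dec0 _ _ (esym dLA).
have [k2 [v2 [v2' [vv2' A20]]]] : exists k v v', v * v' = 1 /\ \det A2 = v * t ^+ k.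
  by apply: (@dec0 _ (g 0 0)); rewrite mulrC -dLA.
have dE : d = (k + k2)%N.
  apply: (@t_exp_inj _ _ _ _ (v * v2) (v' * v2') dLw).
    by rewrite mulrACA vv' vv2' mulr1.
  transitivity (g 0 0 * \det A2); first by rewrite -dLA mulrA.
  by rewrite g0 A20 exprD; ring.
have lA2 := IH A2 k2 v2 v2' vv2' A20.
have factor : (A : 'M_(1 + m)) = L' *m (block_mx (1%:M : 'M_1) 0 0 A2 *m
    (block_mx (1%:M : 'M_1) b 0 1%:M *m
    (block_mx (v%:M : 'M_1) 0 0 1%:M *m block_mx ((t ^+ k)%:M : 'M_1) 0 0 1%:M))).
  rewrite !mulmx_block !mulmx0 !mul0mx !mulmx1 !mul1mx !addr0 !add0r.
  by rewrite -scalar_mxM -g0 -gE !mulmx0 !mulmx1 addr0 -LAE mulmxA L'L mul1mx.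
have rt : regular (\det (block_mx ((t ^+ k)%:M : 'M_1) 0 0 (1%:M : 'M_m))).
  by rewrite det_diag1; apply: regular_tX.
have rvt : regular (\det (block_mx (v%:M : 'M_1) 0 0 1%:M *m
    block_mx ((t ^+ k)%:M : 'M_1) 0 0 (1%:M : 'M_m))).
  by rewrite det_mulmx !det_diag1; apply: regular_dec vv'.
have u1 : \det (block_mx (1%:M : 'M_1) b 0 (1%:M : 'M_m)) = 1.
  by rewrite det_ublock !det1 mulr1.
suff : mlen (A : 'M_(1 + m)) (0 + (k2 + (0 + (0 + k)))).
  have -> : (0 + (k2 + (0 + (0 + k))))%N = d by rewrite dE; lia.
  by [].
rewrite factor; apply: mlen_mul.
- rewrite !det_mulmx u1 mul1r det_lblock det1 mul1r A20 !det_diag1.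
  rewrite mulrACA -exprD; apply: (@regular_dec _ _ (v2' * v')).
  by rewrite mulrACA vv2' vv' mulr1.
- exact: mlen_unit LL'.
apply: mlen_mul.
- by rewrite det_mulmx u1 mul1r.
- exact: mlen_dblock lA2.
apply: mlen_mul => //.
- apply: (@mlen_unit _ _ (block_mx 1%:M (- b) 0 1%:M)).
  rewrite mulmx_block !mul1mx !mulmx0 !mul0mx !mulmx1 !addr0 !add0r addrN.
  by rewrite -scalar_mx_block.
apply: mlen_mul => //; last exact: mlen_tX.
apply: (@mlen_unit _ _ (block_mx (v'%:M : 'M_1) 0 0 1%:M)).
rewrite mulmx_block !mulmx0 !mul0mx !mulmx1 !addr0 !add0r -scalar_mxM mulrC vv'.
by rewrite -scalar_mx_block.
Qed.

End DvrLength.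

(** * The Frobenius matrix of a Kisin module with a basis *)

Lemma linear_inverse (R : pzRingType) (V V' : lmodType R) (h : {linear V -> V'}) :
  bijective h -> exists h' : {linear V' -> V}, cancel h h' /\ cancel h' h.
Proof.
move=> [g hg gh]; have g_lin : linear g.
  by move=> a x y; apply: (can_inj hg); rewrite gh linearP !gh.
pose gM := GRing.isLinear.Build _ _ _ _ g g_lin.
pose G : {linear V' -> V} := HB.pack g gM.
by exists G.
Qed.

Section Basis.
Variable D : kisin_base.
Local Notation S := (SS D).
Local Notation E := (ES D).
Local Notation toE := (to_loc [set E]).
Local Notation phi := (@phiS D).

Variables (R : idomainType) (rho : {rmorphism S -> R}) (phiR : {rmorphism R -> R}).
Hypothesis rho_surj : forall x, exists y, rho y = x.
Hypothesis rho_phi : forall x, rho (phiS x) = phiR (rho x).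
Hypothesis rho_E : rho E != 0.
Local Notation RV := (RV rho).

Variables (N : phi_module D) (n : nat) (g : {linear RV n -> N}).
Hypothesis g_bij : bijective g.

Lemma basis_toE_inj : injective (@to_invE D N).
Proof.
have [h [gh hg]] := linear_inverse g_bij.
move=> x y /(congr1 (bchange_map toE h)); rewrite /to_invE !bchange_map1.
by move=> /(RV_toE_inj rho_E); apply: can_inj.
Qed.

Lemma frob_twistE r x : frob (twist N r) x = twist_coef D r *: frob N x.
Proof. by []. Qed.

Definition is_matrix r (A : 'M[R]_n) : Prop := forall v : 'rV[R]_n,
  twist_coef D r *: frob N (to_invE (bc1 phi (g (v : RV n)))) =
  to_invE (g (map_mx phiR v *m A : RV n)).

Lemma exists_matrix r : effective (twist N r) -> exists A, is_matrix r A.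
Proof.
move=> eff; have [h [gh hg]] := linear_inverse g_bij.
have /choice[m mE] (i : 'I_n) : exists m : N,
  twist_coef D r *: frob N (to_invE (bc1 phi (g (delta_mx 0 i : RV n)))) = to_invE m.
  exact: eff.
exists (\matrix_(i, j) (h (m i) : 'rV[R]_n) 0 j) => v.
have [s sE] := RV_lift rho_surj v.
rewrite {1}(RV_basis sE) linear_sum.
have -> : bc1 phi (\sum_i g (s i *: (delta_mx 0 i : RV n))) =
    \sum_i phi (s i) *: bc1 phi (g (delta_mx 0 i : RV n)).
  rewrite -(semilinear_sum _ _ _ (@bc1_semilinear _ _ phi N)).
  by congr (bc1 _ _); apply: eq_bigr => i _; rewrite linearZ.
have -> : to_invE (\sum_i phi (s i) *: bc1 phi (g (delta_mx 0 i : RV n))) =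
    \sum_i toE (phi (s i)) *: to_invE (bc1 phi (g (delta_mx 0 i : RV n))).
  exact: (semilinear_sum _ _ _ (@bc1_semilinear _ _ toE (phi_pull N))).
rewrite linear_sum scaler_sumr.
transitivity (\sum_i toE (phi (s i)) *: to_invE (m i)).
  by apply: eq_bigr => i _; rewrite linearZ /= -mE !scalerA mulrC.
rewrite /to_invE -(semilinear_sum _ _ _ (@bc1_semilinear _ _ toE N)); congr (bc1 _ _).
rewrite [X in g X](_ : _ = \sum_i phi (s i) *: h (m i)).
  by rewrite linear_sum; apply: eq_bigr => i _; rewrite linearZ hg.
apply/rowP => j; rewrite !mxE summxE; apply: eq_bigr => i _.
by rewrite RV_scale !mxE rho_phi sE.
Qed.

Lemma matrix_image r (A : 'M[R]_n) : is_matrix r A ->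
  [set m : N | exists x : phi_pull N, frob (twist N r) (to_invE x) = to_invE m] =
  [set m | exists w : 'rV[R]_n, m = g (w *m A : RV n)].
Proof.
move=> mA; have [h [gh hg]] := linear_inverse g_bij.
apply/seteqP; split=> m /=.
  move=> [x e]; have [s sE] := bchange_span x.
  exists (\sum_(z <- s) rho z.1 *: map_mx phiR (h z.2 : 'rV[R]_n)).
  apply: basis_toE_inj; rewrite -e sE.
  rewrite [to_invE _](semilinear_sum _ _ _ (@bc1_semilinear _ _ toE (phi_pull N))).
  rewrite linear_sum scaler_sumr mulmx_suml.
  transitivity (to_invE (\sum_(z <- s) z.1 *: g (map_mx phiR (h z.2 : 'rV[R]_n) *m A : RV n))).
    rewrite [RHS](semilinear_sum _ _ _ (@bc1_semilinear _ _ toE N)).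
    apply: eq_bigr => z _; rewrite linearZ /= -[in LHS](hg z.2) scalerA mulrC -scalerA.
    by congr (_ *: _); apply: mA.
  congr to_invE; rewrite linear_sum; apply: eq_bigr => z _.
  by rewrite -linearZ -scalemxAl.
move=> [w ->]; have [s sE] := RV_lift rho_surj w.
exists (\sum_i s i *: bc1 phi (g (delta_mx 0 i : RV n))).
rewrite [to_invE _](semilinear_sum _ _ _ (@bc1_semilinear _ _ toE (phi_pull N))).
rewrite linear_sum scaler_sumr.
have -> : (w *m A : RV n) = \sum_i s i *: (map_mx phiR (delta_mx 0 i : 'rV[R]_n) *m A : RV n).
  rewrite [w]row_sum_delta mulmx_suml; apply: eq_bigr => i _.
  by rewrite RV_scale sE map_delta_mx -scalemxAl.
rewrite linear_sum.
have -> : \sum_i g (s i *: (map_mx phiR (delta_mx 0 i : 'rV[R]_n) *m A : RV n)) =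
    \sum_i s i *: g (map_mx phiR (delta_mx 0 i : 'rV[R]_n) *m A : RV n).
  by apply: eq_bigr => i _; rewrite linearZ.
rewrite [RHS](semilinear_sum _ _ _ (@bc1_semilinear _ _ toE N)).
apply: eq_bigr => i _; rewrite linearZ scalerA mulrC -scalerA; congr (_ *: _).
exact: mA.
Qed.

(** Bounded height puts [E^b N] in the image of Frobenius. A twist [r >= 0] costs a factor [tS^r],
    whence [i = r]; a negative twist is cancelled by scaling the preimage, and [i = 0]. *)
Lemma matrix_cofactor r (A : 'M[R]_n) : bounded_height N -> is_matrix r A ->
  exists i b (W : 'M[R]_n), W *m A = (rho (tS D ^+ i * E ^+ b))%:M.
Proof.
move=> [a [b [_ hb]]] mA; have im := matrix_image mA.
have [i iE] : exists i, forall m : N, exists x : phi_pull N,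
    frob (twist N r) (to_invE x) = to_invE ((tS D ^+ i * E ^+ b) *: m).
  case: r mA im => r mA im.
    exists r => m; have [x xE] := hb m; exists x.
    by rewrite frob_twistE -xE twist_coef_tS scalerA /to_invE bc1Z rmorphM.
  exists 0%N => m; have [x xE] := hb m; exists (tS D ^+ r.+1 *: x).
  rewrite frob_twistE /to_invE bc1Z linearZ /= -[frob N _]xE expr0 mul1r !scalerA bc1Z.
  congr (_ *: _).
  have tt : tinv D ^+ r.+1 * toE (tS D ^+ r.+1) = 1.
    by rewrite rmorphXn -exprMn mulrC tS_tinv expr1n.
  by rewrite [X in X * _]tt mul1r.
exists i, b; have [h [gh hg]] := linear_inverse g_bij.
have /choice[w wE] (j : 'I_n) : exists w : 'rV[R]_n,
    w *m A = rho (tS D ^+ i * E ^+ b) *: delta_mx 0 j.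
  have [x xE] := iE (g (delta_mx 0 j : RV n)).
  have : [set m : N | exists x : phi_pull N, frob (twist N r) (to_invE x) = to_invE m]
    ((tS D ^+ i * E ^+ b) *: g (delta_mx 0 j : RV n)) by exists x.
  by rewrite im => -[w e]; exists w; apply: (can_inj gh); rewrite -e -linearZ.
exists (\matrix_(j, l) w j 0 l); apply/row_matrixP => j.
rewrite row_mul (_ : row j _ = w j) ?wE; last by apply/rowP => l; rewrite !mxE.
by apply/rowP => l; rewrite !mxE eqxx /= mulr_natr eq_sym.
Qed.

Lemma matrix_twist r k (A A' : 'M[R]_n) : is_matrix r A -> is_matrix (r + k%:Z) A' ->
  A' = rho (tS D ^+ k) *: A.
Proof.
move=> mA mA'; have [h [gh hg]] := linear_inverse g_bij.
have tw : twist_coef D (r + k%:Z) = twist_coef D r * toE (tS D ^+ k).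
  have tt j : toE (tS D) ^+ j * tinv D ^+ j = 1 by rewrite -exprMn tS_tinv expr1n.
  rewrite rmorphXn; case: r {mA mA'} => r.
    by rewrite -PoszD /= exprD.
  have -> : twist_coef D (Negz r) = tinv D ^+ r.+1 by [].
  have [le|lt] := leqP r.+1 k.
    have -> : Negz r + k%:Z = Posz (k - r.+1) by lia.
    rewrite [LHS]twist_coef_tS -[in RHS](subnK le) exprD mulrCA [tinv D ^+ _ * _]mulrC tt mulr1.
    by rewrite rmorphXn.
  have -> : Negz r + k%:Z = Negz (r - k) by lia.
  rewrite -[LHS]/(tinv D ^+ (r - k).+1).
  have -> : (r.+1 = (r - k).+1 + k)%N by lia.
  by rewrite exprD -mulrA [tinv D ^+ k * _]mulrC tt mulr1.
apply/row_matrixP => i; rewrite rowE [in RHS]rowE.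
have phid : map_mx phiR (delta_mx 0 i : 'rV[R]_n) = delta_mx 0 i by rewrite map_delta_mx.
rewrite -scalemxAr -phid.
apply: (can_inj gh); apply: basis_toE_inj.
rewrite -mA' tw mulrC -scalerA mA.
by rewrite /to_invE -bc1Z; congr (bc1 _ _); rewrite -linearZ.
Qed.

Section Length.
Variables (Z : comPzRingType) (z : {rmorphism Z -> S}) (zeta : {rmorphism Z -> R}).
Hypothesis zetaE : forall x, zeta x = rho (z x).

Lemma coker_length r (A : 'M[R]_n) l : is_matrix r A ->
  rlen (V := VV zeta n) setT (@rowsp _ _ zeta _ _ A) l ->
  has_length (restr z (coker (twist N r))) l.
Proof.
move=> mA; have [h [gh hg]] := linear_inverse g_bij.
pose P := [set m : twist N r | exists x : phi_pull (twist N r), frob (twist N r) (to_invE x) = to_invE m].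
have PE : P = [set m | exists w : 'rV[R]_n, m = g (w *m A : RV n)] by exact: matrix_image.
have [q qE] := to_quotm_linear P.
pose f (v : VV zeta n) : restr z (quotm P) := q (g v).
have f_lin : linear f.
  move=> c x y.
  rewrite [c *: x](_ : _ = z c *: (x : RV n)); last by rewrite RV_scale VV_scale zetaE.
  have -> : f (z c *: (x : RV n) + y) = q (z c *: g x + g y).
    by congr (q _); exact: linearP.
  exact: linearP.
pose fM := GRing.isLinear.Build _ _ _ _ f f_lin.
pose F : {linear VV zeta n -> restr z (quotm P)} := HB.pack f fM.
apply: (@rlen_surj_has_length _ _ _ F).
- by move=> y; have [m ->] := to_quotmP y; exists (h m); rewrite -[LHS]/(q (g (h m))) hg qE.
have sP : is_submod P.
  rewrite PE; split=> [|c _ _ [w ->] [w' ->]]; first by exists 0; rewrite mul0mx linear0.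
  by exists (rho c *: w + w'); rewrite mulmxDl -scalemxAl -linearP.
move=> x; rewrite -[F x]/(q (g x)) qE; split.
  move=> /to_quotm0; rewrite (gen_submod_id sP) PE => -[w /(can_inj gh) ->].
  by exists w.
by move=> [w xE]; apply/to_quotm0; rewrite (gen_submod_id sP) PE; exists w; rewrite xE.
Qed.

End Length.
End Basis.

Section BasisOf.
Variable D : kisin_base.
Local Notation S := (SS D).
Variables (R : idomainType) (rho : {rmorphism S -> R}).
Hypothesis rho_surj : forall x, exists y, rho y = x.

Lemma basis_of_generators (V : lmodType S) n (s : 'I_n -> V) : generates s ->
  (forall a, \sum_i a i *: s i = 0 <-> forall i, rho (a i) = 0) ->
  exists g : {linear RV rho n -> V}, bijective g /\ forall i, g (delta_mx 0 i) = s i.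
Proof.
move=> gs rel; have [l lE] := choice rho_surj.
pose g (v : RV rho n) := \sum_i l ((v : 'rV[R]_n) 0 i) *: s i.
have gP (v : RV rho n) (r : 'I_n -> S) : (forall i, rho (r i) = (v : 'rV[R]_n) 0 i) ->
    g v = \sum_i r i *: s i.
  move=> rE; apply/eqP; rewrite -subr_eq0 -sumrB; apply/eqP.
  under eq_bigr do rewrite -scalerBl.
  by apply/rel => i; rewrite rmorphB lE rE subrr.
have g_lin : linear g.
  move=> c x y.
  rewrite (@gP _ (fun i => c * l ((x : 'rV[R]_n) 0 i) + l ((y : 'rV[R]_n) 0 i))).
    rewrite /g scaler_sumr -big_split; apply: eq_bigr => i _ /=.
    by rewrite scalerDl scalerA.
  by move=> i; rewrite rmorphD rmorphM !lE RV_scale !mxE.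
pose gM := GRing.isLinear.Build _ _ _ _ g g_lin.
pose G : {linear RV rho n -> V} := HB.pack g gM.
have [h hE] := choice gs.
exists G; split; last first.
  move=> i; rewrite -[LHS]/(g _) (@gP _ (fun j => (j == i)%:R)).
    rewrite (bigD1 i) //= eqxx scale1r big1 ?addr0 // => j /negPf ->.
    by rewrite scale0r.
  by move=> j; rewrite rmorph_nat mxE eqxx.
exists (fun x => (\row_i rho (h x i) : RV rho n)) => x.
  apply/rowP => i; rewrite mxE; apply/eqP; rewrite -subr_eq0; apply/eqP.
  rewrite -[(x : 'rV[R]_n) 0 i]lE -rmorphB.
  move: i; apply/rel; under eq_bigr do rewrite scalerBl.
  by rewrite sumrB -hE subrr.
rewrite -[LHS]/(g _) (@gP _ (h x)) -?hE // => i.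
by rewrite mxE.
Qed.

End BasisOf.

(** * Modules killed by p: bases, length and rank *)

Section Torsion.
Variable D : kisin_base.
Local Notation S := (SS D).
Local Notation p := (res_char D).
Local Notation k := (kf D).
Local Notation u := (fpsX k).
Local Notation e := (eE D).

Definition redS : {rmorphism S -> fps k} := rhoS D.
Definition phk : {rmorphism fps k -> fps k} := @phik D.

Lemma redS_surj x : exists y, redS y = x.
Proof. exact: fps_map_surj (Wk_strict D) x. Qed.

Lemma redS_phi x : redS (phiS x) = phk (redS x).
Proof. exact: rhoS_phi. Qed.

Lemma redS_E : redS (ES D) = u ^+ e. Proof. exact: rhoS_E. Qed.

Lemma redS_E0 : redS (ES D) != 0.
Proof. by rewrite redS_E expf_neq0 // fpsX_neq0. Qed.

Lemma redS_u : redS (uS D) = u. Proof. exact: fps_mapX. Qed.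

Lemma redS_u0 : redS (uS D) != 0. Proof. by rewrite redS_u fpsX_neq0. Qed.

Lemma redS_ker x : redS x = 0 <-> exists y, x = p%:R * y.
Proof. exact: rho_ker. Qed.

Lemma pk0 : p%:R = 0 :> fps k.
Proof.
by have /redS_ker : exists y : S, p%:R = p%:R * y; [exists 1; rewrite mulr1 | rewrite rmorph_nat].
Qed.

Lemma redS_ker_phi x : redS x = 0 -> exists y z, x = phiS y * z /\ redS y = 0.
Proof.
move=> /redS_ker[z zE]; exists p%:R, z; split; last by apply/redS_ker; exists 1; rewrite mulr1.
by rewrite (rmorph_nat (@phiS D)).
Qed.

Lemma redS_t : exists2 w, w \is a GRing.unit & redS (tS D) = w * u ^+ e.
Proof.
exists (redS (fpsC (Eis_c0 D)^-1)); last by rewrite rmorphM redS_E.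
apply/unitrPr; exists (redS (fpsC (Eis_c0 D))).
by rewrite -rmorphM c0V rmorph1.
Qed.

(** A relation that is nonzero modulo [p] can be divided by the least power of [u] occurring in its
    coefficients, as [N] has no [u]-torsion. Some coefficient becomes a unit, against minimality of
    the generators. *)
Lemma torsion_basis (N : lmodType S) : fingen N -> u_torsion_free N ->
  (forall x : N, p%:R *: x = 0) -> exists n (g : {linear RV redS n -> N}), bijective g.
Proof.
move=> /fingen_generates[m [s0 /minimal_generators[n [s [gs minrel]]]]] uN pN.
have p0 (c : S) (x : N) : redS c = 0 -> c *: x = 0.
  by move=> /redS_ker[y ->]; rewrite mulrC -scalerA pN scaler0.
have uX j (x : N) : uS D ^+ j *: x = 0 -> x = 0.
  elim: j x => [|j IH] x; first by rewrite expr0 scale1r.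
  by rewrite exprS -scalerA => /uN/IH.
suff rel a : \sum_i a i *: s i = 0 <-> forall i, redS (a i) = 0.
  by have [g [gb _]] := basis_of_generators redS_surj gs rel; exists n, g.
split=> [sum0|a0]; last by rewrite big1 // => i _; rewrite p0.
apply: contrapT => /existsNP[i0 /eqP nz].
have dvr := fps_dvr k.
case: (arg_minnP (fun i => val u (redS (a i))) (i0 := i0) (P := fun i => redS (a i) != 0)) => //.
move=> i nzi imin; set v := val u (redS (a i)) in imin.
have /choice[b bE] (j : 'I_n) : exists b : S, redS (a j) = redS (b * uS D ^+ v).
  have [z zE] : exists z, redS (a j) = z * u ^+ v.
    have [->|nzj] := eqVneq (redS (a j)) 0; first by exists 0; rewrite mul0r.
    have [w _ wE] := val_dec dvr nzj; exists (w * u ^+ (val u (redS (a j)) - v)).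
    by rewrite {1}wE -mulrA -exprD subnK // imin.
  have [y yE] := redS_surj z; exists y.
  by rewrite zE rmorphM rmorphXn redS_u yE.
have sumb : \sum_j b j *: s j = 0.
  apply: (uX v); rewrite scaler_sumr; rewrite -[RHS]sum0.
  apply: eq_bigr => j _; apply/eqP; rewrite scalerA -subr_eq0 -scalerBl; apply/eqP/p0.
  by rewrite rmorphB bE [b j * _]mulrC subrr.
apply: (minrel b sumb i).
have : redS (b i) \is a GRing.unit.
  have [w uw wE] := val_dec dvr nzi.
  have : redS (b i) * u ^+ v = w * u ^+ v.
    by rewrite -wE bE rmorphM rmorphXn redS_u.
  by move/(mulIf (expf_neq0 _ (fpsX_neq0 k))) => ->.
by move/rhoS_unit => /unitrPr[y yE]; exists y; rewrite mulrC.
Qed.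

Definition zetak : {rmorphism Zp D -> fps k} := (redS \o (@fpsC (Wk D) \o ZpWk D))%FUN.

Lemma rlen_residue : rlen (V := restr zetak (fps k)^o) setT
  [set x | exists y : fps k, x = y * u] (res_deg D).
Proof.
pose h (x : restr zetak (fps k)^o) : restr (actk D) k^o := fcoef (x : fps k) 0.
have h_lin : linear h.
  move=> c x y; rewrite /h.
  rewrite -[fcoef (c *: x + y) 0]/(fcoef (zetak c * (x : fps k)) 0 + fcoef (y : fps k) 0).
  by rewrite fcoefM big_ord1.
pose hM := GRing.isLinear.Build _ _ _ _ h h_lin.
pose H : {linear restr zetak (fps k)^o -> restr (actk D) k^o} := HB.pack h hM.
have [om [gen ind]] := exists_res_lifts D.
have base : rlen [set: restr (actk D) k^o] [set 0] (res_deg D).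
  apply: (@rlen_basis _ (restr (actk D) k^o) [set z | exists y, z = p%:R * y] _
    (fun j => Wk_red D (om j) : restr (actk D) k^o)).
  - move=> [y /(congr1 (Zp_red D))/eqP]; rewrite rmorph1 rmorphM.
    by rewrite (strict_red_p (Zp_strict D)) mul0r oner_eq0.
  - move=> a na; have [//|[b bE]] := Zp_dvd_or_unit a.
    by exists b, 0; rewrite bE subrr mulr0.
  - exact: gen.
  - move=> a j [y ->]; rewrite -[LHS]/(actk D (p%:R * y) * Wk_red D (om j)).
    by rewrite actk_p mul0r.
  exact: ind.
have := rlen_preim (h := H) _ base.
have -> : H @^-1` setT = setT by [].
have -> : H @^-1` [set 0] = [set x | exists y : fps k, x = y * u].
  apply/seteqP; split=> x; rewrite /preimage /=.
    move=> x0; exists (fps_shift 1 (x : fps k)); rewrite mulrC -[u]expr1.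
    by apply: fps_shiftE => -[].
  by move=> [y ->]; rewrite /h mulrC fcoefXM.
by apply => y; exists (fpsC (y : k) : fps k).
Qed.

Lemma torsion_length (N : phi_module D) n (g : {linear RV redS n -> N}) r (A : 'M[fps k]_n) :
  bijective g -> is_matrix phk g r A -> \det A != 0 ->
  has_length (restr (@fpsC (Wk D) \o ZpWk D)%FUN (coker (twist N r)))
    (res_deg D * val u (\det A)).
Proof.
move=> gb mA A0; apply: (coker_length (zeta := zetak) redS_surj redS_E0 gb _ mA) => //.
have dvr := fps_dvr k.
have [w uw wE] := val_dec dvr A0.
have t_reg (x : fps k) : u * x = 0 -> x = 0.
  by move/eqP; rewrite mulf_eq0 (negPf (fpsX_neq0 k)) => /eqP.
have t_dec (x : fps k) : x = 0 \/ exists k w w', w * w' = 1 /\ x = w * u ^+ k.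
  have [->|x0] := eqVneq x 0; [by left | right].
  have [v uv vE] := val_dec dvr x0; exists (val u x), v, v^-1; split=> //.
  exact: mulrV.
apply: (mlen_det (dvr_total dvr) t_reg t_dec _ rlen_residue (mulrV uw) wE).
move=> x xu; have /negP := fpsX_nunit k; apply.
by apply/unitrPr; exists x; rewrite mulrC.
Qed.

(** Modulo [p] the ring [O_E] is a field, and the base change of [N] has the images of the basis
    vectors of [g] as a basis over it. *)
Lemma rank_torsE (N : phi_module D) n (g : {linear RV redS n -> N}) :
  bijective g -> rank_tors N = n.
Proof.
move=> gb; have [h [gh hg]] := linear_inverse gb.
have pN (x : N) : p%:R *: x = 0.
  by rewrite -[x]hg -linearZ RV_scale rmorph_nat pk0 scale0r linear0.
set f : {rmorphism S -> OE D} := (toOE D \o to_loc [set uS D])%FUN.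
pose I : set (OE D) := [set x0 | exists y, x0 = p%:R * y].
pose U : loc [set uS D] := to_loc [set uS D] (uS D).
pose Ui : loc [set uS D] := frac 1 (@denomT S [set uS D] (uS D) erefl).
have UUi : U * Ui = 1 by exact: to_loc_inv.
have UUX j : U ^+ j * Ui ^+ j = 1 by rewrite -exprMn UUi expr1n.
have locE (v : loc [set uS D]) : exists c j, v = to_loc [set uS D] c * Ui ^+ j.
  have [c [s [ds xE]]] := fracP v; have [j sE] := denom_set1 ds.
  exists c, j; rewrite xE fracE; congr (_ * _).
  have e1 : U ^+ j * frac 1 ds = 1 by rewrite -rmorphXn -sE; exact: to_loc_inv.
  by rewrite -[LHS]mul1r -(UUX j) mulrAC e1 mul1r.
have I_sub : is_submod (I : set (OE D)^o).
  split=> [|a _ _ [y ->] [y' ->]]; first by exists 0; rewrite mulr0.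
  by exists (a * y + y'); rewrite /GRing.scale /= mulrDr mulrCA.
(* If [p] were invertible in [O_E], then by [pc_inj] it would be so in [W[[u]][1/u]], and a power of
   [u] would vanish in [k[[u]]]. *)
have nI1 : ~ I 1.
  move=> [y yE]; have [] := pc_inj (toOE_completion D) (n := 1) (a := 1).
    by exists y; rewrite rmorph1 expr1.
  move=> v; rewrite expr1; have [c [j ->]] := locE v => e1.
  have : to_loc [set uS D] (uS D ^+ j) = to_loc [set uS D] (p%:R * c).
    rewrite rmorphXn rmorphM rmorph_nat.
    transitivity (p%:R * (to_loc [set uS D] c * Ui ^+ j) * U ^+ j); first by rewrite -e1 mul1r.
    by rewrite -!mulrA [Ui ^+ j * _]mulrC UUX mulr1.
  move/frac_eq => [w /denom_set1[l ->]]; rewrite !mulr1 => /(congr1 redS).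
  rewrite !rmorphM !rmorphXn redS_u rmorph_nat pk0 mul0r mulr0.
  by move/eqP; rewrite mulf_eq0 !expf_eq0 (negPf (fpsX_neq0 k)) !andbF.
(* Modulo [p], [a] is a fraction [c / u^j] with [c] nonzero in [k[[u]]]. If [c] reduces to [w u^l]
   with [w] a unit, an inverse is a lift of [w^-1] times [u^(j - l)]. *)
have Iinv a : ~ I a -> exists b, I (b * a - 1).
  move=> nIa. have [x [y yE]] := pc_dense (toOE_completion D) a 1.
  rewrite expr1 in yE; have [c [j xE]] := locE x.
  have aE : a = toOE D x + p%:R * y by rewrite -yE addrC subrK.
  have c0 : redS c != 0.
    apply/eqP => /redS_ker[c' c'E]; apply: nIa.
    exists (toOE D (to_loc _ c' * Ui ^+ j) + y).
    have pM : to_loc [set uS D] (p%:R * c') * Ui ^+ j = p%:R * (to_loc [set uS D] c' * Ui ^+ j).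
      by rewrite (rmorphM (to_loc [set uS D])) rmorph_nat mulrA.
    by rewrite aE xE c'E pM (rmorphM (toOE D)) rmorph_nat mulrDr.
  have [w uw wE] := val_dec (fps_dvr k) c0; set l := val _ _ in wE.
  have [w' w'E] := redS_surj w^-1.
  have [c' c'E] : exists c', w' * c - uS D ^+ l = p%:R * c'.
    apply/redS_ker; rewrite rmorphB rmorphM rmorphXn redS_u w'E wE mulrA mulVr //.
    by rewrite mul1r subrr.
  pose b := toOE D (to_loc [set uS D] w' * U ^+ j * Ui ^+ l).
  exists b, (toOE D (to_loc [set uS D] c' * Ui ^+ l) + b * y).
  rewrite aE mulrDr [b * (p%:R * y)]mulrCA [RHS]mulrDr addrAC; congr (_ + _).
  rewrite /b -rmorphM xE.
  have -> : to_loc [set uS D] w' * U ^+ j * Ui ^+ l * (to_loc [set uS D] c * Ui ^+ j) =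
      to_loc [set uS D] (w' * c) * Ui ^+ l * (U ^+ j * Ui ^+ j).
    have alg (A : comPzRingType) (a1 a2 a3 a4 a5 : A) :
      a1 * a2 * a3 * (a4 * a5) = a1 * a4 * a3 * (a2 * a5) by ring.
    by rewrite rmorphM; exact: alg.
  rewrite UUX mulr1 (_ : w' * c = uS D ^+ l + p%:R * c'); last by rewrite -c'E addrC subrK.
  rewrite (rmorphD (to_loc _)) (rmorphXn (to_loc _)) mulrDl UUX (rmorphD (toOE D)) rmorph1.
  rewrite addrC addKr (rmorphM (to_loc _)) rmorph_nat -mulrA (rmorphM (toOE D)).
  by rewrite rmorph_nat.
have bcsum (v : 'I_n -> S) : bc1 f (g (\sum_i v i *: (delta_mx 0 i : RV redS n))) =
    \sum_i f (v i) *: bc1 f (g (delta_mx 0 i : RV redS n)).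
  rewrite linear_sum -(semilinear_sum _ _ _ (@bc1_semilinear _ _ f N)).
  by congr (bc1 _ _); apply: eq_bigr => i _; rewrite linearZ.
apply/mlengthE/rlen_has_length.
apply: (@rlen_basis _ _ I _ (fun i => bc1 f (g (delta_mx 0 i : RV redS n)))) => //.
- move=> x; have [s ->] := bchange_span x.
  have [v vE] := choice (fun m : N => RV_lift redS_surj (h m : 'rV[fps k]_n)).
  exists (fun i => \sum_(z <- s) z.1 * f (v z.2 i)).
  under [RHS]eq_bigr do rewrite scaler_suml.
  rewrite exchange_big /=; apply: eq_bigr => z _.
  rewrite -{1}[z.2]hg {1}(RV_basis (vE z.2)) bcsum scaler_sumr.
  by apply: eq_bigr => i _; rewrite scalerA.
- move=> a i [y ->]; rewrite mulrC -scalerA -(rmorph_nat f) -bc1Z pN.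
  by rewrite bc1_0 scaler0.
move=> a sum0 i.
have [l lE] := choice redS_surj.
pose T := quotm (I : set (OE D)^o).
have [q qE] := to_quotm_linear (I : set (OE D)^o).
have q0 x : q x = 0 <-> I x by rewrite qE to_quotm0 (gen_submod_id I_sub).
(* The [i]-th coordinate with values in [O_E/p]; it extends to the base change and extracts the
   class of [a i] from the relation. *)
pose b (m : N) : T := q (f (l ((h m : 'rV[fps k]_n) 0 i))).
have bP m (c : S) : redS c = (h m : 'rV[fps k]_n) 0 i -> b m = q (f c).
  move=> cE; apply/eqP; rewrite -subr_eq0 -linearB; apply/eqP/q0.
  rewrite -rmorphB.
  have /redS_ker[y ->] : redS (l ((h m : 'rV[fps k]_n) 0 i) - c) = 0.
    by rewrite rmorphB lE cE subrr.
  by exists (f y); rewrite rmorphM rmorph_nat.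
have b_semi : semilinear_over f b.
  move=> r x y.
  rewrite (@bP _ (r * l ((h x : 'rV[fps k]_n) 0 i) + l ((h y : 'rV[fps k]_n) 0 i))).
    by rewrite rmorphD rmorphM -linearP.
  by rewrite rmorphD rmorphM !lE linearP !mxE.
have [L LE] := bchange_lift b_semi.
have := congr1 L sum0; rewrite linear0 linear_sum (bigD1 i) //= big1 ?addr0; last first.
  move=> j nji; rewrite linearZ /= LE (@bP _ 0) ?rmorph0 ?linear0 ?scaler0 //.
  by rewrite gh mxE eq_sym (negPf nji) andbF.
rewrite linearZ /= LE (@bP _ 1) ?rmorph1; last by rewrite gh mxE !eqxx.
by rewrite -linearZ => /q0; rewrite /GRing.scale /= mulr1.
Qed.

End Torsion.

(** * Slopes of torsion modules *)

Section MatrixEffective.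
Variable D : kisin_base.
Local Notation S := (SS D).
Local Notation toE := (to_loc [set ES D]).
Variables (R : idomainType) (rho : {rmorphism S -> R}) (phiR : {rmorphism R -> R}).
Variables (N : phi_module D) (n : nat) (g : {linear RV rho n -> N}).
Hypothesis g_bij : bijective g.

Lemma matrix_effective r (A : 'M[R]_n) : is_matrix phiR g r A -> effective (twist N r).
Proof.
move=> mA x; have [h [gh hg]] := linear_inverse g_bij.
have [s ->] := bchange_span x.
exists (\sum_(z <- s) z.1 *: g (map_mx phiR (h z.2 : 'rV[R]_n) *m A : RV rho n)).
rewrite [to_invE _](semilinear_sum _ _ _ (@bc1_semilinear _ _ toE (phi_pull N))).
rewrite [RHS](semilinear_sum _ _ _ (@bc1_semilinear _ _ toE N)).
rewrite linear_sum; apply: eq_bigr => z _; rewrite linearZ /=; congr (_ *: _).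
by rewrite -[in LHS](hg z.2); apply: mA.
Qed.

Lemma effective_height a : (forall x : phi_pull N, exists m : N,
    toE (ES D ^+ a) *: frob N (to_invE x) = to_invE m) ->
  forall k, effective (twist N (Posz (k + a))).
Proof.
move=> h k x; have [m mE] := h x.
exists (((fpsC (Eis_c0 D)^-1) ^+ a * tS D ^+ k) *: m).
rewrite frob_twistE twist_coef_tS /to_invE bc1Z -[bc1 _ m]mE scalerA -rmorphM.
have tSa : tS D ^+ a = fpsC (Eis_c0 D)^-1 ^+ a * ES D ^+ a by exact: exprMn.
by congr (toE _ *: _); rewrite exprD tSa mulrA [tS D ^+ k * _]mulrC.
Qed.

End MatrixEffective.

Section TorsionDegree.
Variable D : kisin_base.
Local Notation p := (res_char D).
Local Notation k := (kf D).
Local Notation u := (fpsX k).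
Local Notation e := (eE D).
Local Notation redS := (redS D).
Local Notation phk := (@phk D).

Lemma val_redS_t j n (A : 'M[fps k]_n) : \det A != 0 ->
  val u (\det (redS (tS D ^+ j) *: A)) = (e * j * n + val u (\det A))%N.
Proof.
move=> A0; have [w uw wE] := redS_t D; have dvr := fps_dvr k.
have -> : \det (redS (tS D ^+ j) *: A) = redS (tS D ^+ j) ^+ n * \det A by exact: detZ.
have t0 : redS (tS D ^+ j) ^+ n = w ^+ (j * n) * u ^+ (e * j * n).
  by rewrite rmorphXn wE -exprM exprMn -exprM mulnA.
have uwn : w ^+ (j * n) \is a GRing.unit by rewrite unitrX.
rewrite (valM dvr) ?t0 ?(valE dvr) // mulf_neq0 ?expf_neq0 ?fpsX_neq0 //.
by apply: contraTneq uw => ->; rewrite unitr0.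
Qed.

Lemma e_neq0 : (e%:R : rat) != 0.
Proof. by rewrite pnatr_eq0 -lt0n eE_gt0. Qed.

Lemma degK_quot l : ((res_deg D * l)%:R / (degK D)%:R : rat) = l%:R / e%:R.
Proof.
have f0 : ((res_deg D)%:R : rat) != 0 by rewrite pnatr_eq0 -lt0n res_deg_gt0.
have e0 := e_neq0; rewrite degKE !natrM.
by field; rewrite f0 e0.
Qed.

Section Degree.
Variables (N : phi_module D) (n : nat) (g : {linear RV redS n -> N}).
Hypotheses (g_bij : bijective g) (bh : bounded_height N).

Lemma matrix_det_neq0 r (A : 'M[fps k]_n) : is_matrix phk g r A -> \det A != 0.
Proof.
move=> mA; have [i [b [W WA]]] := matrix_cofactor (@redS_surj D) (redS_E0 D) g_bij bh mA.
have : \det W * \det A = redS (tS D ^+ i * ES D ^+ b) ^+ n.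
  by rewrite -(det_scalar n) -WA; apply/esym/det_mulmx.
move=> e1; apply/eqP => A0; move/esym/eqP: e1; rewrite A0 mulr0 expf_eq0 rmorphM.
rewrite !rmorphXn mulf_eq0 !expf_eq0 (negPf (redS_E0 D)) !andbF orbF.
have [w uw ->] := redS_t D; rewrite mulf_eq0 expf_eq0 (negPf (fpsX_neq0 k)) andbF orbF.
by move=> /andP[_ /andP[_ /eqP w0]]; rewrite w0 unitr0 in uw.
Qed.

Lemma matrix_val r r' (A A' : 'M[fps k]_n) : is_matrix phk g r A -> is_matrix phk g r' A' ->
  ((val u (\det A))%:R / e%:R - r%:~R * n%:R : rat) =
  (val u (\det A'))%:R / e%:R - r'%:~R * n%:R.
Proof.
wlog [j jE] : r r' A A' / exists j : nat, r' = r + j%:Z => [H mA mA'|mA mA'].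
  have [le|lt] := lerP r r'.
    by apply: H mA mA'; exists `|r' - r|%N; lia.
  by symmetry; apply: H mA' mA; exists `|r - r'|%N; lia.
rewrite jE in mA' *; have A0 := matrix_det_neq0 mA.
rewrite (matrix_twist (redS_E0 D) g_bij mA mA') (val_redS_t _ A0).
rewrite natrD !natrM intrD -[(Posz j)%:~R]/(j%:R : rat).
by have e0 := e_neq0; field.
Qed.

(** [has_deg_tors] admits every effective twist; by [matrix_val] they all give this value, so the
    choice made by [deg_tors] does not matter. *)
Lemma deg_torsE r (A : 'M[fps k]_n) : is_matrix phk g r A ->
  deg_tors N = (val u (\det A))%:R / e%:R - r%:~R * n%:R.
Proof.
move=> mA; have dE r' A' : is_matrix phk g r' A' ->
    has_length (restr (@fpsC (Wk D) \o ZpWk D)%FUN (coker (twist N r')))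
      (res_deg D * val u (\det A')).
  by move=> mA'; apply: torsion_length g_bij mA' (matrix_det_neq0 mA').
rewrite /deg_tors; case: xgetP => [d _ [r' [l [eff [hl ->]]]]|H].
  have [A' mA'] := exists_matrix (@redS_surj D) (@redS_phi D) g_bij eff.
  rewrite (has_length_uniq hl (dE _ _ mA')) degK_quot (rank_torsE g_bij).
  exact/esym/(matrix_val mA mA').
case: (H ((val u (\det A))%:R / e%:R - r%:~R * n%:R)).
exists r, (res_deg D * val u (\det A))%N; split; first exact: matrix_effective g_bij _ _ mA.
by split; [exact: dE | rewrite degK_quot (rank_torsE g_bij)].
Qed.

Lemma slope_torsE r (A : 'M[fps k]_n) : (0 < n)%N -> is_matrix phk g r A ->
  slope_tors N = (val u (\det A))%:R / e%:R / n%:R - r%:~R.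
Proof.
move=> n0 mA; rewrite /slope_tors (deg_torsE mA) (rank_torsE g_bij) mulrBl mulfK //.
by rewrite pnatr_eq0 -lt0n.
Qed.

End Degree.

Section Semistable.
Variables (n : nat) (A B : 'M[fps k]_n) (a b : nat).
Hypotheses (AB : A *m B = (redS (ES D) ^+ b)%:M) (BA : B *m A = (redS (ES D) ^+ b)%:M).

Definition tors_model : phi_module D := row_module (@redS_phi D) A a.

Lemma tors_model_kisin : kisin tors_model.
Proof.
exact: (row_module_kisin (@redS_surj D) (@redS_phi D) (redS_u0 D) (@redS_ker_phi D) AB BA a).
Qed.

Lemma tors_model_matrix : is_matrix phk (idfun : {linear RV redS n -> tors_model}) (Posz a) A.
Proof.
move=> v; rewrite pmod_frob twist_coef_tS scalerA rmorphXn -exprMn tS_tinv expr1n scale1r.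
by [].
Qed.

(** A subobject is killed by [p], hence free over [k[[u]]]; the matrix [J] of its inclusion turns it
    into a stable submodule of rows, and the twist [a] shifts both slopes equally. *)
Lemma tors_model_semistable :
  (forall y (Y : 'M[fps k]_(y, n)) C, (0 < y)%N -> phi_sub phk A Y C ->
     (val u (\det A) * y <= val u (\det C) * n)%N) ->
  semistable_tors tors_model.
Proof.
move=> ss P N i [sP _ satP] [mi ii rP] kN [x0 x0n].
have [fN uN _ [aN [bN hN]]] := kN.
have bh : bounded_height N by exists aN, bN.
have pN (x : N) : p%:R *: x = 0.
  have e1 : i (p%:R *: x) = redS p%:R *: (i x : 'rV[fps k]_n) :> 'rV[fps k]_n.
    by rewrite linearZ.
  by apply: ii; rewrite linear0 e1 rmorph_nat pk0 scale0r.
have [m [g gb]] := torsion_basis fN uN pN.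
have [h [gh hg]] := linear_inverse gb.
have m0 : (0 < m)%N.
  rewrite lt0n; apply/eqP => m0; case/eqP: x0n; rewrite -[x0]hg.
  rewrite (_ : h x0 = 0) ?linear0 //; apply/rowP => j.
  by move: (ltn_ord j); rewrite [X in (_ < X)%N]m0.
pose J : 'M[fps k]_(m, n) := \matrix_(j, l) (i (g (delta_mx 0 j : RV redS m)) : 'rV[fps k]_n) 0 l.
have igE (v : 'rV[fps k]_m) : i (g (v : RV redS m)) = v *m J :> 'rV[fps k]_n.
  have [s sE] := RV_lift (@redS_surj D) v.
  rewrite {1}(RV_basis sE) !linear_sum; apply/rowP => l; rewrite summxE !mxE.
  apply: eq_bigr => j _; rewrite !linearZ /=.
  by rewrite -[_ *: i _]/(redS (s j) *: (i _ : 'rV[fps k]_n)) !mxE sE.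
have Ji : rowinj J.
  move=> v vJ; apply: (can_inj gh); apply: ii.
  by rewrite igE vJ !linear0.
(* [aN] bounds the poles of the Frobenius of [N], so the twist by [a + aN] is effective on [N]. *)
have [AN mAN] := exists_matrix (@redS_surj D) (@redS_phi D) gb (@effective_height _ _ _ hN.1 a).
have AN0 := matrix_det_neq0 gb bh mAN.
have key (v : 'rV[fps k]_m) : map_mx phk v *m AN *m J =
    redS (tS D ^+ aN) *: (map_mx phk (v *m J) *m A).
  have H : to_invE (i (g (map_mx phk v *m AN : RV redS m)) : tors_model) =
      twist_coef D (Posz (a + aN)) *: frob tors_model (to_invE (bc1 (@phiS D) (i (g (v : RV redS m))))).
    have := mi (to_invE (bc1 (@phiS D) (g (v : RV redS m)))).
    rewrite [bchange_map _ _ (to_invE _)]bchange_map1 [bchange_map _ _ (bc1 _ _)]bchange_map1.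
    rewrite -[bc1 _ (bc1 _ _)]/(to_invE (bc1 (@phiS D) (i (g (v : RV redS m))))) => ->.
    by rewrite -linearZ_LR mAN [RHS]bchange_map1.
  have tt : to_loc [set ES D] (tS D ^+ a) * tinv D ^+ a = 1.
    by rewrite rmorphXn -exprMn tS_tinv expr1n.
  rewrite pmod_frob scalerA twist_coef_tS exprD rmorphM mulrAC [X in X * _]tt mul1r in H.
  rewrite {2}/to_invE -bc1Z in H.
  have {}H := RV_toE_inj (redS_E0 D) H.
  have H2 : (i (g (map_mx phk v *m AN : RV redS m)) : 'rV[fps k]_n) =
    redS (tS D ^+ aN) *: (map_mx phk (i (g (v : RV redS m)) : 'rV[fps k]_n) *m A) := H.
  by rewrite !igE in H2.
(* [key] only puts [tS^aN] times the row in [P]. Modulo [p] this factor is a unit times a power of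
   [u], and strictness allows division by [u] inside [P]. *)
have inP j : exists w : 'rV[fps k]_m, row j (map_mx phk J) *m A = w *m J.
  have [w uw wE] := redS_t D.
  pose v := row j (map_mx phk J) *m A.
  have Pv : P (v : RV redS n).
    have uP l (x : tors_model) : P (uS D ^+ l *: x) -> P x.
      elim: l x => [|l IH] x; first by rewrite expr0 scale1r.
      by rewrite exprS -scalerA => /satP/IH.
    apply: (uP (e * aN)%N).
    have [w' w'E] := redS_surj (w ^- aN).
    have e2 : (w' * tS D ^+ aN) *: (v : RV redS n) = uS D ^+ (e * aN) *: (v : RV redS n).
      suff e1 : redS (w' * tS D ^+ aN) = redS (uS D ^+ (e * aN)) by rewrite !RV_scale e1.
      rewrite rmorphM w'E !rmorphXn redS_u wE exprMn mulrA mulVr ?unitrX // mul1r.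
      by rewrite exprM.
    have e3 : i (g (map_mx phk (delta_mx 0 j : 'rV[fps k]_m) *m AN : RV redS m)) =
        tS D ^+ aN *: (v : RV redS n) :> RV redS n.
      by apply: etrans (igE _) _; rewrite key RV_scale -rowE map_row.
    have Pt : P (tS D ^+ aN *: (v : RV redS n)).
      by rewrite -rP -e3; eexists.
    by have := submodZ sP w' Pt; rewrite scalerA e2.
  move: Pv; rewrite -rP => -[x _ xE]; exists (h x).
  by rewrite -igE hg xE.
have /choice[c cE] := inP.
pose C := \matrix_(j, l) c j 0 l : 'M[fps k]_m.
have CJ : map_mx phk J *m A = C *m J.
  apply/row_matrixP => j; rewrite !row_mul cE; congr (_ *m _).
  by apply/rowP => l; rewrite !mxE.
have ANE : AN = redS (tS D ^+ aN) *: C.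
  apply: (rowinj_mulmx Ji); rewrite -scalemxAl -CJ.
  apply/row_matrixP => j; rewrite [in LHS]rowE [in RHS]rowE.
  rewrite mulmxA -scalemxAr mulmxA.
  have := key (delta_mx 0 j); rewrite map_delta_mx => ->; congr (_ *: _).
  by rewrite map_mxM map_delta_mx.
have sJ : phi_sub phk A J C by [].
have C0 : \det C != 0.
  move: AN0; rewrite ANE.
  have -> : \det (redS (tS D ^+ aN) *: C) = redS (tS D ^+ aN) ^+ m * \det C by exact: detZ.
  by rewrite mulf_eq0 negb_or => /andP[].
have n0 : (0 < n)%N := leq_trans m0 (rowinj_le Ji).
have idb : bijective (idfun : {linear RV redS n -> tors_model}) by exists idfun.
rewrite (slope_torsE gb bh m0 mAN).
rewrite (slope_torsE (g := (idfun : {linear RV redS n -> tors_model})) idb _ n0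
  tors_model_matrix); last first.
  by case: tors_model_kisin.
rewrite ANE (val_redS_t _ C0).
have mR : (0 : rat) < m%:R by rewrite ltr0n.
have nR : (0 : rat) < n%:R by rewrite ltr0n.
have eR : (0 : rat) < e%:R by rewrite ltr0n eE_gt0.
have -> : ((e * aN * m + val u (\det C))%:R / e%:R / m%:R - (Posz (a + aN))%:~R : rat) =
    (val u (\det C))%:R / e%:R / m%:R - (Posz a)%:~R.
  rewrite natrD !natrM PoszD intrD -[(Posz aN)%:~R]/(aN%:R : rat).
  by field; rewrite !gt_eqF.
rewrite lerB // ler_pdivrMr // mulrAC ler_pdivlMr // mulrAC [X in _ <= X]mulrAC.
by rewrite ler_pM2r ?invr_gt0 // -!natrM ler_nat; apply: ss sJ.
Qed.

End Semistable.
End TorsionDegree.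

(** * Slopes of flat modules *)

Section Principal.
Variable R : comNzRingType.

Lemma principal_submod (a : R) : is_submod (principal a : set R^o).
Proof.
split=> [|c _ _ [b ->] [b' ->]]; first by exists 0; rewrite mul0r.
by exists (c * b + b'); rewrite /GRing.scale /= mulrDl mulrA.
Qed.

Lemma principal1 : principal (1 : R) = setT.
Proof. by apply/seteqP; split=> // x _; exists x; rewrite mulr1. Qed.

Lemma ideal_mul_principal (a b : R) :
  ideal_mul (principal a) (principal b) = principal (a * b).
Proof.
apply/seteqP; split=> [x|x [c ->] Q sQ sub].
  apply; first exact: principal_submod.
  by move=> _ [_ [_ [[c ->] [d ->] ->]]]; exists (c * d); rewrite mulrACA.
by apply: sub; exists (c * a), b; split; [exists c|exists 1; rewrite mul1r|rewrite mulrA].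
Qed.

Lemma ideal_exp_principal (a : R) n : ideal_exp (principal a) n = principal (a ^+ n).
Proof.
elim: n => [|n IH]; first by rewrite expr0 principal1.
by rewrite -[LHS]/(ideal_mul _ (ideal_exp _ n)) IH ideal_mul_principal exprS.
Qed.

Lemma has_length0 (Z : comPzRingType) (V : lmodType Z) : (forall x : V, x = 0) -> has_length V 0.
Proof.
move=> V0; apply: rlen_has_length.
have -> : [set: V] = [set 0] by apply/seteqP; split=> x _ //; rewrite (V0 x).
apply: rlen0; split=> // a x y -> ->; exact: V0.
Qed.

End Principal.

(** * Height one primes and the cokernel localised at them *)

Section FlatDegree.
Variable D : kisin_base.
Local Notation S := (fps (Wk D)).
Local Notation E := (Ew D).

Definition PE : set S := principal E.

Lemma prime_ideal0 : prime_ideal [set (0 : S)].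
Proof.
split; first by split=> // a x y -> ->; rewrite scaler0 addr0.
  by move=> /eqP; rewrite oner_eq0.
by move=> x y /eqP; rewrite mulf_eq0 => /orP[] /eqP ->; [left|right].
Qed.

Lemma prime_PE : prime_ideal PE.
Proof.
by split; [exact: principal_submod | exact: Eideal1 | exact: Eideal_prime].
Qed.

Lemma lt0_PE : [set (0 : S)] `<` PE.
Proof.
split; first by move=> _ ->; exists 0; rewrite mul0r.
move=> /(_ E) h; have /eqP := h (ex_intro _ 1 (esym (mul1r _))).
exact/negP/E_neq0.
Qed.

(** A nonzero prime strictly inside [(E)] contains some [y E^n] with [y] outside [(E)], hence
    contains [E]. *)
Lemma height1_PE : height1 PE.
Proof.
split; [exact: prime_PE | by exists [set 0]; [exact: prime_ideal0 | exact: lt0_PE] |].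
move=> Q Q' [[Q0 _] _ _] [[Q'0 Q'Z] Q'1 Q'p] [[QQ' nQ'Q] [Q'P nPQ']].
have [x [Q'x x0]] : exists x, Q' x /\ x != 0.
  apply: contrapT => H; apply: nQ'Q => x Q'x.
  by have -> : x = 0 by apply/eqP/negPn/negP => x0; apply: H; exists x.
have [n [y [ny xE]]] := E_decompose x0.
have Q'X m : Q' (E ^+ m) -> Q' E.
  by elim: m => [//|m IH]; rewrite exprS => /Q'p[].
move: Q'x; rewrite xE => /Q'p[/Q'P//|/Q'X Q'E].
apply: nPQ' => _ [b ->]; have := Q'Z b E 0 Q'E Q'0.
by rewrite addr0.
Qed.

(** Otherwise [0], [(E)] and [P] would form a chain of three distinct primes. *)
Lemma height1_E P : height1 P -> P E -> P = PE.
Proof.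
move=> [[[P0 PZ] _ _] _ H] PEh; apply: contrapT => nP.
have sub : PE `<=` P by move=> _ [b ->]; have := PZ b E 0 PEh P0; rewrite addr0.
apply: (H [set 0] PE prime_ideal0 prime_PE); split; first exact: lt0_PE.
by split=> // sub'; apply: nP; apply/seteqP.
Qed.

Local Notation T := (~` PE).
Local Notation f := (to_loc T).
Local Notation Lc := (loc T).

Lemma denom_PE s : denom T s -> T s.
Proof.
elim=> [|x y Tx _ Ty]; first exact: Eideal1.
by move=> /Eideal_prime[].
Qed.

Lemma denom_PE_neq0 s : denom T s -> s != 0.
Proof. by move=> /denom_PE Ts; apply/eqP => s0; apply: Ts; exists 0; rewrite s0 mul0r. Qed.

Lemma to_loc_PE_inj : injective f.
Proof.
move=> a b /frac_eq[w /denom_PE_neq0 w0]; rewrite !mulr1.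
exact: mulfI.
Qed.

(** With [locE_reg] and [locE_nunit] this makes the localisation at [(E)] a discrete valuation ring
    with uniformizer [E]. *)
Lemma locE_dec (x : Lc) : x = 0 \/ exists k w w', w * w' = 1 /\ x = w * f E ^+ k.
Proof.
have [a [s [ds ->]]] := fracP x; rewrite fracE.
have [->|a0] := eqVneq a 0; first by left; rewrite rmorph0 mul0r.
right; have [k [y [ny aE]]] := E_decompose a0.
have dy : denom T y by apply: denomT.
exists k, (f y * frac 1 ds), (f s * frac 1 dy); split.
  transitivity ((f y * frac 1 dy) * (f s * frac 1 ds)); first by ring.
  by rewrite (to_loc_inv dy) (to_loc_inv ds) mulr1.
by rewrite aE rmorphM rmorphXn mulrAC.
Qed.

Lemma locE_reg (x : Lc) : f E * x = 0 -> x = 0.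
Proof.
have [a [s [ds ->]]] := fracP x; rewrite fracE mulrA -rmorphM => e.
have : f (E * a) = 0.
  have := congr1 ( *%R^~ (f s)) e; rewrite mul0r -mulrA [frac 1 ds * _]mulrC.
  by rewrite to_loc_inv mulr1.
rewrite -[0](rmorph0 f) => /to_loc_PE_inj/eqP.
by rewrite mulf_eq0 (negPf (E_neq0 D)) => /eqP ->; rewrite rmorph0 mul0r.
Qed.

Lemma locE_nunit (x : Lc) : x * f E <> 1.
Proof.
have [a [s [ds ->]]] := fracP x; rewrite fracE => e.
have : f (a * E) = f s.
  have := congr1 ( *%R^~ (f s)) e; rewrite mul1r => <-.
  rewrite rmorphM; transitivity (f a * f E * (f s * frac 1 ds)); last by ring.
  by rewrite (to_loc_inv ds) mulr1.
move/to_loc_PE_inj => sE; apply: (denom_PE ds).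
by exists a.
Qed.

Lemma locE_total (x y : Lc) : (exists z, y = z * x) \/ (exists z, x = z * y).
Proof.
have [->|[k [w [w' [ww' ->]]]]] := locE_dec x; first by right; exists 0; rewrite mul0r.
have [->|[l [v [v' [vv' ->]]]]] := locE_dec y; first by left; exists 0; rewrite mul0r.
have [le|/ltnW le] := leqP k l; [left|right].
  exists (v * w' * f E ^+ (l - k)); rewrite -[in LHS](subnK le) exprD.
  transitivity (v * (f E ^+ (l - k) * f E ^+ k) * (w * w')); last by ring.
  by rewrite ww' mulr1.
exists (w * v' * f E ^+ (k - l)); rewrite -[in LHS](subnK le) exprD.
transitivity (w * (f E ^+ (k - l) * f E ^+ l) * (v * v')); last by ring.
by rewrite vv' mulr1.
Qed.

Definition idL : {rmorphism Lc -> Lc} := idfun.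

Lemma rlen_locE : rlen (V := restr idL Lc^o) setT [set x | exists y : Lc, x = y * f E] 1.
Proof.
pose X := [set x : restr idL Lc^o | exists y : Lc, x = y * f E].
have sX : is_submod X.
  split=> [|a _ _ [y ->] [y' ->]]; first by exists 0; rewrite mul0r.
  by exists (a * y + y'); rewrite -[LHS]/(a * (y * f E) + y' * f E) mulrDl mulrA.
exists (fun i => if i == 0%N then X else setT); split=> //.
  by move=> [|i] _ //=; split.
move=> [|i] // _ /=; split.
  by split=> // /(_ (1 : Lc) I) [y yE]; apply: (@locE_nunit y).
move=> Q sQ XQ _; have [sub|nsub] := pselect (Q `<=` X).
  by left; apply/seteqP.
right; apply/seteqP; split=> // z _.
have [x [Qx nXx]] : exists x, Q x /\ ~ X x.
  by apply: contrapT => H; apply: nsub => x Qx; apply: contrapT => nX; apply: H; exists x.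
have [x0|[[|k] [w [w' [ww' xE]]]]] := locE_dec (x : Lc).
- by case: nXx; exists 0; rewrite mul0r x0.
- have -> : z = ((z : Lc) * w' * (x : Lc) : Lc).
    by rewrite xE mulr1 -mulrA [w' * w]mulrC ww' mulr1.
  exact: (submodZ sQ ((z : Lc) * w') Qx).
by case: nXx; exists (w * f E ^+ k); rewrite xE exprSr mulrA.
Qed.

Definition idS : {rmorphism SS D -> fps (Wk D)} := (idfun : fps (Wk D) -> fps (Wk D)).

Lemma idS_E0 : idS (ES D) != 0. Proof. exact: E_neq0. Qed.

Lemma idS_surj x : exists y, idS y = x. Proof. by exists x. Qed.

Section Coker.
Variables (N : phi_module D) (n : nat) (g : {linear RV idS n -> N}) (r : int) (A : 'M[S]_n).
Hypotheses (g_bij : bijective g) (mA : is_matrix (phiW D) g r A).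
Local Notation C := (coker (twist N r)).

Definition imP : set (twist N r) := [set m : twist N r |
  exists x : phi_pull (twist N r), frob (twist N r) (to_invE x) = to_invE m].

Lemma imPE : imP = [set m | exists w : 'rV[S]_n, m = g (w *m A : RV idS n)].
Proof.
exact: (matrix_image idS_surj idS_E0 g_bij mA).
Qed.

Lemma imP_submod : is_submod imP.
Proof.
rewrite imPE; split=> [|a _ _ [w ->] [w' ->]]; first by exists 0; rewrite mul0mx linear0.
by exists (a *: w + w'); rewrite mulmxDl -scalemxAl -linearP.
Qed.

Lemma coker_killed s (c : C) : (exists B, B *m A = s%:M) -> s *: c = 0.
Proof.
move=> [B BA]; have [h [gh hg]] := linear_inverse g_bij.
have [m ->] := to_quotmP c.
have [q qE] := to_quotm_linear imP.
rewrite -[to_quotm _ m]qE -linearZ qE; apply/to_quotm0.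
rewrite (gen_submod_id imP_submod) imPE; exists ((h m : 'rV[S]_n) *m B).
by rewrite -mulmxA BA mul_mx_scalar -[LHS](hg) linearZ.
Qed.

(** The cofactor [B] shows that [s] kills the cokernel, while [s] is invertible at [P]. *)
Lemma coker_loc0 (P : set S) s : prime_ideal P -> ~ P s -> (exists B, B *m A = s%:M) ->
  has_length (bchange (to_loc (~` P)) C) 0.
Proof.
move=> pP nPs BA; apply: has_length0.
have bc0 (c : C) : bc1 (to_loc (~` P)) c = 0.
  have ds : denom (~` P) s by apply: denomT.
  rewrite -[LHS]scale1r -(to_loc_inv ds) mulrC -scalerA -bc1Z coker_killed //.
  by rewrite bc1_0 scaler0.
move=> x; have [l ->] := bchange_span x.
by rewrite big1 // => z _; rewrite bc0 scaler0.
Qed.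

(** The localised cokernel is the cokernel of the localised matrix, whose length is found by
    [mlen_det] over the localisation itself, where the residue field has length [1]. *)
Lemma coker_loc_length d w : w \is a GRing.unit -> \det A = w * E ^+ d ->
  has_length (bchange f C) d.
Proof.
move=> uw dA; have [h [gh hg]] := linear_inverse g_bij.
pose fA : 'M[Lc]_n := map_mx f A.
have lenA : rlen (V := VV idL n) setT (@rowsp _ _ idL _ _ fA) (1 * d).
  apply: (mlen_det locE_total locE_reg locE_dec locE_nunit rlen_locE (w := f w) (w' := f w^-1)).
    by rewrite -rmorphM mulrV // rmorph1.
  have -> : \det fA = f (\det A) by exact: det_map_mx.
  by rewrite dA rmorphM rmorphXn.
rewrite mul1n in lenA.
have [q qE] := to_quotm_linear imP.
pose cl (v : 'rV[S]_n) : C := q (g (v : RV idS n)).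
have clP (a : S) v v' : cl (a *: v + v') = a *: cl v + cl v'.
  by rewrite /cl -linearP; congr (q _); exact: linearP.
pose ep j := bc1 f (cl (delta_mx 0 j)).
have bccl (v : 'rV[S]_n) : bc1 f (cl v) = \sum_j f (v 0 j) *: ep j.
  have cl_sum (s : seq 'I_n) : cl (\sum_(j <- s) v 0 j *: delta_mx 0 j) =
      \sum_(j <- s) v 0 j *: cl (delta_mx 0 j).
    elim: s => [|j s IH]; last by rewrite !big_cons clP IH.
    rewrite !big_nil; apply: (addrI (cl 0)).
    by have := clP 1 0 0; rewrite scale1r addr0 scale1r => <-; rewrite addr0.
  rewrite {1}[v]row_sum_delta cl_sum.
  by rewrite (semilinear_sum _ _ _ (@bc1_semilinear _ _ f C)).
pose H (x : VV idL n) : bchange f C := \sum_j (x : 'rV[Lc]_n) 0 j *: ep j.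
have H_lin : linear H.
  move=> a x y; rewrite /H scaler_sumr -big_split; apply: eq_bigr => j _ /=.
  by rewrite VV_scale !mxE scalerDl scalerA.
pose HM := GRing.isLinear.Build _ _ _ _ H H_lin.
pose HL : {linear VV idL n -> bchange f C} := HB.pack H HM.
apply: (@rlen_surj_has_length _ _ _ HL _ _ _ _ lenA).
  move=> x; have [s ->] := bchange_span x.
  have /choice[v vE] (c : C) : exists v, c = cl v.
    have [m ->] := to_quotmP c; exists (h m).
    by rewrite /cl (_ : g (h m : RV idS n) = m) ?qE //; exact: hg.
  exists (\sum_(z <- s) z.1 *: map_mx f (v z.2)).
  rewrite -[LHS]/(H _) /H.
  transitivity (\sum_j \sum_(z <- s) z.1 *: (f (v z.2 0 j) *: ep j)).
    apply: eq_bigr => j _; rewrite summxE scaler_suml; apply: eq_bigr => z _.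
    by rewrite !mxE scalerA.
  rewrite exchange_big /=; apply: eq_bigr => z _.
  by rewrite -scaler_sumr -bccl -vE.
move=> x; split=> [Hx0|[y ->]].
  (* To compute the kernel of [H], a map [L] from the localised cokernel back to the cokernel of
     [fA] is built from the coordinates [h]; its composite with [H] is the projection. *)
  pose Y : set (VV idL n) := @rowsp _ _ idL _ _ fA.
  have sY : is_submod Y.
    split=> [|a _ _ [y ->] [y' ->]]; first by exists 0; rewrite mul0mx.
    by exists (a *: y + y'); rewrite mulmxDl -scalemxAl VV_scale.
  pose X : lmodType Lc := quotm Y.
  have [cx cxE] := to_quotm_linear Y.
  have mapP (a : S) (v v' : 'rV[S]_n) :
      map_mx f (a *: v + v') = f a *: map_mx f v + map_mx f v'.
    by apply/rowP => j; rewrite !mxE rmorphD rmorphM.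
  pose k0 (m : twist N r) : restr f X := cx (map_mx f (h m : 'rV[S]_n)).
  have k0_lin : linear k0.
    move=> a m m'.
    have hl : (h (a *: m + m') : 'rV[S]_n) = a *: (h m : 'rV[S]_n) + (h m' : 'rV[S]_n).
      exact: (linearP h a m m').
    rewrite /k0 hl mapP; exact: (linearP cx (f a)).
  pose kM := GRing.isLinear.Build _ _ _ _ k0 k0_lin.
  pose kL : {linear twist N r -> restr f X} := HB.pack k0 kM.
  have kim m : imP m -> kL m = 0.
    rewrite imPE => -[v ->]; rewrite -[LHS]/(cx (map_mx f (h (g _) : 'rV[S]_n))).
    rewrite gh cxE; apply/to_quotm0; rewrite (gen_submod_id sY).
    by exists (map_mx f v); rewrite map_mxM.
  have [k1 k1E] := quotm_lift kim.
  have k1_lin : semilinear_over f (k1 : C -> X) by move=> a c c'; exact: (linearP k1).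
  have [L LE] := bchange_lift k1_lin.
  have : L (H x) = cx x.
    rewrite /H linear_sum {2}[x]row_sum_delta linear_sum.
    apply: eq_bigr => j _; rewrite linearZ /= LE /cl qE k1E.
    transitivity (cx (x 0 j *: (delta_mx 0 j : VV idL n))); last by congr (cx _); exact: VV_scale.
    rewrite linearZ /=; congr (_ *: _).
    rewrite -[LHS]/(cx (map_mx f (h (g _) : 'rV[S]_n))) gh; congr (cx _).
    exact: map_delta_mx.
  rewrite [H x]Hx0 linear0 => /esym; rewrite cxE => /to_quotm0.
  by rewrite (gen_submod_id sY).
rewrite -[LHS]/(H _) /H.
transitivity (\sum_i y 0 i *: bc1 f (cl (row i A))).
  transitivity (\sum_j \sum_i y 0 i *: (f (A i j) *: ep j)).
    apply: eq_bigr => j _; rewrite mxE scaler_suml; apply: eq_bigr => i _.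
    by rewrite mxE scalerA.
  rewrite exchange_big; apply: eq_bigr => i _ /=.
  rewrite -scaler_sumr bccl; congr (_ *: _); apply: eq_bigr => j _.
  by rewrite mxE.
apply: big1 => i _; rewrite (_ : cl _ = 0) ?bc1_0 ?scaler0 //.
rewrite /cl qE; apply/to_quotm0; rewrite (gen_submod_id imP_submod) imPE.
by exists (delta_mx 0 i); rewrite -rowE.
Qed.
End Coker.
End FlatDegree.

Section FreeRank.
Variable R : comNzRingType.

Lemma free_rankE (V : lmodType R) n (g : {linear 'rV[R]_n -> V}) : bijective g -> free_rank V = n.
Proof.
have le m1 m2 (g1 : {linear 'rV[R]_m1 -> V}) (g2 : {linear 'rV[R]_m2 -> V}) :
    bijective g1 -> bijective g2 -> (m1 <= m2)%N.
  move=> b1 b2; have [h1 [gh1 hg1]] := linear_inverse b1.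
  have [h2 [gh2 hg2]] := linear_inverse b2.
  apply: (@mulmx1_min _ _ _ (lin1_mx (h2 \o g1)) (lin1_mx (h1 \o g2))).
  apply/row_matrixP => i; rewrite !rowE mulmxA mulmx1 !mul_rV_lin1 /=.
  by rewrite hg2 gh1.
move=> gb; rewrite /free_rank; case: xgetP => [m _ [g' g'b]|H].
  by apply/eqP; rewrite eqn_leq (le _ _ g' g) // (le _ _ g g').
by case: (H n); exists g.
Qed.

End FreeRank.

(** * Degree and slope of a flat module from its matrix *)

Section FlatSlope.
Variable D : kisin_base.
Local Notation S := (fps (Wk D)).
Local Notation E := (Ew D).
Local Notation k := (kf D).
Local Notation u := (fpsX k).
Local Notation e := (eE D).
Local Notation redS := (redS D).
Local Notation idS := (idS D).

Lemma E_exp_unit w m : w * E ^+ m.+1 = 1 -> False.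
Proof. by rewrite exprSr mulrA => h; apply: (@Eideal1 D); exists (w * E ^+ m). Qed.

Lemma principal_E_inj m d : principal (E ^+ m) = principal (E ^+ d) -> m = d.
Proof.
wlog le : m d / (m <= d)%N => [H e1|].
  by have [/H|/ltnW/H h] := leqP m d; [apply|apply/esym/h].
move=> e1; have : principal (E ^+ d) (E ^+ m) by rewrite -e1; exists 1; rewrite mul1r.
move=> [b]; rewrite -[in d](subnK le) exprD mulrA => /esym/eqP.
rewrite -[X in _ == X]mul1r (inj_eq (mulIf _)) ?expf_neq0 ?E_neq0 //.
by case: (d - m)%N (subnK le) => [|j] // _ /eqP /E_exp_unit.
Qed.

Lemma idS_phi x : idS (phiS x) = phiW D (idS x). Proof. by []. Qed.

Section Slope.
Variables (N : phi_module D) (n : nat) (g : {linear RV idS n -> N}).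
Hypotheses (g_bij : bijective g) (bh : bounded_height N).

Lemma basis_free_rank : free_rank N = n.
Proof.
pose f (v : 'rV[SS D]_n) : N := g (v : RV idS n).
have f_lin : linear f by move=> a x y; exact: (linearP g).
pose fM := GRing.isLinear.Build _ _ _ _ f f_lin.
pose fL : {linear 'rV[SS D]_n -> N} := HB.pack f fM.
apply: (@free_rankE _ N n fL); have [h gh hg] := g_bij.
by exists (h : N -> 'rV[SS D]_n).
Qed.

Lemma tS_Ew : exists2 w : S, w \is a GRing.unit & tS D = w * E.
Proof.
exists (fpsC (Eis_c0 D)^-1) => //.
apply/unitrP; exists (fpsC (Eis_c0 D)); split; last exact: c0V.
by rewrite mulrC; exact: c0V.
Qed.

Lemma flat_det r (A : 'M[S]_n) : is_matrix (phiW D) g r A ->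
  exists d w, w \is a GRing.unit /\ \det A = w * E ^+ d.
Proof.
move=> mA; have [i [b [W WA]]] := matrix_cofactor (@idS_surj D) (@idS_E0 D) g_bij bh mA.
have [w uw tE] := tS_Ew.
have e1 : \det W * \det A = (w ^+ i * E ^+ (i + b)) ^+ n.
  have -> : w ^+ i * E ^+ (i + b) = idS (tS D ^+ i * ES D ^+ b).
    by rewrite -[RHS]/(tS D ^+ i * E ^+ b) tE exprMn exprD mulrA.
  by rewrite -(det_scalar n) -WA; apply/esym/det_mulmx.
apply: (@dvd_E_exp D ((i + b) * n) (\det A) (\det W * w ^- (i * n))).
rewrite mulrA [\det A * _]mulrC e1 exprMn -!exprM mulrAC mulrV ?mul1r //.
by rewrite unitrX.
Qed.

(** The determinant lies outside every height one prime other than [(E)], so the cokernel vanishes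
    there; the list of primes is then empty or reduced to [(E)], with exponent [d]. *)
Lemma flat_char_ideal r (A : 'M[S]_n) d w I : is_matrix (phiW D) g r A ->
  w \is a GRing.unit -> \det A = w * E ^+ d ->
  is_char_ideal (coker (twist N r)) I <-> I = principal (E ^+ d).
Proof.
move=> mA uw dA.
have lPE := coker_loc_length g_bij mA uw dA.
have lP P : height1 P -> P <> PE (D:=D) ->
    has_length (bchange (to_loc (~` P)) (coker (twist N r))) 0.
  move=> h1 nP; have pP := (let: And3 x _ _ := h1 in x).
  have [[P0 PZ] nP1 Pm] := pP.
  apply: (coker_loc0 g_bij mA pP (s := \det A)); last by exists (\adj A); exact: mul_adj_mx.
  rewrite dA => /Pm[Pw|].
    by apply: nP1; have := PZ w^-1 w 0 Pw P0; rewrite addr0 /GRing.scale /= mulVr.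
  elim: d {lPE dA} => [//|d IH]; rewrite exprS => /Pm[/(height1_E h1)//|].
  exact: IH.
split=> [[s [m [us sE lE ->]]]|->].
  have mPE : m (PE (D:=D)) = d := has_length_uniq (lE _ (height1_PE D)) lPE.
  have mP P : height1 P -> P <> PE (D:=D) -> m P = 0%N.
    by move=> h1 nP; exact: has_length_uniq (lE _ h1) (lP _ h1 nP).
  have s1 P : P \in s -> P = PE (D:=D) /\ (0 < d)%N.
    move=> /sE[h1 m0]; have [PE1|nP] := pselect (P = PE (D:=D)).
      by split=> //; rewrite -mPE -PE1.
    by rewrite (mP _ h1 nP) in m0.
  case: s us sE s1 => [_ sE _|P s us sE s1].
    case: d mPE {lPE dA} => [|d] mPE; first by rewrite expr0 principal1.
    by have : PE (D:=D) \in [::] by apply/sE; rewrite mPE; split=> //; exact: height1_PE.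
  have [PE1 d0] := s1 P (mem_head _ _).
  case: s us {sE} s1 => [_ _ /=|P' s us s1]; last first.
    have [PE2 _] := s1 P' (mem_behead (s := [:: P, P' & s]) (mem_head _ _)).
    by move: us; rewrite /= PE1 PE2 inE eqxx.
  rewrite PE1 mPE /PE ideal_exp_principal -principal1 ideal_mul_principal mulr1.
  by [].
exists (if d is 0%N then [::] else [:: PE (D:=D)]), (fun P => if P == PE (D:=D) then d else 0%N).
split.
- by case: (d).
- move=> P; case: d {lPE dA} => [|d]; first by split=> // -[_]; rewrite if_same.
  rewrite inE; split=> [/eqP ->|[_]]; last by case: ifP.
  by split; [exact: height1_PE | rewrite eqxx].
- move=> P h1; case: eqP => [->|] //; exact: lP.
- case: d {lPE dA} => [|d]; first by rewrite expr0 principal1.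
  rewrite /= eqxx.
  rewrite /PE ideal_exp_principal -principal1 ideal_mul_principal mulr1.
  by [].
Qed.

Lemma flat_val d (w : S) (A : 'M[S]_n) : w \is a GRing.unit -> \det A = w * E ^+ d ->
  val u (\det (map_mx redS A)) = (e * d)%N /\ \det (map_mx redS A) != 0.
Proof.
move=> uw dA; have -> : \det (map_mx redS A) = redS w * u ^+ (e * d).
  rewrite exprM -(redS_E D) -rmorphXn -rmorphM -[w * _]dA; exact: det_map_mx.
have uw' : redS w \is a GRing.unit by apply: rmorph_unit.
split; first by rewrite (valE (fps_dvr k)).
by rewrite mulf_neq0 ?expf_neq0 ?fpsX_neq0 //; apply: contraTneq uw' => ->; rewrite unitr0.
Qed.

Lemma flat_matrix_val r r' (A A' : 'M[S]_n) :
  is_matrix (phiW D) g r A -> is_matrix (phiW D) g r' A' ->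
  ((val u (\det (map_mx redS A)))%:R / e%:R - r%:~R * n%:R : rat) =
  (val u (\det (map_mx redS A')))%:R / e%:R - r'%:~R * n%:R.
Proof.
wlog [j jE] : r r' A A' / exists j : nat, r' = r + j%:Z => [H mA mA'|mA mA'].
  have [le|lt] := lerP r r'.
    by apply: H mA mA'; exists `|r' - r|%N; lia.
  by symmetry; apply: H mA' mA; exists `|r - r'|%N; lia.
rewrite jE in mA' *; have [d [w [uw dA]]] := flat_det mA.
have [_ A0] := flat_val uw dA.
have -> : map_mx redS A' = redS (tS D ^+ j) *: map_mx redS A.
  rewrite (matrix_twist (@idS_E0 D) g_bij mA mA'); apply/matrixP => i l.
  by rewrite !mxE -rmorphM.
rewrite (val_redS_t _ A0) natrD !natrM intrD -[(Posz j)%:~R]/(j%:R : rat).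
by have e0 := e_neq0 D; field.
Qed.

(** [E^d] reduces to [u^(e d)], so flat and torsion slopes are given by the same formula in the
    reduced matrix. *)
Lemma slope_flatE r (A : 'M[S]_n) : (0 < n)%N -> is_matrix (phiW D) g r A ->
  slope_flat N = (val u (\det (map_mx redS A)))%:R / e%:R / n%:R - r%:~R.
Proof.
move=> n0 mA; have e0 := e_neq0 D.
have nR : (n%:R : rat) != 0 by rewrite pnatr_eq0 -lt0n.
rewrite /slope_flat basis_free_rank.
suff -> : ((deg_flat N)%:~R : rat) = (val u (\det (map_mx redS A)))%:R / e%:R - r%:~R * n%:R.
  by field; rewrite nR e0.
have degE r' A' d w : is_matrix (phiW D) g r' A' -> w \is a GRing.unit ->
    \det A' = w * E ^+ d -> ((d%:Z - r' * n%:Z)%:~R : rat) =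
    (val u (\det (map_mx redS A)))%:R / e%:R - r%:~R * n%:R.
  move=> mA' uw dA'; rewrite -(flat_matrix_val mA' mA).
  have [-> _] := flat_val uw dA'; rewrite natrM mulrAC mulfV // mul1r.
  by rewrite intrB intrM.
rewrite /deg_flat; case: xgetP => [d _ [r' [m [eff [ci ->]]]]|H].
  have [A' mA'] := exists_matrix (@idS_surj D) idS_phi g_bij eff.
  have [d' [w [uw dA']]] := flat_det mA'.
  have /(flat_char_ideal _ mA' uw dA')/principal_E_inj -> := ci.
  by rewrite basis_free_rank; exact: degE uw dA'.
have [d [w [uw dA]]] := flat_det mA.
case: (H (d%:Z - r * n%:Z)); exists r, d; split; first exact: matrix_effective g_bij _ _ mA.
split; last by rewrite basis_free_rank.
by apply/(flat_char_ideal _ mA uw dA).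
Qed.

End Slope.
End FlatSlope.

(** * Flat Kisin modules as matrices *)

Section PmodMorph.
Variable D : kisin_base.
Local Notation S := (SS D).

Lemma pmod_morph (M M' : lmodType S) (h : M -> M) (h' : M' -> M')
    (hs : semilinear_over (@phiS D) h) (hs' : semilinear_over (@phiS D) h') c
    (f : {linear M -> M'}) :
  (forall m, f (h m) = h' (f m)) -> @is_morph D (pmod hs c) (pmod hs' c) f.
Proof.
move=> fh; apply: is_morphP => m; rewrite [LHS]pmod_frob.
rewrite [frob _ _ in RHS]pmod_frob linearZ /=; congr (_ *: _).
by rewrite /to_invE [RHS]bchange_map1 fh.
Qed.

End PmodMorph.

Section ConstantTerm.
Variable R : comNzRingType.

Definition fps_cst (f : fps R) : R := fcoef f 0.

Lemma fps_cst_is_zmod : zmod_morphism fps_cst.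
Proof. by move=> f g; exact: fcoefB. Qed.

Lemma fps_cst_is_monoid : monoid_morphism fps_cst.
Proof. by split=> [|f g]; rewrite /fps_cst ?fcoef1 // fcoefM big_ord1. Qed.

HB.instance Definition _ := GRing.isZmodMorphism.Build (fps R) R fps_cst fps_cst_is_zmod.
HB.instance Definition _ := GRing.isMonoidMorphism.Build (fps R) R fps_cst fps_cst_is_monoid.

End ConstantTerm.

Section FlatModel.
Variable D : kisin_base.
Local Notation S := (fps (Wk D)).
Local Notation idS := (idS D).
Local Notation phi := (phiW D).
Local Notation RV := (RV idS).

(** The coordinate maps [pr j] detect zero in the tensor product with a free module and are
    compatible with [g]. *)
Lemma RV_flat n : flat (RV n).
Proof.
move=> N N' g g_inj.
have [tDl tDr tZ tm] := ten_balanced (idfun : {rmorphism SS D -> SS D}) N (RV n).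
have /choice[pr prE] (j : 'I_n) : exists L : {linear tens (idfun : {rmorphism SS D -> SS D}) N' (RV n) -> N'},
    forall x (v : RV n), L (ten idfun x v) = ((v : 'rV[S]_n) 0 j : SS D) *: x.
  apply: tens_lift; split=> [x y v|x v w|c x v|r x v].
  - by rewrite scalerDr.
  - by rewrite mxE scalerDl.
  - by rewrite !scalerA mulrC.
  - by rewrite RV_scale mxE !scalerA mulrC.
have span x : exists y : 'I_n -> N, x = \sum_j ten idfun (y j) (delta_mx 0 j : RV n).
  have [s ->] := tensP x; rewrite tens_ten_sum.
  elim: s => [|z s [y yE]].
    exists (fun=> 0); rewrite big_nil big1 // => j _.
    by apply: (addrI (ten idfun (0 : N) (delta_mx 0 j : RV n))); rewrite -tDl !addr0.
  exists (fun j => ((z.2 : 'rV[S]_n) 0 j : SS D) *: z.1 + y j).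
  rewrite big_cons yE; under [RHS]eq_bigr do rewrite tDl; rewrite big_split; congr (_ + _) => /=.
  rewrite {1}[z.2](@RV_basis D _ idS n _ (fun j => (z.2 : 'rV[S]_n) 0 j)) //.
  elim/big_rec2: _ => [|i a b _ <-].
    by apply: (addrI (ten idfun z.1 (0 : RV n))); rewrite -tDr !addr0.
  by rewrite tDr -tm.
have inj0 x : tens_map idfun g (idfun : {linear RV n -> RV n}) x = 0 -> x = 0.
  have [y ->] := span x => e0; rewrite big1 // => j _.
  have -> : y j = 0.
    apply: g_inj; rewrite linear0 -[RHS](linear0 (pr j)) -e0 !linear_sum (bigD1 j) //=.
    rewrite [tens_map _ _ _ _]tens_mapE prE mxE !eqxx scale1r big1 ?addr0 // => i nij.
    by rewrite [tens_map _ _ _ _]tens_mapE prE mxE eq_sym (negPf nij) andbF scale0r.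
  by apply: (addrI (ten idfun (0 : N) (delta_mx 0 j : RV n))); rewrite -tDl !addr0.
by move=> x y e; apply/eqP; rewrite -subr_eq0; apply/eqP/inj0; rewrite linearB /= e subrr.
Qed.

Definition flat_model n (A : 'M[S]_n) a : phi_module D := row_module (@idS_phi D) A a.

Lemma flat_model_kisin n (A : 'M[S]_n) a : E_invertible A -> flat_kisin (flat_model A a).
Proof.
move=> [m [b db]]; split; last exact: RV_flat.
have e1 : \det A * b = idS (ES D) ^+ m by [].
apply: (@row_module_kisin D _ idS phi (@idS_surj D) (@idS_phi D) _ _ n A (b *: \adj A) m _ _ a).
- apply/eqP => /(congr1 (fun f => fcoef f 1)) /eqP; exact/negP/oner_neq0.
- by move=> x x0; exists 0, 0; rewrite mulr0; split=> //; exact: rmorph0.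
- by rewrite -scalemxAr mul_mx_adj scale_scalar_mx mulrC e1.
- by rewrite -scalemxAl mul_adj_mx scale_scalar_mx mulrC e1.
Qed.

Definition flat_model_id n (A : 'M[S]_n) a : {linear RV n -> flat_model A a} := idfun.

Lemma flat_model_id_bij n (A : 'M[S]_n) a : bijective (flat_model_id A a). Proof. by exists idfun. Qed.

Lemma flat_model_matrix n (A : 'M[S]_n) a : is_matrix phi (flat_model_id A a) (Posz a) A.
Proof.
move=> v; rewrite pmod_frob twist_coef_tS scalerA rmorphXn -exprMn tS_tinv expr1n scale1r.
by [].
Qed.

Section RowMul.
Variables (m n : nat) (X : 'M[S]_(m, n)).
Definition rmul (v : RV m) : RV n := (v : 'rV[S]_m) *m X.
Lemma rmul_linear : linear rmul.
Proof. by move=> a x y; rewrite /rmul mulmxDl -scalemxAl. Qed.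
HB.instance Definition _ := GRing.isLinear.Build (SS D) (RV m) (RV n) *:%R rmul rmul_linear.
End RowMul.

Lemma rmul_morph m n (X : 'M[S]_(m, n)) A A' a : map_mx phi X *m A' = A *m X ->
  @is_morph D (flat_model A a) (flat_model A' a) (rmul X).
Proof.
move=> XA; apply: pmod_morph => v.
by rewrite /= /rmul /row_frob map_mxM -!mulmxA XA.
Qed.

Lemma bijective_isogeny (M N : phi_module D) (f : {linear M -> N}) :
  is_morph f -> bijective f -> isogeny f.
Proof.
move=> mf bf; split=> //; have [g [fg gf]] := linear_inverse bf.
by apply: (bijective_up_to (g := g) (denom1 _)) => x; rewrite ?fg ?gf scale1r.
Qed.

Lemma sublattice_isogeny n (A A' : 'M[S]_n) a : sublattice (pS D) phi A A' ->
  exists f : {linear flat_model A' a -> flat_model A a}, isogeny f.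
Proof.
move=> [P [P' [m [PP' [P'P PA]]]]]; exists (rmul P : {linear RV n -> RV n}).
split; first exact: rmul_morph.
apply: (bijective_up_to (g := rmul P') (denom_expr _ m)) => x.
  by rewrite /= /rmul -mulmxA PP' mul_mx_scalar.
by rewrite /= /rmul -mulmxA P'P mul_mx_scalar.
Qed.

Lemma sublattice_E_invertible n (A A' : 'M[S]_n) :
  sublattice (pS D) phi A A' -> E_invertible A -> E_invertible A'.
Proof.
move=> sAA' [m [b db]].
have [v [w [uv uw e]]] : exists v w : S, [/\ v \is a GRing.unit, w \is a GRing.unit &
    v * \det A = w * \det A'].
  exact: (sublattice_det (pS_neq0 D) (phiW_p D) (fps_map_ker (Wk_strict D)) sAA').
exists m, (w * v^-1 * b); transitivity (v^-1 * (w * \det A') * b); first by ring.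
by rewrite -e mulrA mulVr // mul1r.
Qed.

Lemma exists_flat_model (M : phi_module D) : flat_kisin M ->
  exists n (A : 'M[S]_n) a, E_invertible A /\
    exists f : {linear flat_model A a -> M}, isogeny f.
Proof.
move=> [[fM _ _ bM] flM].
(* The residue map of the local ring [W[[u]]]: constant term, reduced modulo [p]. *)
pose res : {rmorphism SS D -> kf D} := (Wk_red D \o @fps_cst (Wk D))%FUN.
have resu (x : SS D) : res x != 0 -> exists y, y * x = 1.
  move=> r0; have : (x : S) \is a GRing.unit.
    rewrite fps_unitE; have [y yx] := strict_unit (Wk_strict D) r0.
    by apply/unitrPr; exists y; rewrite mulrC.
  by move=> /unitrPr[y yE]; exists y; rewrite mulrC.
have [n [s [gs rel]]] := flat_free resu fM flM.
have rel' (c : 'I_n -> SS D) : \sum_i c i *: s i = 0 <-> forall i, idS (c i) = 0.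
  split=> [/rel//|c0]; rewrite big1 // => i _.
  by rewrite (_ : c i = 0) ?scale0r //; exact: c0.
have [g [gb _]] := basis_of_generators (@idS_surj D) gs rel'.
have [a [b [ha _]]] := bM.
have eff : effective (twist M (Posz a)) by exact: (effective_height ha (k := 0)).
have [A mA] := exists_matrix (@idS_surj D) (@idS_phi D) gb eff.
have [d [w [uw dA]]] := flat_det gb bM mA.
exists n, A, a; split.
  by exists d, w^-1; rewrite dA mulrAC mulrV // mul1r.
exists g; apply: bijective_isogeny => //; apply: is_morphP => v.
rewrite [frob _ _ in RHS]pmod_frob linearZ /= /to_invE [X in _ = _ *: X]bchange_map1.
have := mA v; rewrite twist_coef_tS => e.
transitivity (tinv D ^+ a *: (to_loc [set ES D] (tS D ^+ a) *: frob M (to_invE (bc1 (@phiS D) (g v))))).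
  by rewrite scalerA rmorphXn -exprMn mulrC tS_tinv expr1n scale1r.
by rewrite e.
Qed.

End FlatModel.

(** * Filtrations of block triangular matrices *)

Section HNData.
Variable D : kisin_base.
Local Notation S := (fps (Wk D)).
Local Notation phi := (phiW D).
Local Notation u := (fpsX (kf D)).
Local Notation mx_HN := (@mx_HN _ u (@phik D) S (rhoS D)).
Local Notation semistable_mx := (@semistable_mx _ u (@phik D) S (rhoS D)).
Local Notation degm A := (val u (\det (map_mx (rhoS D) A))).

Lemma det_block_trig r s (A : 'M[S]_r) (F : 'M[S]_(s, r)) (B : 'M[S]_s) :
  \det (block_mx A 0 F B) = \det A * \det B.
Proof. exact: det_lblock. Qed.

Lemma E_invertible_block r s (A : 'M[S]_r) (F : 'M[S]_(s, r)) (B : 'M[S]_s) :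
  E_invertible (block_mx A 0 F B) <-> E_invertible A /\ E_invertible B.
Proof.
rewrite /E_invertible det_block_trig; split=> [[m [b e]]|[[m [b e]] [m' [b' e']]]].
  by split; exists m; [exists (\det B * b)|exists (\det A * b)]; rewrite -e; ring.
by exists (m + m')%N, (b * b'); rewrite exprD -e -e'; ring.
Qed.

Lemma mul_col_mx0 m r s n (v : 'M[S]_(m, r + s)) (q : 'M[S]_(s, n)) :
  v *m col_mx 0 q = rsubmx v *m q.
Proof. by rewrite -{1}[v]hsubmxK mul_row_col mulmx0 add0r. Qed.

(* q identifies the quotient by P with a free module *)
Definition quo_mx n (A : 'M[S]_n) (P : set 'rV[S]_n) l (q : 'M[S]_(n, l)) (B : 'M[S]_l) :=
  [/\ map_mx phi q *m B = A *m q, exists q', q' *m q = 1%:M & P = [set v | v *m q = 0]].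

(** The right inverse [J'] makes the submodule a direct summand. *)
Definition sub_mx n (A : 'M[S]_n) (P : set 'rV[S]_n) m (J : 'M[S]_(m, n)) (B : 'M[S]_m) :=
  [/\ map_mx phi J *m A = B *m J, exists J', J *m J' = 1%:M & P = [set v | exists w, v = w *m J]].

(** [type_HN] in terms of matrices: submodules, quotients and subquotients are all free with
    explicit Frobenius matrices. The last clause carries the slope bound of [mx_HN] through the
    induction. *)
Definition HN_data n (A : 'M[S]_n) (b : nat -> nat -> Prop) : Prop :=
  exists (r : nat) (F : nat -> set 'rV[S]_n) (k : nat -> nat) (G : forall i, 'M[S]_(k i)),
  [/\ F 0%N = [set 0] /\ F r = setT,
      forall i, (i <= r)%N -> exists l (q : 'M[S]_(n, l)) B, quo_mx A (F i) q B /\ E_invertible B,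
      forall i, (i < r)%N -> [/\ F i `<` F i.+1,
        exists m (J : 'M[S]_(m, n)) B, [/\ sub_mx A (F i.+1) J B, E_invertible B &
          exists t, quo_mx B [set v | F i (v *m J)] t (G i)],
        E_invertible (G i), semistable_mx (G i) & (0 < k i)%N],
      forall i, (i.+1 < r)%N -> (degm (G i) * k i.+1 < degm (G i.+1) * k i)%N
    & (0 < r)%N -> b (degm (G 0%N)) (k 0%N)].

(** A block matrix is an extension of [B] by [C]: the filtration is [0] followed by the preimages,
    under projection to the last [s] coordinates, of the filtration of [B]. The first graded piece
    is [C]. *)
Lemma mx_HN_data n (A : 'M[S]_n) b : mx_HN A b -> E_invertible A -> HN_data A b.
Proof.
elim=> {n A b} [A b|r s C F B b r0 bC ssC HB IH] => [Ai|/E_invertible_block[Ci Bi]].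
  have sz (v w : 'rV[S]_0) : v = w by apply/rowP => -[].
  exists 0%N, (fun=> setT), (fun=> 0%N), (fun=> 0); split=> //.
    by split=> //; apply/seteqP; split=> v // _; exact: sz.
  move=> i _; exists 0%N, 1%:M, A; split=> //; split; rewrite ?map_mx1 ?mul1mx ?mulmx1 //.
    by exists 1%:M; rewrite mulmx1.
  by apply/seteqP; split=> v // _; exact: sz.
have [r' [F' [k' [G' [[F0 Fr] quoF subF slF bF]]]]] := IH Bi.
pose Fn i : set 'rV[S]_(r + s) := if i is j.+1 then [set v | F' j (rsubmx v)] else [set 0].
pose kn i := if i is j.+1 then k' j else r.
pose Gn i : 'M[S]_(kn i) := if i is j.+1 return 'M[S]_(kn i) then G' j else C.
exists r'.+1, Fn, kn, Gn; split.
- by split=> //; apply/seteqP; split=> v //= _; rewrite Fr.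
- move=> [_|i /quoF[l [q [B' [[qB [q' q'q] FE]] B'i]]]].
    exists (r + s)%N, 1%:M, (block_mx C 0 F B); split; last exact/E_invertible_block.
    split; rewrite ?map_mx1 ?mul1mx ?mulmx1 //; first by exists 1%:M; rewrite mulmx1.
    by apply/seteqP; split=> v /=; rewrite mulmx1.
  exists l, (col_mx 0 q), B'; split=> //; split.
  + by rewrite map_col_mx map_mx0 mul_col_mx mul0mx mul_block_col !mul0mx !mulmx0 !add0r qB.
  + by exists (row_mx 0 q'); rewrite mul_row_col mul0mx add0r.
  + by rewrite /= FE; apply/seteqP; split=> v /=; rewrite mul_col_mx0.
- move=> [_|i /subF[lt [m [J [B' [[JB [J' JJ'] FE] B'i [t [tG [t' t't] tE]]]]]] Gi ssG k0]].
    split=> //.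
    + split=> [v -> /=|h]; first by rewrite linear0 F0.
      pose v : 'rV[S]_(r + s) := row_mx (delta_mx 0 (Ordinal r0)) 0.
      have /h /= /rowP /(_ (lshift s (Ordinal r0))) : Fn 1%N v by rewrite /= row_mxKr F0.
      by rewrite row_mxEl !mxE !eqxx => /eqP; rewrite oner_eq0.
    + exists r, (row_mx 1%:M 0), C; split=> //; first split.
      * by rewrite map_row_mx map_mx1 map_mx0 mul_row_block mul_mx_row !mul1mx !mul0mx
          !addr0 mulmx1 mulmx0.
      * by exists (col_mx 1%:M 0); rewrite mul_row_col mulmx1 mulmx0 addr0.
      * apply/seteqP; split=> v /=; rewrite F0 /=; [move=> v0|move=> [w ->]].
          by exists (lsubmx v); rewrite mul_mx_row mulmx1 mulmx0 -v0 hsubmxK.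
        by rewrite mul_mx_row mulmx0 row_mxKr.
      exists 1%:M; split; rewrite ?map_mx1 ?mul1mx ?mulmx1 //; first by exists 1%:M; rewrite mulmx1.
      apply/seteqP; split=> v /=; rewrite mul_mx_row !mulmx1 mulmx0.
        by move/eqP; rewrite row_mx_eq0 => /andP[/eqP].
      by move=> ->; rewrite row_mx0.
  split=> //.
  + case: lt => sub nsub; split=> [v /sub//|h]; apply: nsub => v Fv.
    have /h /= : Fn i.+2 (row_mx 0 v) by rewrite /= row_mxKr.
    by rewrite row_mxKr.
  + exists (r + m)%N, (block_mx 1%:M 0 0 J), (block_mx C 0 (map_mx phi J *m F) B').
    split; first split.
    * rewrite map_block_mx !map_mx0 map_mx1 !mulmx_block !mul1mx !mul0mx !mulmx0 !mulmx1 !addr0 !add0r.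
      by rewrite JB.
    * exists (block_mx 1%:M 0 0 J').
      by rewrite mulmx_block !mul1mx !mul0mx !mulmx0 !addr0 !add0r JJ' -scalar_mx_block.
    * apply/seteqP; split=> v /=; rewrite FE /=; [move=> [w wE]|move=> [w ->]].
        exists (row_mx (lsubmx v) w).
        by rewrite mul_row_block !mulmx1 !mulmx0 addr0 add0r -wE hsubmxK.
      by exists (rsubmx w); rewrite -{1}[w]hsubmxK mul_row_block !mulmx0 add0r row_mxKr.
    * exact/E_invertible_block.
    exists (col_mx 0 t); split.
    * by rewrite map_col_mx map_mx0 mul_col_mx mul0mx mul_block_col !mul0mx !mulmx0 !add0r tG.
    * by exists (row_mx 0 t'); rewrite mul_row_col mul0mx add0r.
    have rv (v : 'rV[S]_(r + m)) : rsubmx (v *m block_mx 1%:M 0 0 J) = rsubmx v *m J.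
      by rewrite -{1}[v]hsubmxK mul_row_block !mulmx0 add0r row_mxKr.
    apply/seteqP; split=> v /=; rewrite rv mul_col_mx0.
      by move=> h; have : [set v | v *m t = 0] (rsubmx v) by rewrite -tE.
    by move=> h; have : [set v | F' i (v *m J)] (rsubmx v) by rewrite tE.
- move=> [|i] lt; last exact: slF.
  exact: bF.
by [].
Qed.

End HNData.

(** * From matrices to Kisin modules of type HN *)

Section TypeHN.
Variable D : kisin_base.
Local Notation S := (fps (Wk D)).
Local Notation E := (Ew D).
Local Notation phi := (phiW D).
Local Notation redS := (redS D).
Local Notation idS := (idS D).
Local Notation u := (fpsX (kf D)).
Local Notation semistable_mx := (@semistable_mx _ u (@phik D) S (rhoS D)).
Local Notation degm A := (val u (\det (map_mx (rhoS D) A))).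
Local Notation RVS := (RV idS).

Section Reduction.
Variable n : nat.
Definition red_row (v : RVS n) : RV redS n := map_mx redS (v : 'rV[S]_n).
Lemma red_row_linear : linear red_row.
Proof. by move=> a x y; rewrite /red_row RV_scale map_mxD map_mxZ. Qed.
HB.instance Definition _ := GRing.isLinear.Build (SS D) (RVS n) (RV redS n) *:%R
  red_row red_row_linear.
End Reduction.

(** The reduction modulo [p] of the model is the torsion model of the reduced matrix. *)
Lemma flat_model_semistable n (A : 'M[S]_n) a : E_invertible A -> semistable_mx A ->
  semistable_flat (flat_model A a).
Proof.
move=> [m [b db]] ssA.
have e1 : \det A * b = E ^+ m by [].
have rkE : redS (E ^+ m) = redS (ES D) ^+ m by rewrite rmorphXn.
have AB : map_mx redS A *m map_mx redS (b *: \adj A) = (redS (ES D) ^+ m)%:M.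
  by rewrite -map_mxM -scalemxAr mul_mx_adj scale_scalar_mx mulrC e1 map_scalar_mx -rkE.
have BA : map_mx redS (b *: \adj A) *m map_mx redS A = (redS (ES D) ^+ m)%:M.
  by rewrite -map_mxM -scalemxAl mul_adj_mx scale_scalar_mx mulrC e1 map_scalar_mx -rkE.
exists (tors_model (map_mx redS A) a), (@red_row n : {linear RVS n -> RV redS n}); split.
- split; first exact: tors_model_kisin AB BA.
  exists 1%N => x; rewrite RV_scale expr1 rmorph_nat pk0; exact: (scale0r (x : 'rV[fps (kf D)]_n)).
- split.
  + apply: pmod_morph => v; rewrite /= /red_row /row_frob map_mxM; congr (_ *m _).
    by apply/matrixP => i j; rewrite !mxE; exact: redS_phi.
  + apply/seteqP; split=> // v _; have [w wE] := choice (@redS_surj D).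
    exists (map_mx w (v : 'rV[fps (kf D)]_n) : RVS n) => //.
    by apply/matrixP => i j; rewrite !mxE wE.
  + apply/seteqP; split=> [v /= /matrixP v0|v /= [y ->]].
      have ker j : exists y : S, (v : 'rV[S]_n) 0 j = (res_char D)%:R * y.
        by apply/(fps_map_ker (Wk_strict D)); have := v0 0 j; rewrite !mxE.
      have [y yE] := choice ker; exists (\row_j y j : RVS n).
      by apply/rowP => j; rewrite RV_scale !mxE yE rmorph_nat.
    rewrite linearZ /= RV_scale rmorph_nat pk0; exact: (scale0r (red_row y : 'rV[fps (kf D)]_n)).
- exact: tors_model_semistable AB BA ssA.
Qed.

Lemma flat_model_slope n (A : 'M[S]_n) a : (0 < n)%N -> E_invertible A ->
  slope_flat (flat_model A a) = (degm A)%:R / (eE D)%:R / n%:R - a%:R.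
Proof.
move=> n0 /flat_model_kisin-/(_ a)[[_ _ _ bh] _].
exact: (slope_flatE (flat_model_id_bij A a) bh n0 (flat_model_matrix A a)).
Qed.

Lemma quo_mx_quo n (A : 'M[S]_n) P l (q : 'M[S]_(n, l)) B a :
  quo_mx A P q B -> is_quo (M := flat_model A a) (Q := flat_model B a) P (rmul q : {linear RVS n -> RVS l}).
Proof.
move=> [qB [q' q'q] ->]; split; first exact: rmul_morph.
  apply/seteqP; split=> // v _; exists ((v : 'rV[S]_l) *m q' : RVS n) => //.
  by rewrite /= /rmul -mulmxA q'q mulmx1.
by [].
Qed.

Lemma sub_mx_sub n (A : 'M[S]_n) P m (J : 'M[S]_(m, n)) B a :
  sub_mx A P J B -> is_sub (M := flat_model A a) (N := flat_model B a) P (rmul J : {linear RVS m -> RVS n}).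
Proof.
move=> [JB [J' JJ'] ->]; split; first exact: rmul_morph.
  move=> x y /= /(congr1 (mulmx^~ J')); rewrite /rmul -!mulmxA JJ' !mulmx1.
  by [].
apply/seteqP; split=> v /= [w]; first by move=> _ <-; exists w.
by move=> ->; exists w.
Qed.

Lemma quo_mx_strict n (A : 'M[S]_n) P l (q : 'M[S]_(n, l)) B a :
  quo_mx A P q B -> E_invertible B -> strict_flat (M := flat_model A a) P.
Proof.
move=> qQ Bi; have [qB _ PE] := qQ; split.
- rewrite PE; split=> [|c x y /= x0 y0]; first exact: mul0mx.
  by rewrite mulmxDl -scalemxAl x0 y0 scaler0 addr0.
(* The Frobenius of the model carries [tinv^a]; multiplied by [E^a] it leaves the constant
   [c0^a]. *)
- move=> v Pv; exists a, (fpsC (Eis_c0 D) ^+ a *: (row_frob phi A (v : RVS n) : RVS n)); split.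
    rewrite PE in Pv *; rewrite /= -scalemxAl /row_frob -mulmxA -qB mulmxA -map_mxM.
    by rewrite [v *m q]Pv map_mx0 mul0mx scaler0.
  rewrite [frob _ _]pmod_frob scalerA rmorphXn -exprMn E_tinv -rmorphXn.
  by rewrite [RHS]bc1Z.
- by exists (flat_model B a), (rmul q : {linear RVS n -> RVS l}); split;
    [exact: flat_model_kisin | exact: quo_mx_quo qQ].
Qed.

Lemma HN_data_type n (A : 'M[S]_n) b a : HN_data A b -> type_HN (flat_model A a).
Proof.
move=> [r [F [k [G [[F0 Fr] quoF subF slF _]]]]].
exists r, F, (fun i => flat_model (G i) a); split=> //.
- by move=> i /quoF[l [q [B [qB Bi]]]]; exact: quo_mx_strict qB Bi.
- move=> i /subF[lt [m [J [B [JB Bi [t tG]]]]] Gi ssG k0]; split=> //.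
  + exists (flat_model B a), (rmul J : {linear RVS m -> RVS n}), (rmul t : {linear RVS m -> RVS (k i)}).
    by split; [have [] := flat_model_kisin a Bi | exact: sub_mx_sub JB | exact: quo_mx_quo tG].
  + exact: flat_model_kisin.
  + exact: flat_model_semistable.
- move=> i lt; have [_ _ Gi _ k0] := subF i (ltnW lt).
  have [_ _ Gi1 _ k1] := subF i.+1 lt.
  rewrite !flat_model_slope // ltrBlDr subrK.
  have kR : (0 : rat) < (k i)%:R by rewrite ltr0n.
  have k1R : (0 : rat) < (k i.+1)%:R by rewrite ltr0n.
  have eR : (0 : rat) < (eE D)%:R by rewrite ltr0n eE_gt0.
  rewrite ltr_pdivrMr // mulrAC ltr_pdivlMr // mulrAC [X in _ < X]mulrAC.
  by rewrite ltr_pM2r ?invr_gt0 // -!natrM ltr_nat slF.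
Qed.

End TypeHN.

Theorem theorem6p4p3 (D : kisin_base) (M : phi_module D) :
  flat_kisin M ->
  exists N : phi_module D, flat_kisin N /\ isogenous M N /\ type_HN N.
Proof.
move=> flM; have [n [A [a [Ai [f isof]]]]] := exists_flat_model flM.
have [A' [sAA' HNA']] := base_exists_HN Ai.
have A'i := sublattice_E_invertible sAA' Ai.
have [g isog] := sublattice_isogeny a sAA'.
have fA := flat_model_kisin a Ai; have fA' := flat_model_kisin a A'i.
exists (flat_model A' a); split=> //; split; last exact: HN_data_type (mx_HN_data HNA' A'i).
(* Both isogenies point towards [M], from the model of [A'] to that of [A] and on to [M]. *)
apply: (rst_trans _ _ _ (flat_model A a)); apply: rst_sym; apply: rst_step.
  by split=> //; exists f.
by split=> //; exists g.
Qed.
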